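(* Let $F$ be a field and let $(A,\sigma)$ be an $F$-algebra with involution such that $1\in\operatorname{Symd}(\sigma)$ and $\operatorname{cap}(A,\sigma)=4$. Let $L$ be a biquadratic neat $F$-subalgebra of $(A,\sigma)$, and let $K$ be a quadratic neat $F$-subalgebra of $(A,\sigma)$ contained in $L$. The following conditions are equivalent: (i) $\mathfrak P_{\sigma,L}$ is hyperbolic. (ii) $(A,\sigma)$ is decomposable along $L$. (iii) $(A,\sigma)$ is decomposable along $K$.
   Context: An $F$-algebra with involution is a pair $(A,\sigma)$ of a finite-dimensional $F$-algebra $A$ and an $F$-linear anti-automorphism $\sigma$ of $A$ with $\sigma^2=\operatorname{id}_A$ such that $F=\operatorname{Z}(A)\cap\operatorname{Sym}(\sigma)$ and $A$ has no nontrivial two-sided ideals $I$ with $\sigma(I)=I$. Here $\operatorname{Sym}(\sigma)=\{x\in A\mid\sigma(x)=x\}$ and $\operatorname{Symd}(\sigma)=\{x+\sigma(x)\mid x\in A\}$. Either $\operatorname{Z}(A)=F$, and then $\sigma$ is orthogonal (resp. symplectic) if over a splitting field it is adjoint to a nondegenerate diagonalisable symmetric (resp. alternating) bilinear form; or $\operatorname{Z}(A)$ is a quadratic étale $F$-algebra on which $\sigma$ is the nontrivial automorphism, and then $\sigma$ is unitary. If $\operatorname{Z}(A)\simeq F\times F$, then $(A,\sigma)\simeq(A_0\times A_0^{\mathrm{op}},\mathrm{sw})$ with $A_0$ central simple over $F$ and $\mathrm{sw}$ the switch, and $\deg A:=\deg A_0$; otherwise $\deg A$ is the degree over $\operatorname{Z}(A)$.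 The capacity is $\operatorname{cap}(A,\sigma)=\deg A$ if $\sigma$ is orthogonal or unitary, and $\frac12\deg A$ if $\sigma$ is symplectic. An $F$-subalgebra $L$ of $A$ is neat in $(A,\sigma)$ if $L$ is étale over $F$, $L\subseteq\operatorname{Sym}(\sigma)$, $A$ is free as a left $L$-module, and for all primitive idempotents $e$ of $L$ the algebras with involution $(eAe,\sigma|_{eAe})$ have the same degree and the same type (which is the type of $\sigma$). It is quadratic if $\dim_F L=2$, and biquadratic if it is isomorphic to a tensor product of two quadratic $F$-algebras. The Galois group of an étale biquadratic $F$-algebra $L$ consists of $\operatorname{id}_L$ and the three $F$-automorphisms $\gamma$ of order two for which $L^\gamma=\{x\in L\mid\gamma(x)=x\}$ is a quadratic étale $F$-algebra. The form $\mathfrak P_{\sigma,L}$: let $n=\log_2\dim_FA-3\in\{1,2,3\}$, let $\{\operatorname{id}_L,\gamma_1,\gamma_2,\gamma_3\}$ be the Galois group of $L/F$, let $W_i=\{x\in\operatorname{Symd}(\sigma)\mid yx=x\gamma_i(y)\ \forall y\in L\}$ and let $s_i\colon L^{\gamma_i}\to F$ be an $F$-linear form with $\ker(s_i)=F$. For $x\in W_i$ one has $x^2\in L^{\gamma_i}$, and the quadratic forms $q_i\colon W_i\to F$, $x\mapsto s_i(x^2)$ $(i=1,2,3)$ are all similar to one and the same quadratic $n$-fold Pfister form, which is unique up to isometry and independent of the choice of the $s_i$; this Pfister form is $\mathfrak P_{\sigma,L}$. (A quadratic $1$-fold Pfister form is the norm form of a quadratic étale $F$-algebra; a quadratic $n$-fold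 Pfister form is the tensor product of $n-1$ bilinear forms $\langle1,-a_i\rangle$, $a_i\in F^\times$, with a quadratic $1$-fold Pfister form.) Central simple $F$-subalgebras of $A$ are independent if they centralize one another. A subalgebra $B$ is $\sigma$-stable if $\sigma(B)=B$. For an étale $F$-subalgebra $M\subseteq\operatorname{Sym}(\sigma)$, $(A,\sigma)$ is decomposable along $M$ if $[M:F]=2^r$ for some $r$ and there are independent $\sigma$-stable $F$-quaternion subalgebras $Q_1,\dots,Q_r$ of $A$ such that $Q_i\cap M$ is a quadratic $F$-algebra for $1\le i\le r$. *)

(* Defs.v *)
From HB Require Import structures.
From mathcomp Require Import all_boot all_order all_algebra all_field.

Set Implicit Arguments.
Unset Strict Implicit.
Unset Printing Implicit Defensive.

Import GRing.Theory.
Local Open Scope ring_scope.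

(* An F-subalgebra of A is an {aspace A} containing 1; an {aspace A} in general
   carries its own identity algid, and is used below for corners e A e. *)

Definition two_sided_ideal (F : fieldType) (A : falgType F) (I : {vspace A}) :=
  ({:A} * I <= I)%VS /\ (I * {:A} <= I)%VS.

Definition central_simple (F : fieldType) (A : falgType F) : Prop :=
  'Z({:A})%VS = 1%VS /\
  forall I : {vspace A}, two_sided_ideal I -> I = 0%VS \/ I = fullv.

(* Isomorphic to a finite product of finite separable field extensions of F. *)
Definition etale (F : fieldType) (B : falgType F) : Prop :=
  exists (r : nat) (E : 'I_r -> fieldExtType F) (f : forall i, 'AHom(B, E i)),
    (forall i, separable 1%VS {:E i}) /\
    (forall y : (forall i, E i), exists! x : B, forall i, f i x = y i).

Definition quadratic_etale (F : fieldType) (B : falgType F) : Prop :=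
  \dim {:B} = 2 /\ etale B.

Section Involution.

Variables (F : fieldType) (A : falgType F) (sigma : 'End(A)).

Definition Sym : {vspace A} := fixedSpace sigma.
Definition Symd : {vspace A} := limg (\1 + sigma)%VF.

Definition algebra_with_involution : Prop :=
  [/\ forall x y, sigma (x * y) = sigma y * sigma x,
      forall x, sigma (sigma x) = x,
      ('Z({:A}) :&: Sym)%VS = 1%VS
    & forall I : {vspace A}, two_sided_ideal I -> (sigma @: I)%VS = I ->
        I = 0%VS \/ I = fullv].

(* phi : A -> M_n(E) is semilinear along iota : F -> E, and induces an
   isomorphism of E-algebras between A (x)_F E and M_n(E). *)
Definition splitting (E : fieldType) (iota : {rmorphism F -> E}) (n : nat)
    (phi : A -> 'M[E]_n) : Prop :=
  [/\ {morph phi : x y / x + y},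
      forall a x, phi (a *: x) = iota a *: phi x,
      phi 1 = 1%:M,
      forall x y, phi (x * y) = phi x *m phi y
    & basis_of fullv (map phi (vbasis {:A}))].

Definition adjoint_to (E : fieldType) (n : nat) (phi : A -> 'M[E]_n)
    (b : {biscalar 'cV[E]_n}) : Prop :=
  forall x u v, b (phi x *m u) v = b u (phi (sigma x) *m v).

Definition nondegenerate_form (E : fieldType) (n : nat)
    (b : {biscalar 'cV[E]_n}) : Prop :=
  forall u, (forall v, b u v = 0) -> u = 0.

Definition diagonalisable_form (E : fieldType) (n : nat)
    (b : {biscalar 'cV[E]_n}) : Prop :=
  exists P : 'M[E]_n, P \in unitmx /\
    forall i j, i != j -> b (col i P) (col j P) = 0.

Definition symmetric_form (E : fieldType) (n : nat)
    (b : {biscalar 'cV[E]_n}) : Prop := forall u v, b u v = b v u.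

Definition alternating_form (E : fieldType) (n : nat)
    (b : {biscalar 'cV[E]_n}) : Prop := forall u, b u u = 0.

Definition orthogonal_involution : Prop :=
  'Z({:A})%VS = 1%VS /\
  exists (E : fieldType) (iota : {rmorphism F -> E}) (n : nat)
    (phi : A -> 'M[E]_n) (b : {biscalar 'cV[E]_n}),
    [/\ splitting iota phi, adjoint_to phi b, nondegenerate_form b,
        symmetric_form b & diagonalisable_form b].

Definition symplectic_involution : Prop :=
  'Z({:A})%VS = 1%VS /\
  exists (E : fieldType) (iota : {rmorphism F -> E}) (n : nat)
    (phi : A -> 'M[E]_n) (b : {biscalar 'cV[E]_n}),
    [/\ splitting iota phi, adjoint_to phi b, nondegenerate_form b
      & alternating_form b].

Definition unitary_involution : Prop :=
  quadratic_etale (subvs_of 'Z({:A})%AS) /\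
  exists2 z, z \in 'Z({:A})%VS & sigma z != z.

Inductive involution_type := Orthogonal | Symplectic | Unitary.

Definition has_type (t : involution_type) : Prop :=
  match t with
  | Orthogonal => orthogonal_involution
  | Symplectic => symplectic_involution
  | Unitary => unitary_involution
  end.

(* The first alternative is the case where the centre is F x F: an isomorphism
   from (A, sigma) to (A0 x A0^op, sw) has the form x |-> (f x, f (sigma x)). *)
Definition has_degree (n : nat) : Prop :=
  (exists (A0 : falgType F) (f : 'AHom(A, A0)),
     [/\ central_simple A0, bijective (fun x => (f x, f (sigma x)))
       & \dim {:A0} = (n ^ 2)%N]) \/
  ((forall z, z \in 'Z({:A})%VS -> z != 0 -> z \is a GRing.unit) /\
   \dim {:A} = (n ^ 2 * \dim 'Z({:A}))%N).

Definition has_capacity (c : nat) : Prop :=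
  ((orthogonal_involution \/ unitary_involution) /\ has_degree c) \/
  (symplectic_involution /\ has_degree c.*2).

End Involution.

Section Corner.

Variables (F : fieldType) (A : falgType F).

Definition corner_vspace (e : A) : {vspace A} :=
  limg (amull e \o amulr e)%VF.

Lemma corner_is_aspace (e : A) :
  e * e = e -> e != 0 -> is_aspace (corner_vspace e).
Proof.
move=> e2 e0; have lE x : (amull e \o amulr e)%VF x = e * (x * e).
  by rewrite comp_lfunE !lfunE.
apply/andP; split.
  apply/has_algidP; exists e; split=> //.
    by apply/memv_imgP; exists e; rewrite ?memvf // lE !e2.
  by move=> u /memv_imgP[x _ ->]; rewrite lE -!mulrA e2 !mulrA e2.
apply/prodvP=> u v /memv_imgP[x _ ->] /memv_imgP[y _ ->].
by apply/memv_imgP; exists (x * e * (e * y)); rewrite ?memvf // !lE !mulrA.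
Qed.

Definition corner (e : A) (e_idem : e * e = e) (e_neq0 : e != 0) : {aspace A} :=
  ASpace (corner_is_aspace e_idem e_neq0).

(* Meaningful when sigma maps B into B; vsproj is then the inverse of vsval. *)
Definition restrict_end (sigma : 'End(A)) (B : {aspace A}) :
    'End(subvs_of B) :=
  (linfun (vsproj B) \o sigma \o linfun vsval)%VF.

Definition free_left_module (L : {aspace A}) : Prop :=
  exists (m : nat) (b : 'I_m -> A), forall x : A,
    exists! l : {ffun 'I_m -> subvs_of L}, x = \sum_i vsval (l i) * b i.

(* For L commutative. *)
Definition primitive_idempotent (L : {aspace A}) (e : A) : Prop :=
  [/\ e \in L, e * e = e, e != 0
    & forall f g, f \in L -> g \in L -> f * f = f -> g * g = g ->
        f * g = 0 -> g * f = 0 -> e = f + g -> f = 0 \/ g = 0].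

Definition neat (sigma : 'End(A)) (L : {aspace A}) : Prop :=
  [/\ 1 \in L, etale (subvs_of L), (L <= Sym sigma)%VS, free_left_module L
    & exists (d : nat) (t : involution_type), has_type sigma t /\
      forall (e : A) (e_idem : e * e = e) (e_neq0 : e != 0),
        primitive_idempotent L e ->
        has_degree (restrict_end sigma (corner e_idem e_neq0)) d /\
        has_type (restrict_end sigma (corner e_idem e_neq0)) t].

Definition quadratic (L : {vspace A}) : Prop := \dim L = 2.

(* L is the tensor product of L1 and L2: they commute, and the product map from
   L1 (x) L2 to L is surjective between spaces of dimension 4. *)
Definition biquadratic (L : {aspace A}) : Prop :=
  \dim L = 4 /\
  exists L1 L2 : {aspace A},
    [/\ (1 \in L1) && (1 \in L2), quadratic L1, quadratic L2,
        (L1 <= 'C(L2))%VS & (L1 * L2)%VS = L :> {vspace A}].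

Definition quaternion_subalgebra (Q : {aspace A}) : Prop :=
  [/\ 1 \in Q, central_simple (subvs_of Q) & \dim Q = 4].

Definition decomposable_along (sigma : 'End(A)) (M : {aspace A}) : Prop :=
  exists (r : nat) (Q : 'I_r -> {aspace A}),
    [/\ \dim M = (2 ^ r)%N,
        forall i, quaternion_subalgebra (Q i),
        forall i, (sigma @: Q i)%VS = Q i,
        forall i j, i != j -> (Q i <= 'C(Q j))%VS
      & forall i, quadratic (Q i :&: M)%VS].

End Corner.

Section QuadraticForms.

Variable F : fieldType.

Definition isometric (V W : vectType F) (q : V -> F) (q' : W -> F) : Prop :=
  exists f : 'Hom(V, W), bijective f /\ forall v, q' (f v) = q v.

Definition similar (V W : vectType F) (q : V -> F) (q' : W -> F) : Prop :=
  exists2 c : F, c != 0 & isometric (fun v => c * q v) q'.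

Definition hyperbolic (V : vectType F) (q : V -> F) : Prop :=
  exists m : nat,
    isometric q (fun p : 'rV[F]_m * 'rV[F]_m => \sum_i p.1 0 i * p.2 0 i).

Definition alg_norm (K : falgType F) (x : K) : F :=
  \det (\matrix_(i, j) coord (vbasis {:K}) j (x * (vbasis {:K})`_i)).

(* The tensor product of the bilinear form <1, -a> with q. *)
Definition pfister_mul (a : F) (V : vectType F) (q : V -> F) (p : V * V) : F :=
  q p.1 - a * q p.2.

Fixpoint pfister (n : nat) (V : vectType F) (q : V -> F) : Prop :=
  match n with
  | 0 => False
  | 1 => exists K : falgType F,
           quadratic_etale K /\ isometric q (@alg_norm K)
  | n'.+1 => exists (a : F) (W : vectType F) (p : W -> F),
           [/\ a != 0, pfister n' p & isometric q (pfister_mul a p)]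
  end.

End QuadraticForms.

Section PfisterForm.

Variables (F : fieldType) (A : falgType F) (sigma : 'End(A)) (L : {aspace A}).

(* The Galois group of L / F consists of the identity and of these g. *)
Definition galois_involution (g : 'AEnd(subvs_of L)) : Prop :=
  [/\ exists x, g x != x, forall x, g (g x) = x
    & quadratic_etale (subvs_of (fixedSpace_aspace g))].

Definition Wspace (g : 'AEnd(subvs_of L)) : {vspace A} :=
  let y := tnth (vbasis {:subvs_of L}) in
  (Symd sigma :&:
    \bigcap_i lker (amull (vsval (y i)) - amulr (vsval (g (y i)))))%VS.

Lemma WspaceP (g : 'AEnd(subvs_of L)) (x : A) :
  x \in Wspace g <->
  x \in Symd sigma /\ forall y : subvs_of L, vsval y * x = x * vsval (g y).
Proof.
rewrite /Wspace memv_cap; split=> [/andP[Sx /subv_bigcapP xW] | [Sx xW]].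
  split=> // y; rewrite (coord_vbasis (memvf y)) !linear_sum mulr_suml mulr_sumr.
  apply: eq_bigr => i _; rewrite !linearZ /= -scalerAl -scalerAr.
  congr (_ *: _); have := xW i isT; rewrite -memvE memv_ker !lfun_simp /= subr_eq0.
  by rewrite (tnth_nth 0) => /eqP.
rewrite Sx /=; apply/subv_bigcapP => i _.
by rewrite -memvE memv_ker !lfun_simp /= subr_eq0 xW.
Qed.

(* The form x |-> s (x ^ 2) on Wspace g. As x ^ 2 lies in the fixed space of g,
   the projections vsproj only regard it as an element of that space. *)
Definition Wform (g : 'AEnd(subvs_of L))
    (s : 'Hom(subvs_of (fixedSpace_aspace g), F^o))
    (x : subvs_of (Wspace g)) : F :=
  s (vsproj (fixedSpace_aspace g) (vsproj L (vsval x ^+ 2))).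

(* P is the Pfister form attached to (sigma, L), which is unique only up to
   isometry: hence a relation rather than a function of (sigma, L). *)
Definition is_Pfister_form (V : vectType F) (P : V -> F) : Prop :=
  pfister (trunc_log 2 (\dim {:A}) - 3) P /\
  forall (g : 'AEnd(subvs_of L))
         (s : 'Hom(subvs_of (fixedSpace_aspace g), F^o)),
    galois_involution g -> lker s = 1%VS -> similar (Wform s) P.

Definition Pfister_form_hyperbolic : Prop :=
  exists (V : vectType F) (P : V -> F), is_Pfister_form P /\ hyperbolic P.

End PfisterForm.

(* Main.v *)
Require Import Defs.
From HB Require Import structures.
From mathcomp Require Import all_boot all_order all_algebra all_field.
From mathcomp Require Import ring zify.

Set Implicit Arguments.
Unset Strict Implicit.
Unset Printing Implicit Defensive.

Import GRing.Theory.
Local Open Scope ring_scope.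

(** Why the theorem is true.  In every characteristic [L] has generators [u] and
    [u'] with [u ^ 2 = u + c], [u' ^ 2 = u' + c'] and [1 + 4 c], [1 + 4 c'] not
    zero, and by [neat_pair] they can be chosen with [K = F[u]]; this is where
    the freeness of [A] over [K] and [L] matters.  Let [W (u, u')] be the space
    of the symmetrized elements that commute with [u] and flip [u'], that is,
    exchange it with [1 - u'].  All three conditions are shown to be equivalent
    to the existence of a decomposing pair: commuting elements [x] of
    [W (u, u')] and [v] of [W (u', u)] whose squares are nonzero scalars.

    Such a pair gives the stable quaternion algebras generated by [u], [v] and
    by [u'], [x], so that [A] decomposes along [L] and, with the first algebra
    alone, along [K].  It also makes the form on [W (u, u')] hyperbolic
    ([decomposing_hyperbolic]): this space is [T + u T], where [T] consists of
    elements with scalar square, and the form vanishes on [T].  The forms for the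
    two other automorphisms of [L] are treated by changing the generators
    ([galois_pair]), and a hyperbolic form of dimension [2 ^ n] is a Pfister
    form.

    Conversely, an [x] in [W (u, u')] with [x ^ 2] a nonzero scalar is enough to
    find [v] ([W_decomposing]).  If the Pfister form is hyperbolic, the form on
    [W (u, u')] is isotropic, and an isotropic vector has a scalar square; if
    this square is zero, the nondegeneracy of [x |-> x ^ 2] on [W (u, u')]
    allows to modify the vector ([W_invertible_square]).  If a stable quaternion
    algebra contains [u], it contains an element [v] flipping [u], with a nonzero
    scalar square, and [x] is found by descent to the centralizer of [v]
    ([quaternion_W_square]).  This covers both decompositions along [K] and
    decompositions along [L], the latter for generators adapted to the given
    quaternion algebras.

    These arguments use three properties of [A], collected in
    [symmetric_frame]: [A] is semiprime; [F]-independent elements of [L] are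
    independent over the centre, whence by the Artin-Whaples argument
    ([center_free_tensor]) no nontrivial relation [sum_i a_i x b_i = 0] holds
    for all [x]; and a symmetrized element that commutes with [L] is in [L].
    The last one depends on the type.  In the orthogonal and unitary cases [L]
    generates with the centre a commutative reduced subalgebra of maximal
    dimension, which is its own centralizer ([self_centralizing]).  In the
    symplectic case [L] has half the maximal dimension: over an extension that
    splits [A] and [L], each of the four primitive idempotents of [L] has rank
    two, and a symmetrized element induces on its image an operator that is
    alternating for a form of rank two, hence a scalar ([split_alternating]). *)

(** * Ideals, central idempotents and tensors over the centre *)

Section CoordFunctional.

Variables (F : fieldType) (V : vectType F).

Definition vcoord (i : 'I_(\dim {:V})) (x : V) : F := coord (vbasis {:V}) i x.

Lemma vcoordD i x y : vcoord i (x + y) = vcoord i x + vcoord i y.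
Proof. exact: linearD. Qed.
Lemma vcoordN i x : vcoord i (- x) = - vcoord i x.
Proof. exact: linearN. Qed.
Lemma vcoordZ i a x : vcoord i (a *: x) = a * vcoord i x.
Proof. exact: linearZ. Qed.
Lemma vcoord0 i : vcoord i 0 = 0.
Proof. exact: linear0. Qed.
Lemma vcoord_inj x y : (forall i, vcoord i x = vcoord i y) -> x = y.
Proof.
move=> e; rewrite (coord_vbasis (memvf x)) (coord_vbasis (memvf y)).
by apply: eq_bigr => i _; congr (_ *: _); apply: e.
Qed.

End CoordFunctional.

(** Identities in a noncommutative algebra, linear over a commutative field: the
    products are expanded, and the coordinates of both sides are compared by the
    tactic for commutative rings, the words in the algebra being atoms. *)
Ltac nc_expand :=
  match goal with |- context [@eq ?T _ _] =>
    rewrite ?(@mulrDl T, @mulrDr T, @mulrN T, @mulNr T, @mul1r T, @mulr1 T,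
      @mul0r T, @mulr0 T, @mulr2n T, scaler0, scalerDr, scalerN, scalerA,
      @mulrA T, =^~ scalerAl, =^~ scalerAr)
  end.
Ltac nc_solve :=
  apply: vcoord_inj => ?; rewrite ?(vcoordD, vcoordN, vcoordZ, vcoord0); ring.
Ltac nc := nc_expand; nc_solve.

Section CentralIdempotents.

Variables (F : fieldType) (A : falgType F).
Implicit Types (x y z e : A) (U V : {vspace A}).

Lemma centerP z :
  reflect (forall y, z * y = y * z) (z \in 'Z({:A})%VS).
Proof.
rewrite memv_cap memvf; apply: (iffP centvP) => cz y; last by move=> _; apply: cz.
by apply: cz; rewrite memvf.
Qed.

Lemma mem1vP x : reflect (exists a, x = a%:A) (x \in 1%VS).
Proof. exact: vlineP. Qed.

Lemma prodv_ind U V (P : A -> Prop) :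
    P 0 -> (forall x y, P x -> P y -> P (x + y)) ->
    (forall x y, x \in U -> y \in V -> P (x * y)) ->
  forall w, w \in (U * V)%VS -> P w.
Proof.
move=> P0 PD PM w; rewrite /prodv unlock => wUV.
rewrite (@coord_span _ _ _ (in_tuple _) _ wUV).
elim/big_ind: _ => // i _.
have /allpairsP[[x y] /= [xU yV ->]] := mem_nth 0 (ltn_ord i).
by rewrite scalerAl; apply: PM; rewrite ?memvZ // vbasis_mem.
Qed.

Definition principal_ideal x : {vspace A} := ({:A} * <[x]> * {:A})%VS.

Lemma principal_ideal_ind x (P : A -> Prop) :
    P 0 -> (forall y z, P y -> P z -> P (y + z)) ->
    (forall y z, P (y * x * z)) ->
  forall w, w \in principal_ideal x -> P w.
Proof.
move=> P0 PD PM; apply: prodv_ind => // w z + _; move: w.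
apply: prodv_ind => [|w w' Pw Pw'|y _ _ /vlineP[a ->]].
- by rewrite mul0r.
- by rewrite mulrDl; apply: PD.
by rewrite -scalerAr scalerAl.
Qed.

Lemma mem_principal_ideal x y z : y * x * z \in principal_ideal x.
Proof. by rewrite !memv_mul ?memvf ?memv_line. Qed.

Lemma two_sided_idealP (I : {vspace A}) :
  two_sided_ideal I <-> forall x y, x \in I -> y * x \in I /\ x * y \in I.
Proof.
split=> [[/prodvP lI /prodvP rI] x y xI | iI]; first by rewrite lI ?rI ?memvf.
by split; apply/prodvP=> x y xI yI; [have [] := iI y x yI | have [] := iI x y xI].
Qed.

Lemma principal_ideal_two_sided x : two_sided_ideal (principal_ideal x).
Proof.
apply/two_sided_idealP => w y.
move: w; apply: principal_ideal_ind => [|w w' [h1 h2] [h3 h4]|z z'].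
- by rewrite mul0r mulr0 mem0v.
- by rewrite mulrDl mulrDr !memvD.
by rewrite -(mulrA (z * x)) 2!mulrA; split; apply: mem_principal_ideal.
Qed.

(** What survives of simplicity for an algebra that is only simple as an
    algebra with involution: it covers both the simple algebras and the products
    of two simple algebras exchanged by the involution. *)
Definition central_idempotents_generate : Prop :=
  forall x, x != 0 -> exists e,
    [/\ e \in principal_ideal x, e \in 'Z({:A})%VS, e * e = e & e != 0].

Lemma central_simple_idempotents :
  central_simple A -> central_idempotents_generate.
Proof.
move=> [_ simA] x x0; exists 1; split; rewrite ?mulr1 ?oner_neq0 //; last first.
  by apply/centerP=> y; rewrite mul1r mulr1.
have [I0|->] := simA _ (principal_ideal_two_sided x); last exact: memvf.
have := mem_principal_ideal x 1 1; rewrite I0 mul1r mulr1 memv0.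
by rewrite (negPf x0).
Qed.

(** For [I] the ideal generated by [x], both [I] meet [sigma I] and [I + sigma I]
    are stable under [sigma]; so either [I = A], or [A] is the direct sum of [I]
    and [sigma I], and the component of [1] in [I] is the idempotent. *)
Lemma involution_idempotents (sigma : 'End(A)) :
  algebra_with_involution sigma -> central_idempotents_generate.
Proof.
move=> [sM sK _ simA] x x0; set I := principal_ideal x.
have /two_sided_idealP iI := principal_ideal_two_sided x.
have xI : x \in I by have := mem_principal_ideal x 1 1; rewrite mul1r mulr1.
have sI : two_sided_ideal (sigma @: I)%VS.
  apply/two_sided_idealP => _ y /memv_imgP[w wI ->].
  have [h1 h2] := iI w (sigma y) wI.
  by split; apply/memv_imgP; [exists (w * sigma y) | exists (sigma y * w)];
    rewrite // sM sK.
have /two_sided_idealP isI := sI.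
have ssI : (sigma @: (sigma @: I) = I)%VS.
  rewrite -limg_comp -[RHS]lim1g; congr (_ @: _)%VS.
  by apply/lfunP=> w; rewrite comp_lfunE id_lfunE sK.
have [||C0|C1] := simA (I :&: sigma @: I)%VS.
- apply/two_sided_idealP => w y; rewrite !memv_cap => /andP[wI wsI].
  by have [-> ->] := iI w y wI; have [-> ->] := isI w y wsI.
- apply/eqP; rewrite eqEsubv.
  have sub : (sigma @: (I :&: sigma @: I) <= I :&: sigma @: I)%VS.
    by rewrite subv_cap -[X in (_ <= X)%VS && _]ssI !limgS ?capvSl ?capvSr.
  rewrite sub /=; apply/subvP=> w wI; apply/memv_imgP; exists (sigma w).
    by apply: (subvP sub); apply: memv_img.
  by rewrite sK.
- have [||S0|S1] := simA (I + sigma @: I)%VS.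
  + apply/two_sided_idealP => _ y /memv_addP[w wI [w' wI' ->]].
    rewrite mulrDl mulrDr; have [h1 h2] := iI w y wI; have [h3 h4] := isI w' y wI'.
    by rewrite !memv_add.
  + by rewrite limgD ssI addvC.
  + have : x \in (I + sigma @: I)%VS by rewrite (subvP (addvSl _ _)).
    by rewrite S0 memv0 (negPf x0).
  have : 1 \in (I + sigma @: I)%VS by rewrite S1 memvf.
  case/memv_addP=> e eI [f fI ef].
  have I0 w : w \in I -> w \in (sigma @: I)%VS -> w = 0.
    by move=> wI wsI; apply/eqP; rewrite -memv0 -C0 memv_cap wI.
  have ce y : e * y = y * e.
    apply/eqP; rewrite -subr_eq0; apply/eqP/I0.
      by have [h1 h2] := iI e y eI; rewrite memvB.
    have -> : e = 1 - f by rewrite ef addrK.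
    rewrite mulrBl mulrBr mul1r mulr1 opprB addrC addrA subrK.
    by have [h1 h2] := isI f y fI; rewrite memvB.
  have e2 : e * e = e.
    rewrite -[in RHS](mulr1 e) ef mulrDr [e * f]I0 ?addr0 //.
      by have [] := iI e f eI.
    by have [] := isI f e fI.
  exists e; split=> //; first exact/centerP.
  apply/eqP=> e0; move: ef; rewrite e0 add0r => f1.
  have sx : sigma x \in (sigma @: I)%VS by apply: memv_img.
  have : x = 0; last by apply/eqP.
  apply: I0 => //; have [+ _] := isI f x fI.
  by rewrite -f1 mulr1.
have /subvP/(_ 1 (memvf 1)) : ({:A} <= I)%VS by rewrite -C1 capvSl.
exists 1; split; rewrite ?mulr1 ?oner_neq0 //.
by apply/centerP=> y; rewrite mul1r mulr1.
Qed.

Definition semiprime (B : {vspace A}) : Prop :=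
  forall x, x \in B -> (forall w, w \in B -> x * w * x = 0) -> x = 0.

Lemma semiprime_fullv : central_idempotents_generate -> semiprime {:A}.
Proof.
move=> genA x _ xAx; apply/eqP; apply: contraT => /genA[e [eI _ e2 e0]].
have x_e y : x * y * e = 0.
  move: e eI {e2 e0}.
  apply: principal_ideal_ind => [|w w' h1 h2|z z']; rewrite ?mulr0 //.
    by rewrite mulrDr h1 h2 addr0.
  by rewrite !mulrA -(mulrA x y) xAx ?memvf // mul0r.
suff e_e : forall w, w \in principal_ideal x -> w * e = 0.
  by move: e0; rewrite -e2 e_e ?eqxx.
apply: principal_ideal_ind => [|w w' h1 h2|z z']; rewrite ?mul0r //.
  by rewrite mulrDl h1 h2 addr0.
by rewrite -!mulrA (mulrA x) x_e mulr0.
Qed.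

(** The Artin-Whaples argument. Relations [sum_i a_i x b_i = 0] form a
    bimodule, so a nonzero leading coefficient may be replaced by a nonzero
    central one [e]; commuting such a relation with any [d] kills the leading
    term, so that by induction all its coefficients are central, and [x = 1]
    contradicts the independence of the [b_i]. *)
Lemma center_free_tensor n (b : 'I_n -> A) :
    central_idempotents_generate ->
    (forall z : 'I_n -> A, (forall i, z i \in 'Z({:A})%VS) ->
       \sum_i z i * b i = 0 -> forall i, z i = 0) ->
  forall a : 'I_n -> A, (forall x, \sum_i a i * x * b i = 0) ->
  forall i, a i = 0.
Proof.
move=> genA; elim: n b => [|n IHn] b b_free a ab0; first by case.
have tail_free (z : 'I_n -> A) : (forall i, z i \in 'Z({:A})%VS) ->
    \sum_i z i * b (lift ord0 i) = 0 -> forall i, z i = 0.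
  move=> zZ z0 i; pose z' j := oapp z 0 (unlift ord0 j).
  rewrite -[z i]/(oapp z 0 (Some i)) -(liftK ord0 i) -/(z' _).
  apply: b_free => [j|]; first by rewrite /z'; case: unliftP => [k _|_] //=; rewrite mem0v.
  rewrite big_ord_recl {1}/z' unlift_none mul0r add0r -[RHS]z0.
  by apply: eq_bigr => j _; rewrite /z' liftK.
have IH a' : (forall x, \sum_i a' i * x * b i = 0) -> a' ord0 = 0 ->
    forall i, a' i = 0.
  move=> ab' a0 i; case: (unliftP ord0 i) => [j ->|-> //].
  apply: (IHn _ tail_free (fun j => a' (lift ord0 j))) => x.
  by have := ab' x; rewrite big_ord_recl a0 !mul0r add0r.
apply: (IH a) => //; apply/eqP; apply: contraT => /genA[e [eI /centerP eZ _ e0]].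
have [a' ab' a'0] : exists2 a', (forall x, \sum_i a' i * x * b i = 0)
    & a' ord0 = e.
  move: e eI {eZ e0}; apply: principal_ideal_ind => [|w w' [a1 h1 <-] [a2 h2 <-]|y z].
  - by exists (fun=> 0) => // x; apply: big1 => i _; rewrite !mul0r.
  - exists (fun i => a1 i + a2 i) => // x; under eq_bigr do rewrite !mulrDl.
    by rewrite big_split /= h1 h2 addr0.
  exists (fun i => y * a i * z) => // x.
  transitivity (y * \sum_i a i * (z * x) * b i); last by rewrite ab0 mulr0.
  by rewrite mulr_sumr; apply: eq_bigr => i _; rewrite !mulrA.
have a'Z i : a' i \in 'Z({:A})%VS.
  apply/centerP=> d; apply/esym/eqP; rewrite -subr_eq0; apply/eqP; move: i.
  apply: (IH (fun i => d * a' i - a' i * d)); last by rewrite a'0 eZ subrr.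
  move=> x; transitivity (d * (\sum_i a' i * x * b i) - \sum_i a' i * (d * x) * b i).
    rewrite mulr_sumr -sumrB; apply: eq_bigr => i _.
    by rewrite !mulrBl !mulrA.
  by rewrite !ab' mulr0 subr0.
have : a' ord0 = 0.
  apply: (b_free a' a'Z); transitivity (\sum_i a' i * 1 * b i); last exact: ab'.
  by apply: eq_bigr => i _; rewrite mulr1.
by rewrite a'0 => e_0; rewrite e_0 eqxx in e0.
Qed.

End CentralIdempotents.

(** * Quadratic etale generators *)

Section QuadraticGenerators.

Variables (F : fieldType) (A : falgType F).
Implicit Types (u v w x y : A) (c : F).

(** A generator of a quadratic etale algebra, in the form valid in every
    characteristic: a root of [X^2 - X - c], of discriminant [1 + 4c]. *)
Definition etale_root u c : Prop := u * u = u + c%:A /\ 1 + 4 * c != 0.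

Definition flips u w : Prop := w * u = w - u * w.

Lemma etale_rootA u c x : etale_root u c -> x * u * u = x * u + c *: x.
Proof. by case=> u2 _; rewrite -mulrA u2; nc. Qed.

Lemma commA u w x : u * w = w * u -> x * w * u = x * u * w.
Proof. by move=> uw; rewrite -mulrA -uw mulrA. Qed.

Lemma flipsA u w x : flips u w -> x * w * u = x * w - x * u * w.
Proof. by move=> uw; rewrite -mulrA uw; nc. Qed.

Lemma comm_flips u w x : u * w = w * u -> flips u x -> flips u (w * x).
Proof. by rewrite /flips => uw ux; nc_expand; rewrite -mulrA ux mulrBr !mulrA uw. Qed.

Lemma flips_comm u w x : flips u w -> u * x = x * u -> flips u (w * x).
Proof. by rewrite /flips => uw ux; rewrite -mulrA -ux !mulrA uw mulrBl. Qed.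

Lemma flips_flips u w x : flips u w -> flips u x -> u * (w * x) = w * x * u.
Proof. by rewrite /flips => uw ux; rewrite -mulrA ux mulrBr !mulrA uw; nc. Qed.

Lemma flipsD u w x : flips u w -> flips u x -> flips u (w + x).
Proof. by rewrite /flips => uw ux; nc_expand; rewrite uw ux; nc. Qed.

Section Projections.

Variables (u : A) (c : F).
Hypothesis etu : etale_root u c.

Let u2 : u * u = u + c%:A. Proof. by case: etu. Qed.
Let u2A := fun x => etale_rootA x etu.
Let d0 : 1 + 4 * c != 0. Proof. by case: etu. Qed.

Lemma etale_root_discr : (2 *: u - 1) * (2 *: u - 1) = (1 + 4 * c)%:A.
Proof. by nc_expand; rewrite u2; nc. Qed.

Lemma etale_root_cancel x : (2 *: u - 1) * x = 0 -> x = 0.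
Proof.
move=> ux; apply/eqP; rewrite -(inj_eq (scalerI d0)) scaler0.
by rewrite -[x]mul1r scalerAl -etale_root_discr -mulrA ux mulr0.
Qed.

Lemma etale_root_cancelr x : x * (2 *: u - 1) = 0 -> x = 0.
Proof.
move=> ux; apply/eqP; rewrite -(inj_eq (scalerI d0)) scaler0.
by rewrite -[x]mulr1 scalerAr -etale_root_discr mulrA ux mul0r.
Qed.

Lemma etale_root_compl : etale_root (1 - u) c.
Proof. by split=> //; nc_expand; rewrite u2; nc. Qed.

(** The components of [w] commuting with [u] and exchanging [u] with [1 - u]:
    [A] is the direct sum of these two bimodules because [F[u]] is separable. *)
Definition comm_part w : A :=
  (1 + 4 * c)^-1 *: ((1 + 2 * c) *: w - u * w - w * u + 2 *: (u * w * u)).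
Definition flip_part w : A :=
  (1 + 4 * c)^-1 *: ((2 * c) *: w + u * w + w * u - 2 *: (u * w * u)).

Lemma comm_flip_part w : comm_part w + flip_part w = w.
Proof.
rewrite /comm_part /flip_part; apply: vcoord_inj => ?.
by rewrite ?(vcoordD, vcoordN, vcoordZ, vcoord0); field.
Qed.

Lemma comm_partP w : u * comm_part w = comm_part w * u.
Proof. by rewrite /comm_part; nc_expand; rewrite ?(u2, u2A); nc. Qed.

Lemma flip_partP w : flips u (flip_part w).
Proof. by rewrite /flips /flip_part; nc_expand; rewrite ?(u2, u2A); nc. Qed.

Lemma comm_part_id w : u * w = w * u -> comm_part w = w.
Proof.
rewrite /comm_part => uw; rewrite uw u2A; apply: vcoord_inj => ?.
by rewrite ?(vcoordD, vcoordN, vcoordZ, vcoord0); field.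
Qed.

Lemma flip_part_id w : flips u w -> flip_part w = w.
Proof.
rewrite /flips /flip_part => uw; rewrite (flipsA _ uw) uw u2; nc_expand.
apply: vcoord_inj => ?; rewrite ?(vcoordD, vcoordN, vcoordZ, vcoord0); field.
by rewrite (_ : 1 + _ = 1 + 4 * c) //; ring.
Qed.

Lemma comm_partD w x : comm_part (w + x) = comm_part w + comm_part x.
Proof. by rewrite /comm_part; nc. Qed.

Lemma flip_partD w x : flip_part (w + x) = flip_part w + flip_part x.
Proof. by rewrite /flip_part; nc. Qed.

Lemma comm_partZ a w : comm_part (a *: w) = a *: comm_part w.
Proof. by rewrite /comm_part; nc. Qed.

Lemma flip_partZ a w : flip_part (a *: w) = a *: flip_part w.
Proof. by rewrite /flip_part; nc. Qed.

Lemma comm_part_mul x y w : u * x = x * u -> u * y = y * u ->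
  comm_part (x * w * y) = x * comm_part w * y.
Proof.
rewrite /comm_part => ux uy; nc_expand.
by rewrite ?(commA _ uy, ux); nc.
Qed.

Lemma comm_part_comm y w : u * y = y * u -> w * y = y * w ->
  comm_part w * y = y * comm_part w.
Proof.
move=> uy wy; rewrite /comm_part; nc_expand.
by rewrite ?(commA _ (esym uy), commA _ (esym wy), uy, wy); nc.
Qed.

Lemma flip_part_comm y w : u * y = y * u -> w * y = y * w ->
  flip_part w * y = y * flip_part w.
Proof.
move=> uy wy; rewrite /flip_part; nc_expand.
by rewrite ?(commA _ (esym uy), commA _ (esym wy), uy, wy); nc.
Qed.

Lemma comm_part_invol (sigma : 'End(A)) w :
    (forall x y, sigma (x * y) = sigma y * sigma x) -> sigma u = u ->
  sigma (comm_part w) = comm_part (sigma w).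
Proof.
move=> sM su; rewrite /comm_part !(linearZ, linearD, linearN) /= !sM su.
by nc.
Qed.

Lemma flip_part_invol (sigma : 'End(A)) w :
    (forall x y, sigma (x * y) = sigma y * sigma x) -> sigma u = u ->
  sigma (flip_part w) = flip_part (sigma w).
Proof.
move=> sM su; rewrite /flip_part !(linearZ, linearD, linearN) /= !sM su.
by nc.
Qed.

End Projections.

(** Semiprimeness passes to the centralizer of a separable quadratic element:
    if [x w x = 0] for the [w] that commute with [u], then [x w x] flips [u] for
    every [w]; applying this to [x w x w' x] gives [x w x [w', u] x = 0], so
    [x [w', u] x = 0], that is, [x w' x] also commutes with [u]. *)
Lemma semiprime_cent1 u c : etale_root u c -> semiprime {:A} -> semiprime 'C[u]%VS.
Proof.
move=> etu spA x /cent1vP xu xCx.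
have flip w : flips u (x * w * x).
  rewrite -(comm_flip_part etu w) mulrDr mulrDl xCx ?add0r; last first.
    by apply/cent1vP; rewrite (comm_partP etu).
  apply: flips_comm (esym xu); apply: comm_flips (esym xu) _.
  exact: (flip_partP etu).
have kill w w' : x * w * (x * (w' * u - u * w') * x) = 0.
  have := flip (w * x * w'); have := flip w; rewrite /flips !mulrA => f1.
  have {}f1 : x * w * x * u * w' * x = (x * w * x - u * x * w * x) * w' * x by rewrite f1.
  move: f1; nc_expand; rewrite !(commA _ (esym xu), esym xu).
  move=> f1 f2; rewrite f1 -[x * w * x * w' * u * x]opprK -{1}f2.
  by rewrite f2; nc.
have comm w' : x * (w' * u - u * w') * x = 0.
  apply: spA; rewrite ?memvf // => w _.
  by have := kill ((w' * u - u * w') * x * w) w'; rewrite !mulrA.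
apply: spA; rewrite ?memvf // => w _; apply: (etale_root_cancel etu).
have uY : x * w * x * u = u * (x * w * x).
  apply/eqP; rewrite -subr_eq0 -[X in _ == X](comm w).
  by apply/eqP; nc_expand; rewrite !(commA _ (esym xu), esym xu); nc.
have := flip w; rewrite /flips uY => fY.
have e : u * (x * w * x) + u * (x * w * x) = x * w * x by rewrite {1}fY subrK.
by rewrite mulrBl mul1r -[X in _ - X]e; nc.
Qed.

End QuadraticGenerators.

(** * Neat biquadratic subalgebras and the spaces W *)

Section Frames.

Variables (F : fieldType) (A : falgType F) (sigma : 'End(A)).
Implicit Types (L : {aspace A}) (u v w x y e : A) (c a b : F).

Lemma SymdP x : reflect (exists w, x = w + sigma w) (x \in Symd sigma).
Proof.
apply: (iffP memv_imgP) => [[w _ ->]|[w ->]]; exists w; rewrite ?memvf //;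
  by rewrite add_lfunE id_lfunE.
Qed.

Lemma T_Symd w : w + sigma w \in Symd sigma.
Proof. by apply/SymdP; exists w. Qed.

(** What the arguments below use of an involution and of its subalgebra [L]:
    self-centralizing among symmetrized elements, and linear disjointness from
    the centre (in the strong form given by the Artin-Whaples argument). *)
Record symmetric_frame L : Prop := SymmetricFrame {
  frame_anti : forall x y, sigma (x * y) = sigma y * sigma x;
  frame_invol : forall x, sigma (sigma x) = x;
  frame_one_symd : 1 \in Symd sigma;
  frame_semiprime : semiprime {:A};
  frame_one : 1 \in L;
  frame_sym : (L <= Sym sigma)%VS;
  frame_reduced : forall x, x \in L -> x * x = 0 -> x = 0;
  frame_cent : forall x, x \in Symd sigma ->
    (forall y, y \in L -> x * y = y * x) -> x \in L;
  frame_tensor : forall n (X : n.-tuple A) (a : 'I_n -> A), free X ->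
    (forall i, X`_i \in L) -> (forall x, \sum_i a i * x * X`_i = 0) ->
    forall i, a i = 0
}.

Record biquadratic_pair L u u' c c' : Prop := BiquadraticPair {
  pair_root : etale_root u c;
  pair_root' : etale_root u' c';
  pair_comm : u * u' = u' * u;
  pair_free : free [:: 1; u; u'; u * u'];
  pair_span : L = span [:: 1; u; u'; u * u'] :> {vspace A}
}.

Lemma pairC L u u' c c' : biquadratic_pair L u u' c c' -> biquadratic_pair L u' u c' c.
Proof.
case=> r r' uu' fr sp.
have p : perm_eq [:: 1; u'; u; u' * u] [:: 1; u; u'; u * u'].
  by rewrite uu' perm_cons (perm_catCA [:: u'] [:: u] [:: _]).
split=> //; first by rewrite (perm_free p).
by rewrite sp; apply: eq_span => x; rewrite (perm_mem p).
Qed.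

Definition in_quad u (k : A) : Prop := exists a b, k = a%:A + b *: u.

Lemma in_quad1 u : in_quad u 1.
Proof. by exists 1, 0; nc. Qed.

Lemma in_quadD u k k' : in_quad u k -> in_quad u k' -> in_quad u (k + k').
Proof. by move=> [a [b ->]] [a' [b' ->]]; exists (a + a'), (b + b'); nc. Qed.

Lemma in_quadN u k : in_quad u k -> in_quad u (- k).
Proof. by move=> [a [b ->]]; exists (- a), (- b); nc. Qed.

Lemma in_quadZ u a k : in_quad u k -> in_quad u (a *: k).
Proof. by move=> [a' [b ->]]; exists (a * a'), (a * b); nc. Qed.

Lemma in_quadM u c k k' : etale_root u c ->
  in_quad u k -> in_quad u k' -> in_quad u (k * k').
Proof.
move=> [u2 _] [a [b ->]] [a' [b' ->]].
exists (a * a' + b * b' * c), (a * b' + a' * b + b * b').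
by nc_expand; rewrite u2; nc.
Qed.

Lemma in_quad_comm u k x : in_quad u k -> u * x = x * u -> k * x = x * k.
Proof. by move=> [a [b ->]] ux; nc_expand; rewrite ux; nc. Qed.

Lemma in_quad_commC u k k' : in_quad u k -> in_quad u k' -> k * k' = k' * k.
Proof.
by move=> qk [a [b ->]]; apply: in_quad_comm qk _; nc.
Qed.

Lemma in_quad_mem u k L : 1 \in L -> u \in L -> in_quad u k -> k \in L.
Proof. by move=> L1 Lu [a [b ->]]; rewrite memvD ?memvZ. Qed.

Lemma span_quadP u x : x \in span [:: 1; u] <-> in_quad u x.
Proof.
rewrite span_cons span_seq1; split.
  by case/memv_addP=> _ /vlineP[a ->] [_ /vlineP[b ->] ->]; exists a, b.
by move=> [a [b ->]]; rewrite memv_add // memvZ // memv_line.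
Qed.

Lemma dim_span_quad u : (\dim (span [:: 1; u]%R) == 2%N) = (u \notin 1%VS).
Proof.
have e : [:: 1; u] =i [:: u; 1] by move=> x; rewrite !inE orbC.
rewrite (eq_span e) -[_ == _]/(free [:: u; 1]).
by rewrite free_cons span_seq1 free_cons span_nil memv0 oner_eq0 nil_free /= andbT.
Qed.

Lemma quad_indep u a b : u \notin 1%VS -> a%:A + b *: u = 0 -> a = 0 /\ b = 0.
Proof.
move=> uF e; have b0 : b = 0.
  apply: contraNeq uF => b0; apply/vlineP; exists (- (b^-1 * a)).
  rewrite scaleNr -scalerA (_ : a%:A = - (b *: u)); last by apply/eqP; rewrite -addr_eq0 e.
  by rewrite scalerN opprK scalerA mulVf // scale1r.
by move: e; rewrite b0 scale0r addr0 => /eqP; rewrite scaler_eq0 oner_eq0 orbF => /eqP.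
Qed.

Lemma scalar_unit (z : A) : z \in 1%VS -> z != 0 -> z \is a GRing.unit.
Proof.
case/vlineP=> a -> a0; apply/unitrP; exists (a^-1 *: 1).
have a_0 : a != 0 by apply: contraNneq a0 => ->; rewrite scale0r.
by rewrite -!scalerAl !mul1r !scalerA mulVf ?divff ?scale1r.
Qed.

Section Pair.

Variables (L : {aspace A}) (u u' : A) (c c' : F).
Hypotheses (fr : symmetric_frame L) (bp : biquadratic_pair L u u' c c').

Let sM := frame_anti fr.
Let sK := frame_invol fr.
Let L1 := frame_one fr.
Let ru := pair_root bp.
Let ru' := pair_root' bp.
Let uu' := pair_comm bp.
Let u2 : u * u = u + c%:A. Proof. by case: ru. Qed.
Let u'2 : u' * u' = u' + c'%:A. Proof. by case: ru'. Qed.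
Let u2A := fun x => etale_rootA x ru.
Let u'2A := fun x => etale_rootA x ru'.

Lemma pair_mem1 : u \in L.
Proof. by rewrite (pair_span bp) memv_span // !inE eqxx ?orbT. Qed.
Lemma pair_mem2 : u' \in L.
Proof. by rewrite (pair_span bp) memv_span // !inE eqxx ?orbT. Qed.
Let Lu := pair_mem1.
Let Lu' := pair_mem2.

Lemma frame_fix x : x \in L -> sigma x = x.
Proof. by move=> xL; apply/fixedSpaceP; apply: (subvP (frame_sym fr)). Qed.

Let su : sigma u = u. Proof. exact: frame_fix. Qed.
Let su' : sigma u' = u'. Proof. exact: frame_fix. Qed.

Lemma Symd_fix x : x \in Symd sigma -> sigma x = x.
Proof. by case/SymdP=> w ->; rewrite linearD /= sK addrC. Qed.

Lemma pair_indep a b a' b' :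
  (a%:A + b *: u) + (a'%:A + b' *: u) * u' = 0 -> [/\ a = 0, b = 0, a' = 0 & b' = 0].
Proof.
move=> e; have /(@freeP _ _ _ [tuple 1; u; u'; u * u']) free4 := pair_free bp.
have {free4} h : forall i, tnth [tuple a; b; a'; b'] i = 0.
  apply: free4.
  by rewrite !big_ord_recl big_ord0 /= !(tnth_nth 0) /= -[RHS]e; nc.
by have := (h ord0, h 1, h 2%:R, h 3%:R); rewrite !(tnth_nth 0) /=; case=> [[[]]].
Qed.

Lemma pair_coord x : x \in L ->
  exists a b a' b', x = (a%:A + b *: u) + (a'%:A + b' *: u) * u'.
Proof.
rewrite (pair_span bp) => /(@coord_span _ _ _ [tuple 1; u; u'; u * u']) ->.
rewrite !big_ord_recl big_ord0 /=.
by do 4 eexists; rewrite addr0 !(addrA, mulrDl) -!scalerAl mul1r; reflexivity.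
Qed.

Lemma comm_pair x : x * u = u * x -> x * u' = u' * x ->
  forall y, y \in L -> x * y = y * x.
Proof.
move=> xu xu' y /pair_coord[a [b [a' [b' ->]]]]; nc_expand.
by rewrite ?(commA _ (esym xu), commA _ (esym xu'), xu, xu'); nc.
Qed.

Lemma comm_part_Symd x : x \in Symd sigma -> comm_part u c x \in Symd sigma.
Proof.
move=> /SymdP[w ->]; apply/SymdP; exists (comm_part u c w).
by rewrite (comm_part_invol c w sM su) comm_partD.
Qed.

Lemma flip_part_Symd x : x \in Symd sigma -> flip_part u c x \in Symd sigma.
Proof.
move=> /SymdP[w ->]; apply/SymdP; exists (flip_part u c w).
by rewrite (flip_part_invol c w sM su) flip_partD.
Qed.

Lemma Symd_conj y x : sigma y = y -> x \in Symd sigma -> y * x * y \in Symd sigma.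
Proof.
move=> sy /SymdP[w ->]; apply/SymdP; exists (y * w * y).
by rewrite !sM sy mulrDr mulrDl !mulrA.
Qed.

Lemma Symd_cent1 x : x \in Symd sigma -> u * x = x * u ->
  exists2 w, u * w = w * u & x = w + sigma w.
Proof.
move=> /SymdP[w ex] ux; exists (comm_part u c w); first exact: (comm_partP ru).
by rewrite (comm_part_invol c w sM su) -comm_partD -ex (comm_part_id ru).
Qed.

(** The space [W_i] of the Pfister form, for the automorphism of [F[s, s']] that
    fixes [s] and exchanges [s'] with [1 - s']. *)
Definition Wvs (s s' : A) : {vspace A} :=
  (Symd sigma :&: lker (amull s - amulr s)
   :&: lker (amull s' + amulr s' - \1)%VF)%VS.

Lemma WvsP s s' x :
  reflect [/\ x \in Symd sigma, s * x = x * s & flips s' x] (x \in Wvs s s').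
Proof.
rewrite /Wvs !memv_cap !memv_ker !lfun_simp /= !subr_eq0 -andbA.
apply: (iffP and3P) => [[h1 /eqP h2 /eqP h3]|[h1 h2 h3]]; split=> //.
- by rewrite /flips -[in X in X - _]h3 addrC addKr.
- by rewrite h2.
by rewrite h3 addrC subrK.
Qed.

Lemma W_symmetrized x : x \in Wvs u u' ->
  exists w, [/\ u * w = w * u, flips u' w & x = w + sigma w].
Proof.
case/WvsP=> xS ux fx; have [w uw ex] := Symd_cent1 xS ux.
exists (flip_part u' c' w); split; last 2 first.
- exact: (flip_partP ru').
- by rewrite (flip_part_invol c' w sM su') -flip_partD -ex (flip_part_id ru').
by rewrite (flip_part_comm _ (esym uu') (esym uw)).
Qed.

Lemma sigma_comm y w : sigma y = y -> y * w = w * y -> y * sigma w = sigma w * y.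
Proof. by move=> sy yw; rewrite -{1}sy -sM -yw sM sy. Qed.

Lemma sigma_flips y w : sigma y = y -> flips y w -> flips y (sigma w).
Proof.
rewrite /flips => sy yw; have := congr1 sigma yw.
by rewrite linearB /= !sM sy => ->; rewrite opprB addrC subrK.
Qed.

Lemma W_T w : u * w = w * u -> flips u' w -> w + sigma w \in Wvs u u'.
Proof.
move=> uw fw; apply/WvsP; split; first exact: T_Symd.
  by rewrite mulrDr mulrDl uw (sigma_comm su uw).
by apply: flipsD => //; apply: sigma_flips.
Qed.

Lemma W_mul k x : in_quad u k -> x \in Wvs u u' -> k * x \in Wvs u u'.
Proof.
move=> qk /W_symmetrized[w [uw fw ->]].
have kL := in_quad_mem L1 Lu qk; have sk := frame_fix kL.
have -> : k * (w + sigma w) = k * w + sigma (k * w).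
  by rewrite sM sk mulrDr (in_quad_comm qk (sigma_comm su uw)).
have uk : u * k = k * u by have [a [b ->]] := qk; nc.
have u'k : u' * k = k * u' by have [a [b ->]] := qk; nc_expand; rewrite uu'; nc.
apply: W_T; last exact: comm_flips.
by rewrite mulrA uk -!mulrA uw.
Qed.

Lemma in_quad_W k x : in_quad u k -> x \in Wvs u u' -> k * x = x * k.
Proof. by move=> qk /WvsP[_ ux _]; apply: in_quad_comm qk ux. Qed.

Lemma frame_one_symmetrized : exists a : A, [/\ 1 = a + sigma a, u * a = a * u & u' * a = a * u'].
Proof.
have [w uw e1] := Symd_cent1 (frame_one_symd fr) (commr1 u).
exists (comm_part u' c' w); split; last exact: (comm_partP ru').
  by rewrite (comm_part_invol c' w sM su') -comm_partD -e1 (comm_part_id ru') // mul1r mulr1.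
by rewrite (comm_part_comm _ (esym uu') (esym uw)).
Qed.

Lemma Symd_pair_mem x : x \in Symd sigma -> u * x = x * u -> u' * x = x * u' -> x \in L.
Proof.
by move=> xS ux u'x; apply: (frame_cent fr xS); apply: comm_pair.
Qed.

Lemma square_Symd x : x \in Symd sigma -> x * x \in Symd sigma.
Proof.
move=> xS; have sx := Symd_fix xS; have /SymdP[a e1] := frame_one_symd fr.
by rewrite -[x in x * _]mulr1; apply: Symd_conj => //; apply: (frame_one_symd fr).
Qed.

Lemma W_square x : x \in Wvs u u' -> in_quad u (x * x).
Proof.
move=> xW; have [xS ux fx] := WvsP _ _ _ xW.
have [k [k' [qk qk' ex]]] : exists k k', [/\ in_quad u k, in_quad u k' & x * x = k + k' * u'].
  have /pair_coord[a [b [a' [b' ->]]]] : x * x \in L.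
    apply: Symd_pair_mem (square_Symd xS) _ _; first by rewrite mulrA ux -!mulrA ux.
    exact: flips_flips.
  by exists (a%:A + b *: u), (a'%:A + b' *: u); split=> //; [exists a, b | exists a', b'].
have k'x := in_quad_W qk' xW; have kx := in_quad_W qk xW.
have k'x0 : k' * x = 0.
  apply: (etale_root_cancel ru').
  have := mulrA x x x; rewrite ex mulrDr mulrDl -kx !mulrA -k'x => /addrI.
  rewrite -mulrA fx => e.
  have u'k : u' * k' = k' * u' by have [a [b ->]] := qk'; nc_expand; rewrite uu'; nc.
    have -> : (2 *: u' - 1) * k' * x = k' * u' * x - k' * (x - u' * x).
    by nc_expand; rewrite u'k; nc.
  by rewrite e subrr.
have : k' * (x * x) = 0 by rewrite mulrA k'x0 mul0r.
rewrite ex mulrDr mulrA.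
have [a1 [b1 ->]] := in_quadM ru qk' qk; have [a2 [b2 e2]] := in_quadM ru qk' qk'.
rewrite e2 => /pair_indep[_ _ a20 b20].
have k'0 : k' = 0.
  apply: (frame_reduced fr); first exact: in_quad_mem L1 Lu qk'.
  by rewrite e2 a20 b20; nc.
by rewrite k'0 mul0r addr0.
Qed.

Lemma W_polar x y : x \in Wvs u u' -> y \in Wvs u u' -> in_quad u (x * y + y * x).
Proof.
move=> xW yW; have -> : x * y + y * x = (x + y) * (x + y) - x * x - y * y by nc.
have sq z : z \in Wvs u u' -> in_quad u (z * z) := @W_square z.
by do 2 (apply: in_quadD; last by apply: in_quadN; apply: sq); apply/sq/memvD.
Qed.

(** The [F[u]]-quadratic form [x |-> x ^ 2] on [W] is nondegenerate. For [x] in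
    its radical, comparing the symmetrizations of [x w] and [x w u'] gives
    [(x w + sigma (x w)) x = 0] for all [w] in the bimodule containing [W];
    hence [x ^ 2 = 0], then [x w x = 0], and semiprimeness of the centralizer of
    [u] concludes. *)
Lemma W_nondegenerate x : x \in Wvs u u' ->
  (forall y, y \in Wvs u u' -> x * y + y * x = 0) -> x = 0.
Proof.
move=> xW x0; have [xS ux fx] := WvsP _ _ _ xW; have sx := Symd_fix xS.
have qxx := W_square xW.
have tx w : u * w = w * u -> flips u' w -> (x * w + sigma w * x) * x = 0.
  move=> uw fw.
  have tx' v : u * v = v * u -> flips u' v ->
      (x * v + sigma v * x) * x = - (x * (x * v + sigma v * x)).
    move=> uv fv; have := x0 _ (W_T uv fv) => /(congr1 (fun z => x * z)).
    have xxs : x * x * sigma v = sigma v * (x * x) by apply: in_quad_comm qxx (sigma_comm su uv).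
    rewrite mulr0 => e; apply/eqP; rewrite -addr_eq0 -[X in _ == X]e; apply/eqP.
    by nc_expand; rewrite -(mulrA _ x x) -xxs; nc.
  set t := x * w + sigma w * x.
  have wu' : flips u' (w * u') by apply: flips_comm.
  have uwu : u * (w * u') = w * u' * u by rewrite mulrA uw -!mulrA uu'.
  have u't : u' * t = t * u'.
    rewrite /t mulrDr mulrDl (flips_flips fx fw).
    by rewrite (flips_flips (sigma_flips su' fw) fx).
  have e2 : x * (w * u') + sigma (w * u') * x = t * u'.
    by rewrite -u't /t mulrDr (flips_flips fx fw) sM su' !mulrA.
  have := tx' _ uwu wu'; rewrite e2 => e3; have e1 := tx' _ uw fw.
  apply: (etale_root_cancel ru'); rewrite -/t in e1 *; clearbody t.
  have : t * u' * x = t * x * u' by rewrite e3 mulrA -mulNr -e1.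
  rewrite -u't -[t * x * u']mulrA fx mulrBr !mulrA -u't => e4.
  have -> : (2 *: u' - 1) * t * x = u' * t * x - (t * x - u' * t * x) by nc.
  by rewrite -e4 subrr.
have xx0 : x * x = 0.
  have [a [e1 ua u'a]] := frame_one_symmetrized.
  have := tx (x * a); rewrite sM sx.
  have fxa : flips u' (x * a) by apply: flips_comm.
  have uxa : u * (x * a) = x * a * u by rewrite mulrA ux -!mulrA ua.
  have xxa : sigma a * x * x = x * (x * sigma a).
    rewrite -mulrA [RHS]mulrA; apply/esym/in_quad_comm; first exact: qxx.
    exact: sigma_comm.
  move=> /(_ uxa fxa); rewrite xxa -!mulrDr -e1 mulr1 => xxx.
  apply: (frame_reduced fr); first exact: in_quad_mem L1 Lu qxx.
  by rewrite mulrA xxx mul0r.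
have xwx w : u * w = w * u -> flips u' w -> x * w * x = 0.
  by move=> uw fw; have := tx w uw fw; rewrite mulrDl -(mulrA (sigma w)) xx0 mulr0 addr0.
have spB := semiprime_cent1 ru (frame_semiprime fr).
have flip_comp z : u * z = z * u -> exists z0 z1, [/\ z = z0 + z1,
     u * z0 = z0 * u, u' * z0 = z0 * u', u * z1 = z1 * u & flips u' z1].
  move=> uz; exists (comm_part u' c' z), (flip_part u' c' z).
  rewrite comm_flip_part //; split=> //; last exact: (flip_partP ru').
  - by rewrite (comm_part_comm _ (esym uu') (esym uz)).
  - by rewrite (comm_partP ru').
  by rewrite (flip_part_comm _ (esym uu') (esym uz)).
apply: (spB _); first by apply/cent1vP.
move=> z /cent1vP zu; have [b [z1 [-> ub u'b uz1 u'z1]]] := flip_comp z (esym zu).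
rewrite mulrDr mulrDl (xwx _ uz1 u'z1) addr0.
apply: (spB _); first by apply/cent1vP; rewrite -!mulrA -ux (mulrA b) -ub !mulrA ux.
move=> y /cent1vP yu; have [y0 [y1 [-> uy0 u'y0 uy1 u'y1]]] := flip_comp y (esym yu).
have -> : x * b * x * (y0 + y1) * (x * b * x)
  = x * (b * x * y0) * x * b * x + x * b * (x * y1 * x) * b * x by nc.
rewrite (xwx (b * x * y0)) ?(xwx y1) ?mul0r ?mulr0 ?mul0r ?addr0 //.
  by rewrite !mulrA ub -(mulrA b) ux mulrA -!mulrA uy0.
by apply: flips_comm => //; apply: comm_flips.
Qed.
End Pair.
End Frames.

(** * From isotropic vectors to invertible scalar squares *)

Section ScalarSquares.

Variables (F : fieldType) (A : falgType F) (sigma : 'End(A)).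
Implicit Types (u v w x y z e : A) (c a b : F).

(** In [F[u]], a field or the product of two copies of [F], every [k <> 0] has a
    generalized inverse: [e] is [1] unless [k] is in one of two factors. *)
Lemma quad_idempotent u c k : etale_root u c -> in_quad u k -> k != 0 ->
  exists e k', [/\ in_quad u e, in_quad u k', e * e = e, k * k' = e
    & forall l, in_quad u l -> exists a, l * (1 - e) = a *: (1 - e)].
Proof.
move=> [u2 d0] [b0 [b1 ->]] {k} k0.
pose n := b0 ^+ 2 + b0 * b1 - c * b1 ^+ 2; pose t := 2 * b0 + b1.
pose kb := (b0 + b1)%:A - b1 *: u : A.
have kkb : (b0%:A + b1 *: u) * kb = n%:A by rewrite /kb /n; nc_expand; rewrite u2; nc.
have [n0|n0] := eqVneq n 0; last first.
  exists 1, (n^-1 *: kb); split; rewrite ?mulr1 //.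
  - exact: in_quad1.
  - by apply: in_quadZ; exists (b0 + b1), (- b1); rewrite /kb; nc.
  - by rewrite -scalerAr kkb scalerA mulVf // scale1r.
  by move=> l _; exists 0; rewrite subrr mulr0 scaler0.
have b10 : b1 != 0.
  apply: contraNneq k0 => b10; move: n0; rewrite /n b10 mulr0 expr0n mulr0 subr0 addr0.
  by move/eqP; rewrite expf_eq0 /= => /eqP ->; rewrite !scale0r addr0.
have t0 : t != 0.
  apply: contraNneq b10 => t0; have e1 : b1 = - 2 * b0 by rewrite -[LHS]subr0 -t0 /t; ring.
  have : (1 + 4 * c) * b0 ^+ 2 = 0 by rewrite -[RHS]oppr0 -n0 /n e1; ring.
  move/eqP; rewrite mulf_eq0 (negPf d0) expf_eq0 /= => /eqP b00.
  by rewrite e1 b00 mulr0.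
have kk : (b0%:A + b1 *: u) * (b0%:A + b1 *: u) = t *: (b0%:A + b1 *: u).
  rewrite -[RHS]subr0 -(scale0r 1) -n0 /n /t; nc_expand; rewrite u2; nc.
have q : in_quad u (b0%:A + b1 *: u) by exists b0, b1.
set k := b0%:A + b1 *: u in kk q *.
have ee : t^-1 *: k * (t^-1 *: k) = t^-1 *: k.
  by rewrite -scalerAr -scalerAl kk !scalerA -mulrA mulVf // mulr1.
exists (t^-1 *: k), ((t^-1 * t^-1) *: k); split=> //; try exact: in_quadZ.
  by rewrite -scalerAr kk scalerA -mulrA mulVf // mulr1.
move=> _ [l0 [l1 ->]]; exists (l0 - l1 * (b0 / b1)).
have -> : 1 - t^-1 *: k = t^-1 *: kb.
  rewrite -[1 in LHS](scale1r 1) -(mulVf t0) -scalerA -scalerBr; congr (_ *: _).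
  by rewrite /k /kb /t; nc.
rewrite -scalerAr scalerA [_ * t^-1]mulrC -scalerA; congr (_ *: _).
have ub : u * kb = - (b0 / b1) *: kb.
  have e1 : c * b1 = b0 * (b0 + b1) / b1.
    apply: (mulIf b10); rewrite mulfVK //.
    by rewrite -[RHS]subr0 -n0 /n; ring.
  have -> : u * kb = b0 *: u - (c * b1)%:A by rewrite /kb; nc_expand; rewrite u2; nc.
  rewrite e1 /kb; apply: vcoord_inj => ?.
  by rewrite ?(vcoordD, vcoordN, vcoordZ, vcoord0); field.
by rewrite mulrDl -!scalerAl mul1r ub; nc.
Qed.

Section Pair.

Variables (L : {aspace A}) (u u' : A) (c c' : F).
Hypotheses (fr : symmetric_frame sigma L) (bp : biquadratic_pair L u u' c c').

Let sM := frame_anti fr.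
Let sK := frame_invol fr.
Let L1 := frame_one fr.
Let ru := pair_root bp.
Let ru' := pair_root' bp.
Let uu' := pair_comm bp.
Let u2 : u * u = u + c%:A. Proof. by case: ru. Qed.
Let u'2 : u' * u' = u' + c'%:A. Proof. by case: ru'. Qed.
Let u2A := fun x => etale_rootA x ru.
Let u'2A := fun x => etale_rootA x ru'.
Let Lu : u \in L := pair_mem1 bp.
Let Lu' : u' \in L := pair_mem2 bp.
Let su : sigma u = u := frame_fix fr Lu.
Let su' : sigma u' = u' := frame_fix fr Lu'.
Let W := Wvs sigma u u'.

(** The bimodule of the elements that commute with [u] and flip [u'] is the
    image of an operator [w |-> sum y_b w b], [b] ranging over the basis of [L]
    given by the pair, whose coefficient at [b = u u'] is invertible. *)
Lemma flip_bimodule_faithful e :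
  (forall w, u * w = w * u -> flips u' w -> e * w = 0) -> e = 0.
Proof.
move=> e0.
have [p0 [p1 [pP p1E]]] : exists p0 p1 : A, (forall x,
    (1 + 4 * c) *: comm_part u c x = p0 * x + p1 * x * u) /\ p1 = 2 *: u - 1.
  exists ((1 + 2 * c)%:A - u), (2 *: u - 1); split=> // x.
  by rewrite scalerA mulfV ?scale1r; [nc | case: ru].
have [q0 [q1 [qP q1E]]] : exists q0 q1 : A, (forall x,
    (1 + 4 * c') *: flip_part u' c' x = q0 * x + q1 * x * u') /\ q1 = 1 - 2 *: u'.
  exists ((2 * c')%:A + u'), (1 - 2 *: u'); split=> // x.
  by rewrite scalerA mulfV ?scale1r; [nc | case: ru'].
pose a := tnth [tuple e * q0 * p0; e * q0 * p1; e * q1 * p0; e * q1 * p1].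
have a0 : forall i, a i = 0.
  apply: (frame_tensor fr (X := [tuple 1; u; u'; u * u'])).
  - exact: pair_free bp.
  - by case=> [|[|[|[|i]]]] //=; rewrite ?memvM ?nth_nil ?mem0v.
  move=> x; have h : e * flip_part u' c' (comm_part u c x) = 0.
    apply: e0; last exact: (flip_partP ru').
    by rewrite (flip_part_comm _ (esym uu')) ?(comm_partP ru).
  transitivity (e * ((1 + 4 * c') *: flip_part u' c' ((1 + 4 * c) *: comm_part u c x))).
    by rewrite pP qP !big_ord_recl big_ord0 /a !(tnth_nth 0) /=; nc.
  by rewrite flip_partZ -scalerAr -scalerAr h !scaler0.
have := a0 3%:R; rewrite /a (tnth_nth 0) /= p1E q1E => /(etale_root_cancelr ru).
move/(congr1 -%R); rewrite -mulrN opprB oppr0.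
exact: (etale_root_cancelr ru').
Qed.

(** If [e W = 0], then [e] annihilates the bimodule containing [W], against
    [flip_bimodule_faithful]. If all squares vanish on [e W], so does the polar
    form, against [W_nondegenerate]. *)
Lemma W_idempotent e : in_quad u e -> e * e = e -> e != 0 ->
  exists z, [/\ z \in W, e * z = z & z * z != 0].
Proof.
move=> qe e2 e0.
have eu' : u' * e = e * u' by have [a [b ->]] := qe; nc_expand; rewrite uu'; nc.
have [z [zW ez z0]] : exists z, [/\ z \in W, e * z = z & z != 0].
  have [eW0|eW] := eqVneq (amull e @: W)%VS 0%VS; last first.
    exists (vpick (amull e @: W)%VS); rewrite vpick0.
    have /memv_imgP[x xW ->] := memv_pick (amull e @: W)%VS.
    by rewrite lfunE /= mulrA e2 (W_mul fr bp).
  have eW x : x \in W -> e * x = 0.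
    by move=> xW; apply/eqP; rewrite -memv0 -eW0; apply/memv_imgP; exists x; rewrite ?lfunE.
  move: e0; rewrite (_ : e = 0) ?eqxx //; apply: flip_bimodule_faithful => w uw fw.
  have h1 := eW _ (W_T fr bp uw fw).
  have uu'w : u * (u' * w) = u' * w * u by rewrite mulrA uu' -!mulrA uw.
  have fu'w : flips u' (u' * w) by apply: comm_flips.
  have := eW _ (W_T fr bp uu'w fu'w); rewrite sM su'.
  rewrite (sigma_flips fr su' fw) => h2.
  have sw0 : e * sigma w = 0.
    apply: (etale_root_cancel ru'); rewrite -[RHS](subrr 0) -{1}[0](mulr0 u') -{1}h1 -{1}h2.
    by nc_expand; rewrite eu'; nc.
  by move: h1; rewrite mulrDr sw0 addr0.
have [zz|zz] := eqVneq (z * z) 0; last by exists z.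
have [/subvP Wz|/subvPn[y yW]] := boolP (W <= lker (amull z + amulr z)%R)%VS.
  move: z0; rewrite (W_nondegenerate fr bp zW) ?eqxx // => y yW.
  by have := Wz y yW; rewrite memv_ker !lfun_simp /= => /eqP.
rewrite memv_ker !lfun_simp /= => zy0.
have ze : z * e = z by rewrite -(in_quad_W qe zW).
have eyW : e * y \in W by apply: (W_mul fr bp).
have [yy|yy] := eqVneq (e * y * (e * y)) 0; last first.
  by exists (e * y); split=> //; rewrite mulrA e2.
exists (z + e * y); split; first by rewrite memvD.
  by rewrite mulrDr mulrA e2 ez.
have -> : (z + e * y) * (z + e * y) = z * z + e * y * (e * y) + (z * e * y + e * (y * z)) by nc.
have eyz : e * (y * z) = y * z.
  by rewrite mulrA (in_quad_W qe yW) -mulrA ez.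
by rewrite zz yy !add0r ze eyz.
Qed.

(** A nonzero isotropic vector of [x |-> s (x ^ 2)], where [s] kills [F], yields
    an invertible one: if [e ^ 2 = 0], pair [e] with some [f] outside of its
    orthogonal and solve a linear equation over [F[u]]; where [F[u]] is split
    and only one of its components can be adjusted in this way, a vector of
    nonzero square is taken in the other one. *)
Lemma W_invertible_square y : y \in W -> y != 0 -> (exists a, y * y = a%:A) ->
  exists x a, [/\ x \in W, a != 0 & x * x = a%:A].
Proof.
move=> yW y0 [a yy]; have [a0|a0] := eqVneq a 0; last by exists y, a.
have {a a0}yy : y * y = 0 by rewrite yy a0 scale0r.
have [/subvP Wy|/subvPn[f fW]] := boolP (W <= lker (amull y + amulr y)%R)%VS.
  move: y0; rewrite (W_nondegenerate fr bp yW) ?eqxx // => f fW.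
  by have := Wy f fW; rewrite memv_ker !lfun_simp /= => /eqP.
rewrite memv_ker !lfun_simp /=.
have [k ek] : exists k, y * f + f * y = k by exists (y * f + f * y).
rewrite ek => k0; have qk : in_quad u k by rewrite -ek; apply: (W_polar fr bp).
have [e [k' [qe qk' e2 kk' le]]] := quad_idempotent ru qk k0.
have qe' : in_quad u (1 - e) by apply: in_quadD; [apply: in_quad1 | apply: in_quadN].
have comW l x : in_quad u l -> x \in W -> x * l = l * x.
  by move=> ql xW; rewrite (in_quad_W ql xW).
have comQ l l' : in_quad u l -> in_quad u l' -> l * l' = l' * l by apply: in_quad_commC.
have e2' : (1 - e) * (1 - e) = 1 - e by rewrite mulrBl mul1r mulrBr mulr1 e2 subrr subr0.
have [z [t [zW ez t0 zz]]] : exists z t, [/\ z \in W, (1 - e) * z = z, t != 0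
    & z * z = t *: (1 - e)].
  have [e1|e1] := eqVneq (1 - e) 0.
    by exists 0, 1; rewrite mem0v e1 !mul0r scaler0 oner_neq0.
  have [z [zW ez z0]] := W_idempotent qe' e2' e1.
  have [t et] := le _ (W_square fr bp zW); exists z, t.
  have zzt : z * z = t *: (1 - e) by rewrite -et -{1}ez -mulrA comQ //; apply: (W_square fr bp).
  by split=> //; apply: contraNneq z0 => t0; rewrite zzt t0 scale0r.
have qff := W_square fr bp fW.
have q1 : in_quad u (t%:A - f * f) by apply: in_quadD; [exists t, 0; nc | apply: in_quadN].
pose g := (t%:A - f * f) * (e * (k' * y)) + e * f.
have ge : g = e * ((t%:A - f * f) * (k' * y) + f).
  by rewrite /g [RHS]mulrDr !mulrA (comQ e (t%:A - f * f)).
have gW : g \in W by rewrite memvD // !(W_mul fr bp).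
have gz : g * z = 0.
  by rewrite -ez mulrA (comW _ _ qe' gW) ge mulrA mulrBl mul1r e2 subrr !mul0r.
have zg : z * g = 0.
  by rewrite ge mulrA (comW _ _ qe zW) -{1}ez mulrA mulrBr mulr1 e2 subrr !mul0r.
have mulQW l l' x x' : in_quad u l' -> x \in W -> l * x * (l' * x') = l * l' * (x * x').
  by move=> ql' xW; rewrite -mulrA (mulrA x) (comW l' x) // !mulrA.
have gg : g * g = t *: e.
  have [p [qp pe gp]] : exists p, [/\ in_quad u p, p * e * k = (t%:A - f * f) * e
      & g = p * y + e * f].
    exists ((t%:A - f * f) * e * k'); split.
    - by do 2 (apply: (in_quadM ru) => //).
    - rewrite -(mulrA _ k' e) (comQ k' e) // !mulrA -(mulrA _ k' k) (comQ k' k) //.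
      by rewrite kk'; do 2 rewrite -(mulrA _ e e) e2.
    by rewrite /g !mulrA.
  have -> : g * g = p * y * (p * y) + p * y * (e * f) + e * f * (p * y) + e * f * (e * f).
    by rewrite gp; nc.
  rewrite (mulQW p p) // (mulQW p e) // (mulQW e p) // (mulQW e e) // yy mulr0 add0r e2 (comQ e p) // -mulrDr ek pe.
  by rewrite (comQ e (f * f)) // -mulrDl subrK -scalerAl mul1r.
clearbody g; exists (g + z), t; split=> //; first by rewrite memvD.
by rewrite mulrDl !mulrDr gz zg gg zz addr0 add0r -scalerDr addrC subrK.
Qed.

End Pair.
End ScalarSquares.

(** * From a quaternion algebra containing u to a scalar square *)

Section Descent.

Variables (F : fieldType) (A : falgType F) (u v : A) (c beta : F).
Hypotheses (ru : etale_root u c) (uv : flips u v) (vv : v * v = beta%:A).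
Hypothesis beta0 : beta != 0.

(** Conjugation by [v] is an [F[u]]-semilinear involution of the centralizer of
    [u], so this is [F[u]] tensored with the centralizer of [u] and [v]; [y] has
    the coordinate [descent y] at [u]. *)
Definition descent y : A :=
  ((1 + 4 * c) * beta)^-1 *: ((2 *: u - 1) * (beta *: y - v * y * v)).

Lemma descentP y : u * y = y * u ->
  [/\ u * descent y = descent y * u, v * descent y = descent y * v
    & v * (y - u * descent y) = (y - u * descent y) * v].
Proof.
move=> uy; have [u2 d0] := ru; have u2A := fun x => etale_rootA x ru.
have vvA x : x * v * v = beta *: x by rewrite -mulrA vv -scalerAr mulr1.
have uvA := fun x => flipsA x uv; have yuA := fun x => commA x uy.
pose z := beta *: y - v * y * v.
have vz : v * z = - (z * v) by rewrite /z; nc_expand; rewrite ?(vv, vvA); nc.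
have uz : u * z = z * u.
  have uvyv := flips_flips (flips_comm uv uy) uv.
  by rewrite /z mulrBr mulrBl uvyv -scalerAr -scalerAl uy.
have Dz : descent y = ((1 + 4 * c) * beta)^-1 *: ((2 *: u - 1) * z) by [].
have zv : z * v = beta *: (y * v - v * y) by rewrite /z; nc_expand; rewrite ?(vv, vvA); nc.
move: z (descent y) vz uz Dz zv => z D vz uz Dz zv.
have vD : v * D = D * v.
  rewrite Dz -scalerAr -scalerAl; congr (_ *: _).
  have -> : v * ((2 *: u - 1) * z) = - ((2 *: u - 1) * (v * z)).
    by nc_expand; rewrite (uv : v * u = _); nc.
  by rewrite vz mulrN opprK mulrA.
split=> //.
  rewrite Dz -scalerAr -scalerAl; congr (_ *: _).
  by nc_expand; rewrite ?(commA _ uz, esym uz); nc.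
have e : (1 + 4 * c) *: (beta *: (v * y - y * v)) =
   (1 + 4 * c) *: (beta *: (v * (u * D) - u * D * v)).
  have -> : v * (u * D) - u * D * v = (1 - 2 *: u) * (D * v).
    by rewrite mulrA (uv : v * u = _) mulrBl -(mulrA u v) vD; nc.
  rewrite [in RHS]Dz -scalerAl -scalerAr !scalerA mulfV ?mulf_neq0 // scale1r -mulrA zv mulrA.
  have -> : (1 - 2 *: u) * (2 *: u - 1) = - (1 + 4 * c)%:A.
    by rewrite -(etale_root_discr ru); nc.
  by rewrite mulNr -scalerAl mul1r -scalerA -!scalerN opprB.
have {}e := scalerI beta0 (scalerI d0 e).
apply/eqP; rewrite -subr_eq0.
have -> : v * (y - u * D) - (y - u * D) * v =
  v * y - y * v - (v * (u * D) - u * D * v) by nc.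
by rewrite e subrr.
Qed.

End Descent.

Section Quaternion.

Variables (F : fieldType) (A : falgType F) (sigma : 'End(A)).
Variables (L : {aspace A}) (u u' : A) (c c' : F).
Hypotheses (fr : symmetric_frame sigma L) (bp : biquadratic_pair L u u' c c').

Let sM := frame_anti fr.
Let sK := frame_invol fr.
Let L1 := frame_one fr.
Let ru := pair_root bp.
Let ru' := pair_root' bp.
Let uu' := pair_comm bp.
Let u2 : u * u = u + c%:A. Proof. by case: ru. Qed.
Let u'2 : u' * u' = u' + c'%:A. Proof. by case: ru'. Qed.
Let Lu : u \in L := pair_mem1 bp.
Let Lu' : u' \in L := pair_mem2 bp.
Let su : sigma u = u := frame_fix fr Lu.
Let su' : sigma u' = u' := frame_fix fr Lu'.
Let W := Wvs sigma u u'.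

Lemma frame_Symd x : x \in L -> x \in Symd sigma.
Proof.
move=> xL; have [a [e1 ua u'a]] := frame_one_symmetrized fr bp.
have ax : a * x = x * a by apply: (comm_pair bp).
by apply/SymdP; exists (a * x); rewrite sM (frame_fix fr xL) ax -mulrDr -e1 mulr1.
Qed.

Variables (v : A) (beta : F).
Hypotheses (uv : flips u v) (vv : v * v = beta%:A) (beta0 : beta != 0).
Hypothesis sv_cent : forall y, u * y = y * u -> v * y = y * v ->
  sigma v * y = y * sigma v.

Let V0 : {vspace A} :=
  (Symd sigma :&: lker (amull u - amulr u) :&: lker (amull v - amulr v))%VS.

Let V0P x : reflect [/\ x \in Symd sigma, u * x = x * u & v * x = x * v] (x \in V0).
Proof.
rewrite /V0 !memv_cap !memv_ker !lfun_simp /= !subr_eq0 -andbA.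
by apply: (iffP and3P) => [[h1 /eqP h2 /eqP h3]|[h1 h2 h3]]; split=> //; apply/eqP.
Qed.

(** An element of [V0] is a root of a polynomial [X^2 - t X + n] over [F[u]],
    whose coefficients are fixed by conjugation by [v] and so lie in [F]. *)
Lemma V0_coord x : x \in V0 -> exists a a' b,
  comm_part u' c' x = a%:A + a' *: u' + b *: (u * (1 - 2 *: u')) /\
  (b = 0 -> exists m, flip_part u' c' x * flip_part u' c' x = m%:A).
Proof.
move=> /V0P[xS ux vx].
have x1u : u * comm_part u' c' x = comm_part u' c' x * u.
  by rewrite (comm_part_comm _ (esym uu') (esym ux)).
have xgW : flip_part u' c' x \in W.
  apply/WvsP; split; first exact: (flip_part_Symd fr (pairC bp)).
    by rewrite (flip_part_comm _ (esym uu') (esym ux)).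
  exact: (flip_partP ru').
have xgu' := flip_partP ru' x.
have := comm_flip_part ru' x.
have x1L : comm_part u' c' x \in L.
  apply: (Symd_pair_mem fr bp); rewrite ?(comm_partP ru') //.
  exact: (comm_part_Symd fr (pairC bp)).
have x1_id y : x = y%:A -> comm_part u' c' x = y%:A.
  by move=> ->; rewrite comm_part_id //; nc.
have [n0 [n1 en]] := W_square fr bp xgW.
have xgu := in_quad_W _ xgW.
move: (flip_part u' c' x) xgW xgu' en xgu => xg xgW xgu' en xgu.
have [a0 [a1 [b0 [b1 ex1]]]] := pair_coord bp x1L.
rewrite ex1 in x1_id *; move=> ex {x1u x1L}.
pose k := a0%:A + a1 *: u; pose k' := b0%:A + b1 *: u.
have qk : in_quad u k by exists a0, a1.
have qk' : in_quad u k' by exists b0, b1.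
have [m0 [m1 em]] : in_quad u (k * k + k * k' - c' *: (k' * k')).
  by apply: in_quadD; [apply: in_quadD | apply/in_quadN/in_quadZ]; apply: (in_quadM ru).
have kk' := in_quad_commC qk qk'.
have u'k : u' * k = k * u' by rewrite /k; nc_expand; rewrite uu'; nc.
have u'k' : u' * k' = k' * u' by rewrite /k'; nc_expand; rewrite uu'; nc.
have xgk := xgu _ qk; have xgk' := xgu _ qk'.
have eT : k + k + k' = (2 * a0 + b0)%:A + (2 * a1 + b1) *: u by rewrite /k /k'; nc.
rewrite -/k -/k' in ex ex1 x1_id *.
have h1 : xg * (k + k' * u') = (k + k' - k' * u') * xg.
  by rewrite mulrDr -xgk mulrA -xgk' -mulrA (xgu' : xg * u' = _); clearbody k k'; nc.
have nE : (k + k' * u') * (k + k' - k' * u') = k * k + k * k' - c' *: (k' * k').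
  clearbody k k'; have u'2A y := etale_rootA y ru'.
  nc_expand; rewrite -!(mulrA _ u' k) -!(mulrA _ u' k') u'k u'k' !mulrA u'2A.
  by rewrite ?(esym kk', commA _ kk'); nc.
have nE' : (k + k' - k' * u') * (k + k' * u') = k * k + k * k' - c' *: (k' * k').
  clearbody k k'; have u'2A y := etale_rootA y ru'.
  nc_expand; rewrite -!(mulrA _ u' k) -!(mulrA _ u' k') u'k u'k' !mulrA u'2A.
  by rewrite ?(esym kk', commA _ kk'); nc.
have xx : x * x = ((2 * a0 + b0)%:A + (2 * a1 + b1) *: u) * x
    - ((m0 - n0)%:A + (m1 - n1) *: u).
  have -> : (m0 - n0)%:A + (m1 - n1) *: u = (m0%:A + m1 *: u) - (n0%:A + n1 *: u) by nc.
  rewrite -eT -em -en.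
  have eT' : k + k + k' = (k + k' * u') + (k + k' - k' * u') by nc.
  rewrite -nE -ex eT'; move: (k + k' * u') (k + k' - k' * u') h1 nE' nE => x1 x1b h1 e1 e2.
  have {e1 e2}e : x1b * x1 = x1 * x1b by rewrite e1 e2.
  by nc_expand; rewrite h1 e; nc.
have [p1 ep1] : exists p1, m1 - n1 = p1 by exists (m1 - n1).
rewrite ep1 in xx; move: (m0 - n0) xx => p0 xx.
have uv' := uv : v * u = _.
have e1 : (2 * a1 + b1) *: x = p1%:A.
  apply/eqP; rewrite -subr_eq0; apply/eqP.
  suff e : ((2 * a1 + b1) *: x - p1%:A) * v = 0.
    move/(congr1 (fun z => z * v)): e; rewrite mul0r -mulrA vv -scalerAr mulr1 => /eqP.
    by rewrite scaler_eq0 (negPf beta0) => /eqP.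
  apply: (etale_root_cancel ru).
  have : v * (x * x) = x * x * v by rewrite mulrA vx -!mulrA vx.
  rewrite xx; move: (2 * a0 + b0) (2 * a1 + b1) => t0 t1 e.
  have -> : (2 *: u - 1) * ((t1 *: x - p1%:A) * v) =
     ((t0%:A + t1 *: u) * x - (p0%:A + p1 *: u)) * v -
     v * ((t0%:A + t1 *: u) * x - (p0%:A + p1 *: u)).
    by do 2 (nc_expand; rewrite ?(uv', flipsA _ uv, vx, commA _ (esym vx))); nc.
  by rewrite e subrr.
have t10 : 2 * a1 + b1 = 0.
  apply/eqP; apply: contraT => t1.
  have ex' : x = ((2 * a1 + b1)^-1 * p1)%:A by rewrite -scalerA -e1 scalerA mulVf ?scale1r.
  have := x1_id _ ex'; set q := _ * p1 => eq.
  have : ((a0 - q)%:A + a1 *: u) + (b0%:A + b1 *: u) * u' = 0.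
    by rewrite -[RHS](subrr q%:A) -{1}eq /k /k'; nc.
  by case/(pair_indep bp) => _ a10 _ b10; rewrite a10 b10 mulr0 addr0 eqxx in t1.
have p10 : p1 = 0.
  by move: e1; rewrite t10 scale0r => /esym/eqP; rewrite scaler_eq0 oner_eq0 orbF => /eqP.
have b1E : b1 = - (2 * a1) by apply/eqP; rewrite -addr_eq0 addrC t10.
exists a0, b0, a1; split; first by rewrite /k /k' b1E; nc.
move=> a10; exists n0; rewrite en; suff -> : n1 = 0 by rewrite scale0r addr0.
have -> : n1 = m1 by rewrite -(subrK n1 m1) ep1 p10 add0r.
have b10 : b1 = 0 by rewrite b1E a10 mulr0 oppr0.
have : ((m0 - (a0 * a0 + a0 * b0 - c' * (b0 * b0)))%:A + m1 *: u)
    + (0%:A + 0 *: u) * u' = 0.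
  transitivity (m0%:A + m1 *: u - (a0 * a0 + a0 * b0 - c' * (b0 * b0))%:A); first by nc.
  by rewrite -em /k /k' a10 b10; nc.
by case/(pair_indep bp).
Qed.

(** Half of the [F]-subspace [V0] of symmetrized elements centralizing [u] and
    [v] projects to isotropic vectors of [W]; that this half is not contained in
    [L] is a dimension count when [u'] does not commute with [v], and is automatic
    when it does. *)
Lemma quaternion_W_square : exists x a, [/\ x \in W, a != 0 & x * x = a%:A].
Proof.
have good x a a' : x \in V0 -> x \notin L ->
    comm_part u' c' x = a%:A + a' *: u' -> exists x a, [/\ x \in W, a != 0 & x * x = a%:A].
  move=> xV xL ex; have [b0 [b1 [b [eb sq]]]] := V0_coord xV.
  have [xS ux vx] := V0P _ xV.
  have b_0 : b = 0.
    have : ((b0 - a)%:A + b *: u) + ((b1 - a')%:A + (- 2 * b) *: u) * u' = 0.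
      by rewrite -[RHS](subrr (comm_part u' c' x)) {1}eb ex; nc.
    by case/(pair_indep bp).
  apply: (W_invertible_square fr bp (y := flip_part u' c' x)); last exact: sq.
    apply/WvsP; split; first exact: (flip_part_Symd fr (pairC bp)).
      by rewrite (flip_part_comm _ (esym uu') (esym ux)).
    exact: (flip_partP ru').
  apply: contraNneq xL => xg0.
  by rewrite -(comm_flip_part ru' x) xg0 addr0 ex memvD ?memvZ.
have V0_descent x : x \in Symd sigma -> u * x = x * u ->
    exists t t', [/\ t \in V0, t' \in V0 & x = t + u * t'].
  move=> xS /(Symd_cent1 fr bp xS)[w uw ->].
  have [ud vd vd'] := descentP ru uv vv beta0 uw.
  set d := descent u v c beta w in ud vd vd'.
  have sv y : u * y = y * u -> v * y = y * v -> v * sigma y = sigma y * v.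
    move=> uy vy; have := congr1 sigma (sv_cent uy vy).
    by rewrite !sM !sK.
  have TV y : u * y = y * u -> v * y = y * v -> y + sigma y \in V0.
    move=> uy vy; apply/V0P; split; first exact: T_Symd.
      by rewrite mulrDr mulrDl uy (sigma_comm fr su uy).
    by rewrite mulrDr mulrDl vy sv.
  have ud' : u * (w - u * d) = (w - u * d) * u.
    by rewrite mulrBr mulrBl uw -[in RHS]mulrA ud.
  exists (w - u * d + sigma (w - u * d)), (d + sigma d); split; try exact: TV.
  by clearbody d; rewrite linearB /= sM su -(sigma_comm fr su ud); nc.
have V1 : 1 \in V0 by apply/V0P; rewrite !mulr1 !mul1r frame_Symd.
have [VL|/subvPn[x xV xL]] := boolP (V0 <= L)%VS.
  have [z [zW _ z0]] := W_idempotent fr bp (in_quad1 u) (mulr1 1) (oner_neq0 _).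
  have [zS uz fz] := WvsP _ _ _ _ zW; have [t [t' [tV t'V ez]]] := V0_descent z zS uz.
  have zL : z \in L by have sub := subvP VL; rewrite ez memvD ?memvM // sub.
  case/eqP: z0; rewrite (_ : z = 0) ?mul0r //; apply: (etale_root_cancel ru').
  have u'z : u' * z = z * u'.
    exact: (comm_pair bp (esym uu') erefl zL).
  have e : u' * z + u' * z = z by rewrite {1}u'z (fz : z * u' = _) subrK.
  have -> : (2 *: u' - 1) * z = u' * z + u' * z - z by nc.
  by rewrite e subrr.
have [a [a' [b [ex sq]]]] := V0_coord xV.
have [b_0|b0] := eqVneq b 0.
  by apply: (good x a a' xV xL); rewrite ex b_0 scale0r addr0.
have [/subvP V2|/subvPn[y yV yx]] := boolP (V0 <= span [:: 1; x]%R)%VS.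
  have LE : (L <= span [:: 1; x; u; u * x]%R)%VS.
    apply/subvP=> l lL.
    have ul : u * l = l * u := comm_pair bp erefl uu' lL.
    have [t [t' [tV t'V ->]]] := V0_descent l (frame_Symd lL) ul.
    have in2 w : w \in V0 -> exists p q, w = p *: 1 + q *: x.
      move/V2; rewrite span_cons span_seq1 => /memv_addP[_ /vlineP[p ->] [_ /vlineP[q ->] ->]].
      by exists p, q.
    have [p [q ->]] := in2 t tV; have [p' [q' ->]] := in2 t' t'V.
    rewrite mulrDr -!scalerAr mulr1 !memvD // memvZ // memv_span //;
      by rewrite !inE eqxx ?orbT.
  have dL : \dim L = 4.
    by rewrite (pair_span bp); apply/eqP; have := pair_free bp; rewrite /free.
  case/negP: xL; have /eqP -> : L == span [:: 1; x; u; u * x] :> {vspace A}.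
    by rewrite eqEdim LE dL dim_span.
  by rewrite memv_span // !inE eqxx ?orbT.
have [a1 [a1' [b1 [ey _]]]] := V0_coord yV.
pose z := y - (b1 / b) *: x.
have zV : z \in V0 by rewrite memvB ?memvZ.
have ez : comm_part u' c' z = (a1 - b1 / b * a)%:A + (a1' - b1 / b * a') *: u'.
  rewrite /z -scaleNr comm_partD comm_partZ ex ey.
  by apply: vcoord_inj => ?; rewrite ?(vcoordD, vcoordN, vcoordZ, vcoord0); field.
have [zL|zL] := boolP (z \in L); last exact: good zV zL ez.
have u'z : u' * z = z * u' := comm_pair bp (esym uu') erefl zL.
rewrite (comm_part_id ru' u'z) in ez.
move: (a1 - _) (a1' - _) ez => p q ez.
have q0 : q != 0.
  apply: contraNneq yx => q0; rewrite -(subrK ((b1 / b) *: x) y) -/z ez q0 scale0r addr0.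
  by rewrite memvD ?memvZ ?memv_span ?inE ?eqxx ?orbT.
have u'V : u' \in V0.
  have -> : u' = q^-1 *: (z - p%:A) by rewrite ez addrC addKr scalerA mulVf ?scale1r.
  by rewrite memvZ ?memvB ?memvZ.
have [_ _ vu'] := V0P _ u'V; have [xS ux vx] := V0P _ xV.
have xV' : u' * x * u' \in V0.
  apply/V0P; split; first by apply: (Symd_conj fr).
    by rewrite !mulrA uu' -(mulrA u') ux !mulrA -(mulrA _ u) uu' mulrA.
  by rewrite !mulrA vu' -(mulrA u') vx !mulrA -(mulrA _ v) vu' mulrA.
have [p2 [q2 [b2 [ex2 _]]]] := V0_coord xV'.
rewrite comm_part_mul // ex in ex2; case/eqP: b0.
have : ((a * c' + a' * c' - p2)%:A + (- b * c' - b2) *: u)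
     + ((a + a' * (1 + c') - q2)%:A + (- b * (1 + 2 * c') + 2 * b2) *: u) * u' = 0.
  rewrite -[RHS](subrr (p2%:A + q2 *: u' + b2 *: (u * (1 - 2 *: u')))) -{1}ex2.
  have u'2A w := etale_rootA w ru'.
  by do 2 (nc_expand; rewrite ?(u'2, u'2A, esym uu', commA _ uu')); nc.
case/(pair_indep bp) => _ e1 _ e2.
apply/eqP; have := mulf_eq0 (1 + 4 * c') b; have [_ /negPf ->] := ru'; rewrite /= => <-.
apply/eqP; transitivity (- (2 * (- b * c' - b2) + (- b * (1 + 2 * c') + 2 * b2))); first by ring.
by rewrite e1 e2 mulr0 addr0 oppr0.
Qed.

End Quaternion.

(** * Decomposing pairs and hyperbolicity *)

Lemma dim_double (F : fieldType) (V : vectType F) (X Y : {vspace V}) (h : 'End(V)) :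
    (forall y1 y2, y1 \in Y -> y2 \in Y -> y1 + h y2 \in X) ->
    (forall x, x \in X -> exists y1 y2, [/\ y1 \in Y, y2 \in Y & x = y1 + h y2]) ->
    (forall y1 y2, y1 \in Y -> y2 \in Y -> y1 + h y2 = 0 -> y1 = 0 /\ y2 = 0) ->
  \dim X = (2 * \dim Y)%N.
Proof.
move=> YX XY Y0.
have -> : X = (Y + h @: Y)%VS.
  apply/vspaceP => x; apply/idP/idP=> [/XY[y1 [y2 [h1 h2 ->]]]|].
    by rewrite memv_add // memv_img.
  by case/memv_addP=> y1 h1 [_ /memv_imgP[y2 h2 ->] ->]; apply: YX.
have YhY : (Y :&: h @: Y = 0)%VS.
  apply/eqP; rewrite -subv0; apply/subvP=> y; rewrite memv_cap memv0.
  case/andP=> yY /memv_imgP[y2 h2 e]; have [||y_0 _] := Y0 y (- y2) yY.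
  - by rewrite memvN.
  - by rewrite linearN /= -e subrr.
  by rewrite y_0.
rewrite dimv_disjoint_sum // limg_dim_eq ?mul2n ?addnn //.
apply/eqP; rewrite -subv0; apply/subvP=> y; rewrite memv_cap memv0 memv_ker.
case/andP=> yY /eqP hy; by have [|_ ->] := Y0 0 y (mem0v _) yY; rewrite ?hy ?addr0.
Qed.

Lemma lfun_bijective (F : fieldType) (V W : vectType F) (f : 'Hom(V, W)) :
  injective f -> dim V = dim W -> bijective f.
Proof.
move=> /lker0P/eqP f0 dVW.
have fV : limg f = fullv.
  by apply/eqP; rewrite eqEdim subvf limg_dim_eq ?f0 ?capv0 // !dimvf dVW leqnn.
exists (f^-1)%VF; first by apply: lker0_lfunK; rewrite f0.
by move=> w; apply: limg_lfunVK; rewrite fV memvf.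
Qed.

Section Decompositions.

Variables (F : fieldType) (A : falgType F) (sigma : 'End(A)).
Implicit Types (u v x y z : A) (c a b : F).

Lemma scalar_in_quad u c x a k : etale_root u c -> flips u x -> x * x = a%:A ->
  a != 0 -> in_quad u k -> k * x = x * k -> exists b, k = b%:A.
Proof.
move=> ru ux xx a0 [k0 [k1 ->]] kx; exists k0.
suff -> : k1 = 0 by rewrite scale0r addr0.
have e : k1 *: ((2 *: u - 1) * x) = 0.
  transitivity ((k0%:A + k1 *: u) * x - x * (k0%:A + k1 *: u)); last by rewrite kx subrr.
  by nc_expand; rewrite (ux : x * u = _); nc.
apply/eqP; apply: contraT => k10.
move/eqP: e; rewrite scaler_eq0 (negPf k10) /= => /eqP/(etale_root_cancel ru) x0.
move: xx; rewrite x0 mul0r => /esym/eqP.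
by rewrite scaler_eq0 (negPf a0) oner_eq0.
Qed.

(** Two commuting elements generating, with [u'] and [u] respectively, two
    independent stable quaternion algebras. *)
Definition decomposing_pair u u' : Prop := exists x v a b,
  [/\ x \in Wvs sigma u u', v \in Wvs sigma u' u, x * v = v * x,
      x * x = a%:A /\ a != 0 & v * v = b%:A /\ b != 0].

Lemma decomposing_pairC u u' : decomposing_pair u u' -> decomposing_pair u' u.
Proof.
by move=> [x [v [a [b [xW vW xv ha hb]]]]]; exists v, x, b, a; split.
Qed.

Section Pair.

Variables (L : {aspace A}) (u u' : A) (c c' : F).
Hypotheses (fr : symmetric_frame sigma L) (bp : biquadratic_pair L u u' c c').

Let sM := frame_anti fr.
Let ru := pair_root bp.
Let ru' := pair_root' bp.
Let uu' := pair_comm bp.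
Let Lu : u \in L := pair_mem1 bp.
Let Lu' : u' \in L := pair_mem2 bp.
Let su : sigma u = u := frame_fix fr Lu.
Let su' : sigma u' = u' := frame_fix fr Lu'.

(** The elements of [Wvs u u'] that commute with [v] form an [F]-structure of this
    [F[u]]-module. *)
Lemma W_descent v b x : v \in Wvs sigma u' u -> v * v = b%:A -> b != 0 ->
    x \in Wvs sigma u u' ->
  [/\ descent u v c b x \in Wvs sigma u u',
      v * descent u v c b x = descent u v c b x * v,
      x - u * descent u v c b x \in Wvs sigma u u'
    & v * (x - u * descent u v c b x) = (x - u * descent u v c b x) * v].
Proof.
move=> /WvsP[vS u'v uv] vv b0 xW; have [xS ux fx] := WvsP _ _ _ _ xW.
have [_ vd vd'] := descentP ru uv vv b0 ux.
have dW : descent u v c b x \in Wvs sigma u u'.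
  rewrite /descent memvZ // (W_mul fr bp) //; first by exists (- 1), 2; nc.
  rewrite memvB ?memvZ //; apply/WvsP; split.
  - by apply: (Symd_conj fr) => //; apply: (Symd_fix fr).
  - exact: (flips_flips (flips_comm uv ux) uv).
  exact: flips_comm (comm_flips u'v fx) u'v.
by split=> //; rewrite memvB // (W_mul fr bp) //; exists 0, 1; nc.
Qed.

End Pair.

Section Pair.

Variables (L : {aspace A}) (u u' : A) (c c' : F).
Hypotheses (fr : symmetric_frame sigma L) (bp : biquadratic_pair L u u' c c').

Let sM := frame_anti fr.
Let ru := pair_root bp.
Let ru' := pair_root' bp.
Let uu' := pair_comm bp.
Let Lu : u \in L := pair_mem1 bp.
Let Lu' : u' \in L := pair_mem2 bp.
Let su : sigma u = u := frame_fix fr Lu.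
Let su' : sigma u' = u' := frame_fix fr Lu'.

(** The second element is found in the centralizer of the first one: it spans
    [Wvs u' u] over [F[u']], so the squaring map does not vanish there. *)
Lemma W_decomposing x a : x \in Wvs sigma u u' -> a != 0 -> x * x = a%:A ->
  decomposing_pair u u'.
Proof.
move=> xW a0 xx; have [xS ux fx] := WvsP _ _ _ _ xW.
have [y [yW _ y0]] := W_idempotent fr (pairC bp) (in_quad1 u') (mulr1 1) (oner_neq0 _).
have good t : t \in Wvs sigma u' u -> x * t = t * x -> t * t != 0 -> decomposing_pair u u'.
  move=> tW xt t0.
  have [|b eb] := scalar_in_quad ru' fx xx a0 (W_square fr (pairC bp) tW).
    by rewrite -mulrA -xt mulrA -xt mulrA.
  exists x, t, a, b; split=> //; split=> //.
  by apply: contraNneq t0 => b0; rewrite eb b0 scale0r.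
have [dW xd eW xe] := W_descent fr (pairC bp) xW xx a0 yW.
move: (descent _ _ _ _ _) dW xd eW xe => d dW xd eW xe.
have [d0|] := eqVneq (d * d) 0; last exact: good.
have [e0|] := eqVneq ((y - u' * d) * (y - u' * d)) 0; last exact: good.
have [f0|] := eqVneq ((y - u' * d + d) * (y - u' * d + d)) 0; last first.
  by apply: good; [apply: memvD | rewrite mulrDr mulrDl xe xd].
have [_ u'd _] := WvsP _ _ _ _ dW; have [_ u'e _] := WvsP _ _ _ _ eW.
case/eqP: y0; rewrite -(subrK (u' * d) y).
move: (y - u' * d) e0 f0 u'e {xe eW} => e e0 f0 u'e.
have -> : (e + u' * d) * (e + u' * d) = e * e + u' * ((e + d) * (e + d) - e * e - d * d)
    + u' * u' * (d * d).
  by nc_expand; rewrite ?(esym u'd, esym u'e, commA _ u'd, commA _ u'e); nc.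
by rewrite e0 f0 d0 !subr0 !mulr0 !addr0.
Qed.

(** The subalgebras are isotropic of half the dimension for
    [x |-> s (x ^ 2)]: this is the mechanism behind hyperbolicity. *)
Lemma decomposing_dim x v a b :
    x \in Wvs sigma u u' -> v \in Wvs sigma u' u ->
    x * x = a%:A -> a != 0 -> v * v = b%:A -> b != 0 ->
  \dim (Wvs sigma u u') = (2 * \dim (Wvs sigma u u' :&: 'C[v]))%N /\
  \dim {:A} = (8 * \dim (Wvs sigma u u'))%N.
Proof.
move=> xW vW xx a0 vv b0; have [xS ux fx] := WvsP _ _ _ _ xW.
have [vS u'v fv] := WvsP _ _ _ _ vW.
have comm_flips0 w y1 y2 d : etale_root w d -> w * y1 = y1 * w -> flips w y2 ->
    y1 + y2 = 0 -> y1 = 0 /\ y2 = 0.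
  move=> rw wy1 fy2 e; suff y10 : y1 = 0 by split=> //; rewrite -e y10 add0r.
  apply: (etale_root_cancel rw).
  have {e}e : y2 = - y1 by apply/eqP; rewrite -addr_eq0 addrC e.
  move: fy2; rewrite e /flips mulNr mulrN opprK -wy1 => fy.
  have -> : (2 *: w - 1) * y1 = w * y1 + (- y1 + w * y1) by nc.
  by rewrite -fy subrr.
split; last have e1 : \dim {:A} = (2 * \dim 'C[u])%N.
- apply: (dim_double (h := amull u)) => [y1 y2|y yW|y1 y2].
  + move=> /memv_capP[y1W _] /memv_capP[y2W _]; rewrite lfunE /=.
    by apply: memvD => //; apply: (W_mul fr bp) => //; exists 0, 1; nc.
  + have [dW vd eW ve] := W_descent fr bp vW vv b0 yW.
    exists (y - u * descent u v c b y), (descent u v c b y).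
    by split; [apply/memv_capP; split=> //; apply/cent1vP.. | rewrite lfunE /= subrK].
  move=> /memv_capP[y1W /cent1vP vy1] /memv_capP[y2W /cent1vP vy2]; rewrite lfunE /= => e.
  have [_ uy1 _] := WvsP _ _ _ _ y1W; have [_ uy2 _] := WvsP _ _ _ _ y2W.
  have y20 : y2 = 0.
    suff : y2 * v = 0.
      move/(congr1 (fun z => z * v)); rewrite mul0r -mulrA vv -scalerAr mulr1 => /eqP.
      by rewrite scaler_eq0 (negPf b0) => /eqP.
    apply: (etale_root_cancel ru).
    have -> : (2 *: u - 1) * (y2 * v) = (y1 + u * y2) * v - v * (y1 + u * y2).
      by do 2 (nc_expand; rewrite ?(fv : v * u = _, esym vy1, esym vy2, commA _ vy2)); nc.
    by rewrite e mul0r mulr0 subrr.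
  by move: e; rewrite y20 mulr0 addr0.
- apply: (dim_double (h := amulr v)) => [y1 y2 _ _|y _|y1 y2]; first exact: memvf.
    exists (comm_part u c y), (b^-1 *: (flip_part u c y * v)); split.
    - by apply/cent1vP; rewrite (comm_partP ru).
    - by rewrite memvZ //; apply/cent1vP; rewrite -(flips_flips (flip_partP ru y) fv).
    by rewrite lfunE /= -scalerAl -mulrA vv -scalerAr mulr1 scalerA mulVf // scale1r
      (comm_flip_part ru).
  move=> /cent1vP uy1 /cent1vP uy2; rewrite lfunE /= => e.
  have [-> yv] := comm_flips0 u y1 (y2 * v) c ru (esym uy1) (comm_flips (esym uy2) fv) e.
  split=> //; move/(congr1 (fun z => z * v)): yv.
  rewrite mul0r -mulrA vv -scalerAr mulr1 => /eqP.
  by rewrite scaler_eq0 (negPf b0) => /eqP.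
have xkill y : y * x = 0 -> y = 0.
  move/(congr1 (fun z => z * x)); rewrite mul0r -mulrA xx -scalerAr mulr1 => /eqP.
  by rewrite scaler_eq0 (negPf a0) => /eqP.
pose B := ('C[u] :&: lker (amull u' + amulr u' - \1%VF)%R)%VS.
have BP y : reflect (u * y = y * u /\ flips u' y) (y \in B).
  rewrite memv_cap memv_ker !lfun_simp /= subr_eq0.
  apply: (iffP andP) => [[/cent1vP uy /eqP e]|[uy fy]]; split=> //.
  - by rewrite /flips -[in X in X - _]e addrC addKr.
  - exact/cent1vP.
  by rewrite (fy : y * u' = _) addrC subrK.
have e2 : \dim 'C[u] = (2 * \dim B)%N.
  apply: (dim_double (h := amulr x)) => [y1 y2|y /cent1vP yu|y1 y2].
  - move=> /BP[uy1 _] /BP[uy2 _]; rewrite lfunE /= memvD //; apply/cent1vP => //.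
    by rewrite -mulrA -ux !mulrA uy2.
  - exists (flip_part u' c' y), (a^-1 *: (comm_part u' c' y * x)); split.
    + apply/BP; split; last exact: (flip_partP ru').
      by rewrite (flip_part_comm _ (esym uu') yu).
    + rewrite memvZ //; apply/BP; split.
        by rewrite mulrA -(comm_part_comm _ (esym uu') yu) -!mulrA ux.
      by apply: comm_flips => //; apply: (comm_partP ru').
    by rewrite lfunE /= -scalerAl -mulrA xx -scalerAr mulr1 scalerA mulVf // scale1r
      addrC (comm_flip_part ru').
  move=> /BP[uy1 fy1] /BP[uy2 fy2]; rewrite lfunE /= addrC => e.
  have [yx ->] := comm_flips0 u' (y2 * x) y1 c' ru' (flips_flips fy2 fx) fy1 e.
  by split=> //; apply: xkill.
suff e3 : \dim B = (2 * \dim (Wvs sigma u u'))%N by rewrite e1 e2 e3 !mulnA.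
apply: (dim_double (h := amull u')) => [y1 y2 y1W y2W|y /BP[uy fy]|y1 y2 y1W y2W].
- have [_ uy1 fy1] := WvsP _ _ _ _ y1W; have [_ uy2 fy2] := WvsP _ _ _ _ y2W.
  rewrite lfunE /=; apply/BP; split; last by apply: flipsD => //; apply: comm_flips.
  by rewrite mulrDr mulrDl uy1 mulrA uu' -!mulrA uy2.
- have syf := sigma_flips fr su' fy.
  pose d := (1 + 4 * c')^-1; have d0 : 1 + 4 * c' != 0 by have [] := ru'.
  exists (d *: ((1 + 2 * c') *: (y + sigma y)  - (u' * y + sigma (u' * y)))),
    (d *: (2 *: (u' * y + sigma (u' * y)) - (y + sigma y))).
  have TW : y + sigma y \in Wvs sigma u u' by apply: (W_T fr bp).
  have TW' : u' * y + sigma (u' * y) \in Wvs sigma u u'.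
    by apply: (W_T fr bp); [rewrite mulrA uu' -!mulrA uy | apply: comm_flips].
  rewrite !memvZ ?memvB ?memvZ //; split=> //.
  have u'2A := fun w => etale_rootA w ru'; have [u'2 _] := ru'.
  rewrite lfunE /= sM su' (syf : sigma y * u' = _) -scalerAr -scalerDr.
  apply: (scalerI d0); rewrite scalerA mulfV // scale1r.
  by nc_expand; rewrite u'2; nc.
rewrite lfunE /= => e.
have [y1S uy1 fy1] := WvsP _ _ _ _ y1W; have [y2S uy2 fy2] := WvsP _ _ _ _ y2W.
have y20 : y2 = 0.
  apply: (etale_root_cancel ru').
  have := congr1 sigma e.
  rewrite linearD linear0 /= sM su' (Symd_fix fr y1S) (Symd_fix fr y2S).
  rewrite (fy2 : y2 * u' = _) => e'.
  have -> : (2 *: u' - 1) * y2 = (y1 + u' * y2) - (y1 + (y2 - u' * y2)) by nc.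
  by rewrite e e' subrr.
by move: e; rewrite y20 mulr0 addr0.
Qed.

(** With [T] the elements of [Wvs u u'] that commute with [v], which have scalar
    squares, [Wvs u u' = T + u T] and
    [(t + u t') ^ 2 = t ^ 2 + c t' ^ 2 + (t t' + t' t + t' ^ 2) u], so that
    [q (t + u t') = s (t t' + t' t + t' t')]: a bilinear pairing of [t'] with a
    linear function of [(t, t')]. *)
Lemma decomposing_hyperbolic (U : {vspace A}) (q : subvs_of U -> F) (s : F) :
    decomposing_pair u u' -> U = Wvs sigma u u' -> s != 0 ->
    (forall (x : subvs_of U) a b, vsval x * vsval x = a%:A + b *: u -> q x = s * b) ->
  exists m, [/\ \dim {:A} = (16 * m)%N, (0 < m)%N
    & isometric q (fun p : 'rV[F]_m * 'rV[F]_m => \sum_i p.1 0 i * p.2 0 i)].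
Proof.
move=> [x0 [v [a0 [b0 [x0W vW x0v [xx a00] [vv b00]]]]]] eU s0 qE.
have [dW dA] := decomposing_dim x0W vW xx a00 vv b00.
have [vS u'v fv] := WvsP _ _ _ _ vW.
set T := (Wvs sigma u u' :&: 'C[v])%VS in dW.
exists (\dim T); split.
- by rewrite dA dW mulnA.
- rewrite lt0n; apply/eqP=> T0; have := x0W; rewrite T0 muln0 in dW.
  move/eqP: dW; rewrite dimv_eq0 => /eqP ->; rewrite memv0 => /eqP x00.
  move: xx; rewrite x00 mul0r => /esym/eqP.
  by rewrite scaler_eq0 (negPf a00) oner_eq0.
have /existsP[i0 i00] : [exists i, vcoord i (1 : A) != 0].
  apply: contraT; rewrite negb_exists => /forallP h.
  case/eqP: (oner_neq0 A); apply: vcoord_inj => i; rewrite vcoord0.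
  by have := h i; rewrite negbK => /eqP.
pose p (z : A) := vcoord i0 z / vcoord i0 (1 : A).
have p1 a : p a%:A = a by rewrite /p vcoordZ mulfK.
have pD y z : p (y + z) = p y + p z by rewrite /p vcoordD mulrDl.
have pZ a z : p (a *: z) = a * p z by rewrite /p vcoordZ mulrA.
clearbody p; pose D y := descent u v c b0 y.
have DD a y z : D (a *: y + z) = a *: D y + D z.
  by rewrite /D /descent; move: (_^-1) => k; nc.
have TP t : t \in T -> t \in Wvs sigma u u' /\ v * t = t * v.
  by case/memv_capP=> tW /cent1vP.
have DT y : y \in Wvs sigma u u' -> D y \in T /\ y - u * D y \in T.
  move=> yW; have [h1 h2 h3 h4] := W_descent fr bp vW vv b00 yW.
  by split; apply/memv_capP; split=> //; apply/cent1vP.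
have Tsq t : t \in T -> exists a, t * t = a%:A.
  case/TP=> tW vt; apply: (scalar_in_quad ru fv vv b00 (W_square fr bp tW)).
  by rewrite -mulrA -vt mulrA -vt mulrA.
have Tpol t t' : t \in T -> t' \in T -> t * t' + t' * t = (p (t * t' + t' * t))%:A.
  move=> tT t'T; have [a ea] := Tsq _ (memvD tT t'T).
  have [a1 e1] := Tsq _ tT; have [a2 e2] := Tsq _ t'T.
  have -> : t * t' + t' * t = (a - a1 - a2)%:A by rewrite !scalerBl -ea -e1 -e2; nc.
  by rewrite p1.
have Tsq' t : t \in T -> t * t = (p (t * t))%:A by case/Tsq=> a ->; rewrite p1.
have Tj (j : 'I_(\dim T)) : (vbasis T)`_j \in T.
  by rewrite vbasis_mem // mem_nth ?size_tuple.
clearbody D.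
pose f1 (y : A) : 'rV[F]_(\dim T) := \row_j (s * p
  ((y - u * D y) * (vbasis T)`_j + (vbasis T)`_j * (y - u * D y) + D y * (vbasis T)`_j)).
pose f2 (y : A) : 'rV[F]_(\dim T) := \row_j coord (vbasis T) j (D y).
pose f (y : subvs_of U) := (f1 (vsval y), f2 (vsval y)).
have f_lin : linear f.
  move=> a y z; rewrite /f linearP /=; congr (_, _); apply/rowP=> j; rewrite !mxE DD; last first.
    by rewrite linearP.
  rewrite (_ : forall w1 w2 w3 w4 w5 : A, (a *: w1 + w2 - u * (a *: w3 + w4)) * w5
      + w5 * (a *: w1 + w2 - u * (a *: w3 + w4)) + (a *: w3 + w4) * w5 =
    a *: ((w1 - u * w3) * w5 + w5 * (w1 - u * w3) + w3 * w5)
      + ((w2 - u * w4) * w5 + w5 * (w2 - u * w4) + w4 * w5)); last by move=> *; nc.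
  by rewrite pD pZ mulrDr mulrCA.
pose fL : {linear subvs_of U -> ('rV[F]_(\dim T) * 'rV[F]_(\dim T))%type} :=
  HB.pack f (GRing.isLinear.Build _ _ _ _ f f_lin).
have fU (y : subvs_of U) : vsval y \in Wvs sigma u u' by rewrite -eU subvsP.
exists (linfun fL); split.
- apply: lfun_bijective; last first.
    have -> : dim (subvs_of U) = \dim U by [].
    have -> : dim ('rV[F]_(\dim T) * 'rV[F]_(\dim T))%type = (\dim T + \dim T)%N.
      by transitivity (1 * \dim T + 1 * \dim T)%N; [|rewrite !mul1n].
    by rewrite eU dW mul2n addnn.
  suff f0 (y : subvs_of U) : f y = 0 -> y = 0.
    move=> y z; rewrite !lfunE /= => e; apply/eqP; rewrite -subr_eq0; apply/eqP/f0.
    by rewrite -[f _]/(fL _) linearB /= e subrr.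
  case=> e1 e2.
  have [dT tT] := DT _ (fU y); apply: subvs_inj; rewrite linear0.
  have d0 : D (vsval y) = 0.
    rewrite (coord_vbasis dT) big1 // => j _.
    by have /rowP/(_ j) := e2; rewrite !mxE => ->; rewrite scale0r.
  rewrite d0 mulr0 subr0 in tT; have [tW vt] := TP _ tT.
  have pol z : z \in T -> vsval y * z + z * vsval y = 0.
    move=> zT; rewrite (coord_vbasis zT) mulr_sumr mulr_suml -big_split big1 //= => j _.
    rewrite -scalerAl -scalerAr -scalerDr (Tpol _ _ tT (Tj j)).
    have /rowP/(_ j) := e1; rewrite !mxE d0 mulr0 mul0r subr0 addr0 => /eqP.
    by rewrite mulf_eq0 (negPf s0) /= => /eqP ->; rewrite scale0r scaler0.
  apply: (W_nondegenerate fr bp tW) => z zW; have [dzT tzT] := DT z zW.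
  rewrite -(subrK (u * D z) z) mulrDr mulrDl addrACA pol // add0r.
  have [_ uy _] := WvsP _ _ _ _ tW.
  by rewrite mulrA -uy -!mulrA -mulrDr pol // mulr0.
move=> y; rewrite lfunE /= /f1 /f2.
have [dT tT] := DT _ (fU y).
have -> : q y = s * p ((vsval y - u * D (vsval y)) * D (vsval y) +
    D (vsval y) * (vsval y - u * D (vsval y)) + D (vsval y) * D (vsval y)).
  move: (vsval y) (D (vsval y)) (qE y) dT tT => z d qz dT tT.
  apply: (qz (p ((z - u * d) * (z - u * d)) + c * p (d * d))).
  move: (z - u * d) (subrK (u * d) z) tT => t <- tT.
  have [_ ud _] := WvsP _ _ _ _ (TP _ dT).1; have [_ ut _] := WvsP _ _ _ _ (TP _ tT).1.
  have [u2 _] := ru.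
  have -> : (t + u * d) * (t + u * d) = t * t + u * (t * d + d * t) + u * u * (d * d).
    by nc_expand; rewrite ?(esym ud, esym ut, commA _ ud, commA _ ut); nc.
  rewrite pD u2; have := Tsq' _ tT; have := Tsq' _ dT; have := Tpol _ _ tT dT.
  by move: (p (t * t)) (p (d * d)) (p (t * d + d * t)) => a1 a2 a3 -> -> ->; nc.
move: (vsval y) (D (vsval y)) dT tT => z d dT tT.
pose h w := (z - u * d) * w + w * (z - u * d) + d * w; pose g w := s * p (h w).
have hD w1 w2 : h (w1 + w2) = h w1 + h w2 by rewrite /h; nc.
have hZ a w : h (a *: w) = a *: h w by rewrite /h; nc.
have gD w1 w2 : g (w1 + w2) = g w1 + g w2 by rewrite /g hD pD mulrDr.
have gZ a w : g (a *: w) = a * g w by rewrite /g hZ pZ mulrCA.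
rewrite -[RHS]/(g d) [in RHS](coord_vbasis dT) (big_morph g gD (_ : _ = 0)); last first.
  by rewrite -(scale0r 0) gZ mul0r.
by apply: eq_bigr => j _; rewrite gZ !mxE mulrC.
Qed.

End Pair.
End Decompositions.

(** * Hyperbolic forms are Pfister forms *)

Definition split_quadratic (F : fieldType) : falgType F :=
  HB.pack (F^o * F^o)%type.

Section HyperbolicPfister.

Variable F : fieldType.

Lemma lfun_monoid_ahom (B : falgType F) (E : fieldExtType F) (h : 'Hom(B, E)) :
    h 1 = 1 -> (forall x y, h (x * y) = h x * h y) ->
  exists f : 'AHom(B, E), forall x, f x = h x.
Proof.
move=> h1 hM; have hA : ahom_in {:B} h by apply/ahomP_tmp; split.
by exists (AHom hA).
Qed.

Lemma split_quadratic_etale : quadratic_etale (split_quadratic F).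
Proof.
split; first by rewrite dimvf.
pose K := split_quadratic F.
have [f1 e1] : exists f : 'AHom(K, F^o), forall x, f x = x.1.
  have [|x y|f e] := @lfun_monoid_ahom K F^o (linfun (@fst F^o F^o : F^o * F^o -> F^o)).
  - by rewrite lfunE.
  - by rewrite !lfunE.
  by exists f => x; rewrite e lfunE.
have [f2 e2] : exists f : 'AHom(K, F^o), forall x, f x = x.2.
  have [|x y|f e] := @lfun_monoid_ahom K F^o (linfun (@snd F^o F^o : F^o * F^o -> F^o)).
  - by rewrite lfunE.
  - by rewrite !lfunE.
  by exists f => x; rewrite e lfunE.
exists 2, (fun=> F^o), (fun i => if i == 0 then f1 else f2); split.
  by move=> i; rewrite regular_fullv separable_refl.
move=> y; exists (y 0, y 1); split=> [i|x ex].
  by case: eqP => [->|/eqP]; rewrite ?e1 ?e2 //; case: i => [[|[|[]]] ] //= lti _;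
    congr (y _); apply: val_inj.
have := ex 0; have := ex 1; rewrite /= e1 e2 => <- <-.
by case: (x).
Qed.

(** The norm is defined from one basis; the matrices in two bases are
    conjugate. *)
Lemma alg_norm_basis (K : falgType F) (X : (\dim {:K}).-tuple K) x :
  basis_of fullv X ->
  alg_norm x = \det (\matrix_(i, j) coord X j (x * X`_i)).
Proof.
move=> bX; pose b := vbasis {:K}.
pose P := \matrix_(i, j) coord b j X`_i : 'M[F]_(\dim {:K}).
pose Q := \matrix_(i, j) coord X j b`_i : 'M[F]_(\dim {:K}).
have QP : Q *m P = 1%:M.
  apply/matrixP => i j; rewrite !mxE; under eq_bigr do rewrite !mxE.
  transitivity (coord b j (\sum_k coord X k b`_i *: X`_k)).
    by rewrite linear_sum; apply: eq_bigr => k _; rewrite linearZ.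
  rewrite -(coord_basis bX (memvf _)) coord_free 1?eq_sym //.
  exact: basis_free (vbasisP _).
rewrite /alg_norm -/b; set M := \matrix_(i, j) _; set N := \matrix_(i, j) _.
have PM : P *m M = N *m P.
  apply/matrixP => i j; rewrite !mxE; under eq_bigr do rewrite !mxE.
  under [RHS]eq_bigr do rewrite !mxE.
  transitivity (coord b j (x * X`_i)).
    rewrite [in RHS](coord_basis (vbasisP _) (memvf X`_i)) mulr_sumr linear_sum.
    by apply: eq_bigr => k _; rewrite -scalerAr linearZ.
  rewrite [in LHS](coord_basis bX (memvf (x * X`_i))) linear_sum.
  by apply: eq_bigr => k _; rewrite linearZ.
have := congr1 determinant PM; rewrite !det_mulmx mulrC => /mulIf; apply.
have := congr1 determinant QP; rewrite det_mulmx det1 => e.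
by apply: contraTneq (oner_neq0 F) => P0; rewrite -e P0 mulr0 eqxx.
Qed.

Definition hyperbolic_form m (p : 'rV[F]_m * 'rV[F]_m) : F :=
  \sum_i p.1 0 i * p.2 0 i.

Lemma split_quadratic_norm (x : split_quadratic F) : alg_norm x = x.1 * x.2.
Proof.
pose K := split_quadratic F.
have d2 : \dim {:K} = 2 by rewrite dimvf.
have szX : size [:: (1, 0) : K; (0, 1)] == \dim {:K} by rewrite d2.
pose X := Tuple szX.
have fX : basis_of fullv X.
  rewrite basisEdim (eqP szX) leqnn andbT; apply/subvP=> y _.
  have -> : y = y.1 *: ((1, 0) : K) + y.2 *: ((0, 1) : K).
    case: y => y1 y2; rewrite -[RHS]/(y1 * 1 + y2 * 0, y1 * 0 + y2 * 1).
    by rewrite !mulr1 !mulr0 addr0 add0r.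
  by rewrite memvD // memvZ // memv_span // !inE eqxx ?orbT.
rewrite (alg_norm_basis x fX).
have -> : (\matrix_(i, j) coord X j (x * X`_i)) = diag_mx (\row_i [:: x.1; x.2]`_i).
  apply/matrixP => i j; rewrite !mxE.
  have -> : x * X`_i = [:: x.1; x.2]`_i *: X`_i.
    have := ltn_ord i; rewrite {2}d2; case: (nat_of_ord i) => [|[|//]] _ /=.
      by rewrite -[LHS]/(x.1 * 1, x.2 * 0) -[RHS]/(x.1 * 1, x.1 * 0) !mulr0.
    by rewrite -[LHS]/(x.1 * 0, x.2 * 1) -[RHS]/(x.2 * 0, x.2 * 1) !mulr0.
  by rewrite linearZ /= coord_free ?(basis_free fX) // mulr_natr.
rewrite det_diag; under eq_bigr do rewrite mxE.
by rewrite -(big_mkord xpredT (fun i => [:: x.1; x.2]`_i)) d2 !big_nat_recr //= big_nil mul1r.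
Qed.

Lemma bijective_lfun (V W : vectType F) (f : V -> W) (f' : W -> V) :
    linear f -> cancel f f' -> cancel f' f ->
  exists h : 'Hom(V, W), bijective h /\ forall v, h v = f v.
Proof.
move=> lf ff' f'f.
pose fL : {linear V -> W} := HB.pack f (GRing.isLinear.Build _ _ _ _ f lf).
exists (linfun fL); split; last by move=> v; rewrite lfunE.
by exists f' => v; rewrite lfunE /= ?ff' ?f'f.
Qed.

(** The sign in [<1, -1>] is absorbed by changing the sign of the second
    half of one of the two isotropic summands. *)
Lemma isometric_hyperbolicD m : isometric (@hyperbolic_form (m + m))
  (pfister_mul 1 (@hyperbolic_form m)).
Proof.
pose f (p : 'rV[F]_(m + m) * 'rV[F]_(m + m)) :=
  ((lsubmx p.1, lsubmx p.2), (rsubmx p.1, - rsubmx p.2)).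
pose f' (p : ('rV[F]_m * 'rV[F]_m) * ('rV[F]_m * 'rV[F]_m)) :=
  (row_mx p.1.1 p.2.1, row_mx p.1.2 (- p.2.2)).
have [||p|h [bh hE]] := @bijective_lfun _ _ f f'.
- move=> a p q; rewrite /f !linearD !linearZ /=.
  by congr (_, _); congr (_, _); rewrite ?linearP // linearP /= opprD scalerN.
- by case=> p q; rewrite /f /f' /= opprK !hsubmxK.
- by case: p => [[p1 p2] [p3 p4]]; rewrite /f /f' /= !row_mxKl !row_mxKr opprK.
exists h; split=> // p; rewrite hE /pfister_mul /hyperbolic_form /= mul1r.
rewrite big_split_ord /= -sumrN; congr (_ + _); apply: eq_bigr => i _;
  by rewrite !mxE ?mulrN ?opprK.
Qed.

(** Start from the norm form [x y] of [F x F] and multiply by [<1, -1>]. *)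
Lemma pfister_hyperbolic n : pfister n.+1 (@hyperbolic_form (2 ^ n)).
Proof.
elim: n => [|n IHn].
  exists (split_quadratic F); split; first exact: split_quadratic_etale.
  pose f (p : 'rV[F]_(2 ^ 0) * 'rV[F]_(2 ^ 0)) : split_quadratic F := (p.1 0 0, p.2 0 0).
  pose f' (x : split_quadratic F) : 'rV[F]_(2 ^ 0) * 'rV[F]_(2 ^ 0) :=
    (const_mx x.1, const_mx x.2).
  have [|[p q]|[x y]|h [bh hE]] := @bijective_lfun _ _ f f'.
  - by move=> a p q; rewrite /f /= !mxE.
  - by congr (_, _); apply/rowP=> i; rewrite !mxE ord1.
  - by rewrite /f /f' /= !mxE.
  exists h; split=> // p; rewrite hE split_quadratic_norm /hyperbolic_form.
  by rewrite big_ord_recl big_ord0 addr0.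
exists 1, ('rV[F]_(2 ^ n) * 'rV[F]_(2 ^ n))%type, (@hyperbolic_form (2 ^ n)).
split=> //; first exact: oner_neq0.
rewrite expnS mul2n -addnn; exact: isometric_hyperbolicD.
Qed.

End HyperbolicPfister.

(** * Generators of quadratic etale subalgebras *)

Section EtaleSubalgebras.

Variables (F : fieldType) (A : falgType F) (L : {aspace A}).
Hypotheses (L1 : 1 \in L) (etL : etale (subvs_of L)).
Implicit Types (t x y : A) (a b : F).

Lemma vsval_one (B : {aspace A}) : 1 \in B -> vsval (1 : subvs_of B) = 1.
Proof. by rewrite -algid_eq1 => /eqP. Qed.

Lemma vsprojM (B : {aspace A}) x y : x \in B -> y \in B ->
  vsproj B (x * y) = vsproj B x * vsproj B y.
Proof.
by move=> xB yB; apply: subvs_inj; rewrite /= !vsprojK // memvM.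
Qed.

Lemma vsproj1 (B : {aspace A}) : 1 \in B -> vsproj B 1 = 1.
Proof. by move=> B1; apply: subvs_inj; rewrite vsprojK // vsval_one. Qed.

Lemma etale_reduced x : x \in L -> x * x = 0 -> x = 0.
Proof.
have [r [E [f [_ f_bij]]]] := etL => xL xx.
have [z [_ z_uniq]] := f_bij (fun=> 0).
have f0 : forall i, f i (vsproj L x) = 0.
  move=> i; have /eqP : f i (vsproj L x) * f i (vsproj L x) = 0.
    by rewrite -rmorphM -vsprojM // xx linear0 rmorph0.
  by rewrite mulf_eq0 orbb => /eqP.
rewrite -(vsprojK xL) -(z_uniq _ f0) (z_uniq 0) ?linear0 // => i.
by rewrite rmorph0.
Qed.

(** A vanishing discriminant would make [2 t - a] nilpotent; in characteristic 2
    the images of [t] in the factor fields would be both separable and purely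
    inseparable over [F], hence equal to the one square root of [b] in [F]. *)
Lemma etale_discriminant t a b : t \in L -> t * t = a *: t + b%:A ->
  t \notin 1%VS -> a ^+ 2 + 4 * b != 0.
Proof.
move=> tL tt tF; apply: contraNneq tF => d0.
have t2 : 2 *: t - a%:A = 0.
  apply: etale_reduced; first by rewrite memvB ?memvZ.
  transitivity ((a ^+ 2 + 4 * b)%:A : A); last by rewrite d0 scale0r.
  by nc_expand; rewrite tt; nc.
have [two0|two0] := eqVneq (2 : F) 0; last first.
  apply/vlineP; exists (2^-1 * a); rewrite -scalerA -(subrK (a%:A) (2 *: t)) in t2 *.
  by move/eqP: t2; rewrite addrK subr_eq0 => /eqP <-; rewrite scalerA mulVf // scale1r.
have a0 : a = 0.
  move/eqP: d0; rewrite (_ : 4 = 2 * 2 :> F); last by rewrite -natrM.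
  by rewrite two0 !mul0r addr0 expf_eq0 /= => /eqP.
rewrite {}a0 scale0r add0r in tt.
have [r [E [f [sepE f_bij]]]] := etL.
have f_inj x y : x \in L -> y \in L ->
    (forall i, f i (vsproj L x) = f i (vsproj L y)) -> x = y.
  move=> xL yL e; have [z [_ zu]] := f_bij (fun i => f i (vsproj L y)).
  by rewrite -(vsprojK xL) -(vsprojK yL) -(zu _ e) -(zu (vsproj L y)).
have f_sq i : exists a, f i (vsproj L t) = a%:A /\ a ^+ 2 = b.
  set s := f i (vsproj L t).
  have ss : s ^+ 2 = b%:A.
    by rewrite expr2 -rmorphM -vsprojM // tt linearZ /= linearZ /= vsproj1 // rmorph1.
  have : s \in 1%VS.
    rewrite -(separable_inseparable_element 1%AS s).
    apply/andP; split; first by apply: (separableP (sepE i)); rewrite ?memvf.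
    apply/purely_inseparable_elementP_pchar; exists 2.
      by rewrite pnatE // inE /= -(rmorph_nat (in_alg (E i))) two0 rmorph0.
    by rewrite ss memvZ ?mem1v.
  case/vlineP=> q es; exists q; split=> //.
  move: ss; rewrite es expr2 -scalerAl mul1r scalerA -expr2 => /eqP.
  by rewrite -subr_eq0 -scalerBl scaler_eq0 oner_eq0 orbF subr_eq0 => /eqP.
case: r E f {sepE f_bij} f_inj f_sq => [|r] E f f_inj f_sq.
  by rewrite (f_inj t 0) ?mem0v // => -[].
have [q [_ qq]] := f_sq ord0; apply/vlineP; exists q.
apply: f_inj; rewrite ?memvZ // => i; have [q' [-> qq']] := f_sq i.
rewrite linearZ /= linearZ /= vsproj1 // rmorph1; congr (_ *: _); apply/eqP.
have : (q' - q) ^+ 2 == 0.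
  have -> : (q' - q) ^+ 2 = q' ^+ 2 + q ^+ 2 - 2 * (q' * q) by ring.
  by rewrite qq qq' two0 mul0r subr0 -mulr2n -mulr_natl two0 mul0r.
by rewrite expf_eq0 subr_eq0.
Qed.

(** Completing the square is only possible away from characteristic 2; dividing
    by the trace, after a translation if it vanishes, always is. *)
Lemma etale_generator (M : {aspace A}) : (M <= L)%VS -> 1 \in M -> \dim M = 2%N ->
  exists u c, [/\ etale_root u c, u \in M & M = span [:: 1; u] :> {vspace A}].
Proof.
move=> ML M1 M2.
have [t tM tF] : exists2 t, t \in M & t \notin 1%VS.
  apply/subvPn; apply/negP=> /dimvS; rewrite M2 dimv1 //.
have gen u : u \in M -> u \notin 1%VS -> M = span [:: 1; u] :> {vspace A}.
  move=> uM uF; apply/eqP; rewrite eq_sym eqEdim; apply/andP; split.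
    by apply/span_subvP=> x; rewrite !inE => /orP[] /eqP ->.
  have : free [:: u; 1] by rewrite free_cons span_seq1 uF seq1_free oner_neq0.
  by rewrite /free M2 => /eqP /= <-; rewrite (@eq_span _ _ [:: u; 1] [:: 1; u]) // => x; rewrite !inE orbC.
have [a [b tt]] : exists a b, t * t = a *: t + b%:A.
  have : t * t \in M by rewrite memvM.
  rewrite (gen t tM tF) span_cons span_seq1.
  by case/memv_addP=> _ /vlineP[b ->] [_ /vlineP[a ->] ->]; exists a, b; rewrite addrC.
have d0 := etale_discriminant (subvP ML _ tM) tt tF.
suff [u [c [ru uM uF]]] : exists u c, [/\ etale_root u c, u \in M & u \notin 1%VS].
  by exists u, c; split=> //; apply: gen.
have notF a1 a2 : a1 != 0 -> a1 *: (t + a2%:A) \notin 1%VS.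
  move=> a10; apply: contra tF => h.
  rewrite -(addrK a2%:A t) memvB ?memvZ ?memv_line //.
  by rewrite -(scale1r (t + _)) -(mulVf a10) -scalerA memvZ.
have [a0|a0] := eqVneq a 0; last first.
  exists (a^-1 *: (t + 0%:A)), (b / a ^+ 2); split.
  - split; last first.
      by apply: contraNneq d0 => e; rewrite -[a ^+ 2](mulr1) -[X in _ * X](addrK (4 * (b / a ^+ 2)))
         e; apply/eqP; field.
    rewrite scale0r addr0 -scalerAl -scalerAr tt.
    by apply: vcoord_inj => ?; rewrite ?(vcoordD, vcoordN, vcoordZ, vcoord0); field.
  - by rewrite memvZ ?memvD ?memvZ.
  exact/notF/invr_neq0.
rewrite a0 expr0n add0r mulf_eq0 negb_or in d0; case/andP: d0 => four b0.
have two0 : (2 : F) != 0.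
  apply: contraNneq four => e; rewrite (_ : 4 = 2 * 2 :> F); last by rewrite -natrM.
  by rewrite e mul0r.
exists (2^-1 *: (t + 1%:A)), ((b - 1) / 4); split.
- split; last by rewrite mulrC mulfVK // addrC subrK.
  rewrite -scalerAl -scalerAr mulrDl !mulrDr tt a0.
  apply: vcoord_inj => i; rewrite scale1r !mulr1 !mul1r.
  by rewrite ?(vcoordD, vcoordN, vcoordZ, vcoord0); field; rewrite four two0.
- by rewrite memvZ ?memvD ?memvZ.
exact/notF/invr_neq0.
Qed.

End EtaleSubalgebras.

(** * Automorphisms of a biquadratic algebra *)

Section Automorphisms.

Variables (F : fieldType) (A : falgType F) (L : {aspace A}).
Hypothesis (L1 : 1 \in L).
Implicit Types (u x y k : A) (c a b : F).

Definition act (g : 'AEnd(subvs_of L)) (x : A) : A := vsval (g (vsproj L x)).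

Section Act.

Variable g : 'AEnd(subvs_of L).

Lemma actD x y : act g (x + y) = act g x + act g y.
Proof. by rewrite /act linearD /= linearD. Qed.
Lemma actZ a x : act g (a *: x) = a *: act g x.
Proof. by rewrite /act linearZ /= linearZ. Qed.
Lemma actB x y : act g (x - y) = act g x - act g y.
Proof. by rewrite actD -scaleN1r actZ scaleN1r. Qed.
Lemma actM x y : x \in L -> y \in L -> act g (x * y) = act g x * act g y.
Proof. by move=> xL yL; rewrite /act vsprojM // rmorphM. Qed.
Lemma act1 : act g 1 = 1.
Proof. by rewrite /act vsproj1 // rmorph1 vsval_one. Qed.
Lemma act_mem x : act g x \in L. Proof. exact: subvsP. Qed.

End Act.

Section Pair.

Variables (u u' : A) (c c' : F).
Hypothesis bp : biquadratic_pair L u u' c c'.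

Let ru := pair_root bp.
Let ru' := pair_root' bp.
Let uu' := pair_comm bp.
Let Lu : u \in L := pair_mem1 bp.
Let Lu' : u' \in L := pair_mem2 bp.

Lemma pair_commutative x y : x \in L -> y \in L -> x * y = y * x.
Proof.
move=> xL yL; apply: (comm_pair bp) yL.
  by rewrite -(comm_pair bp (erefl (u * u)) uu' xL).
by rewrite -(comm_pair bp (esym uu') (erefl (u' * u')) xL).
Qed.

Lemma pair_in_quad x : x \in L ->
  exists k k', [/\ in_quad u k, in_quad u k' & x = k + k' * u'].
Proof.
move/(pair_coord bp) => [a [b [a' [b' ->]]]].
by exists (a%:A + b *: u), (a'%:A + b' *: u); split=> //; [exists a, b | exists a', b'].
Qed.

Definition conjugates (g : 'AEnd(subvs_of L)) : Prop :=
  act g u = u /\ act g u' = 1 - u'.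

Lemma conjugates_quad g k : conjugates g -> in_quad u k -> act g k = k.
Proof.
by move=> [gu _] [a [b ->]]; rewrite actD !actZ gu act1.
Qed.

Lemma conjugatesE g k k' : conjugates g -> in_quad u k -> in_quad u k' ->
  act g (k + k' * u') = k + k' * (1 - u').
Proof.
move=> cg qk qk'; have k'L := in_quad_mem L1 Lu qk'.
by rewrite actD actM // (conjugates_quad cg qk) (conjugates_quad cg qk') cg.2.
Qed.

Lemma pair_automorphism : exists g, conjugates g /\ forall x : subvs_of L, g (g x) = x.
Proof.
have [f] := linear_of_free [:: 1; u; u'; u * u'] [:: 1; u; 1 - u'; u * (1 - u')].
move/(_ (pair_free bp) erefl) => /= [f1 fu fu' fuu'].
have fE k k' : in_quad u k -> in_quad u k' -> f (k + k' * u') = k + k' * (1 - u').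
  move=> [a [b ->]] [a' [b' ->]].
  have -> : a%:A + b *: u + (a'%:A + b' *: u) * u' =
     a%:A + b *: u + a' *: u' + b' *: (u * u') by nc.
  by rewrite !linearD !linearZ /= f1 fu fu' fuu'; nc.
have fL x : x \in L -> f x \in L.
  case/pair_in_quad=> k [k' [qk qk' ->]]; rewrite fE //.
  have := in_quad_mem L1 Lu qk; have := in_quad_mem L1 Lu qk'.
  by move=> h1 h2; rewrite memvD ?memvM ?memvB.
have mulE s k k' l l' : s * s = s + c'%:A -> s * l = l * s -> s * l' = l' * s ->
    (k + k' * s) * (l + l' * s) = (k * l + c' *: (k' * l')) + (k * l' + k' * l + k' * l') * s.
  move=> ss sl sl'; nc_expand; rewrite -!(mulrA _ s l) -!(mulrA _ s l') sl sl' !mulrA.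
  by rewrite -(mulrA _ s s) ss; nc.
have fM x y : x \in L -> y \in L -> f (x * y) = f x * f y.
  case/pair_in_quad=> k [k' [qk qk' ->]]; case/pair_in_quad=> l [l' [ql ql' ->]].
  have [u'2 _] := ru'; have [nu'2 _] := etale_root_compl ru'.
  have cu' q : in_quad u q -> u' * q = q * u'.
    by move=> qq; rewrite (in_quad_comm qq uu').
  have cnu' q : in_quad u q -> (1 - u') * q = q * (1 - u').
    by move=> qq; rewrite mulrBl mulrBr mul1r mulr1 cu'.
  have q1 : in_quad u (k * l + c' *: (k' * l')).
    by apply: in_quadD; [|apply: in_quadZ]; apply: (in_quadM ru).
  have q2 : in_quad u (k * l' + k' * l + k' * l').
    by do 2 (try apply: in_quadD); apply: (in_quadM ru).
  rewrite (mulE u' k k' l l' u'2 (cu' _ ql) (cu' _ ql')) (fE _ _ q1 q2).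
  by rewrite (fE _ _ qk qk') (fE _ _ ql ql') (mulE _ k k' l l' nu'2 (cnu' _ ql) (cnu' _ ql')).
pose h : 'End(subvs_of L) := (linfun (vsproj L) \o linfun f \o linfun vsval)%VF.
have hE (x : subvs_of L) : vsval (h x) = f (vsval x).
  by rewrite /h !comp_lfunE !lfunE /= vsprojK // fL // subvsP.
have hA : ahom_in {:subvs_of L} h.
  apply/ahomP_tmp; split; first by apply: subvs_inj; rewrite hE vsval_one.
  by move=> x y; apply: subvs_inj; rewrite /= !hE /= fM // subvsP.
have gE x : x \in L -> act (AHom hA) x = f x by move=> xL; rewrite /act /= hE vsprojK.
exists (AHom hA); split; first by split; rewrite gE.
move=> x; apply: subvs_inj; rewrite /= !hE.
have /pair_in_quad[k [k' [qk qk' ->]]] := subvsP x.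
rewrite (fE _ _ qk qk').
have -> : k + k' * (1 - u') = (k + k') + (- k') * u' by nc.
by rewrite (fE _ _ (in_quadD qk qk') (in_quadN qk')); nc.
Qed.

Lemma conjugates_fixed g x : conjugates g -> x \in L -> act g x = x -> in_quad u x.
Proof.
move=> cg /pair_in_quad[k [k' [qk qk' ->]]]; rewrite conjugatesE // => /addrI e.
suff -> : k' = 0 by rewrite mul0r addr0.
apply: (etale_root_cancelr ru').
have -> : k' * (2 *: u' - 1) = k' * u' - k' * (1 - u') by nc.
by rewrite e subrr.
Qed.

Lemma conjugates_galois g (K : {aspace A}) : conjugates g -> (forall x : subvs_of L, g (g x) = x) ->
    1 \in K -> etale (subvs_of K) -> K = span [:: 1; u] :> {vspace A} ->
  galois_involution g.
Proof.
move=> cg gg K1 etK eK; split=> //.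
  exists (vsproj L u'); apply/eqP=> /(congr1 vsval); rewrite -/(act g u') cg.2 vsprojK // => e.
  have : (2 *: u' - 1) * 1 = 0.
    have -> : (2 *: u' - 1) * 1 = u' - (1 - u') by nc.
    by rewrite e subrr.
  by move/(etale_root_cancel ru')/eqP; rewrite oner_eq0.
pose M := fixedSpace_aspace g.
have inK x : x \in K <-> in_quad u x.
  rewrite eK span_cons span_seq1; split.
    by case/memv_addP=> _ /vlineP[a ->] [_ /vlineP[b ->] ->]; exists a, b.
  by move=> [a [b ->]]; rewrite memv_add // memvZ ?memv_line.
have KL x : x \in K -> x \in L by move/inK/(in_quad_mem L1 Lu).
have MK (x : subvs_of M) : vsval (vsval x) \in K.
  apply/inK/(conjugates_fixed cg); first exact: subvsP.
  by rewrite /act vsvalK; congr vsval; apply/fixedSpaceP/(subvsP x).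
have KM x : x \in K -> vsproj L x \in M.
  move=> xK; apply/fixedSpaceP/subvs_inj.
  by rewrite -/(act g x) (conjugates_quad cg) ?vsprojK ?KL //; apply/inK.
have M1 : 1 \in M by apply/fixedSpaceP; rewrite rmorph1.
pose psi (x : subvs_of M) : subvs_of K := vsproj K (vsval (vsval x)).
have [r [E [f [sepE f_bij]]]] := etK.
have psiE (x : subvs_of M) : vsval (psi x) = vsval (vsval x) by rewrite vsprojK // MK.
have psi1 : psi 1 = 1 by apply: subvs_inj; rewrite psiE !vsval_one // vsval_one.
have psiM (x y : subvs_of M) : psi (x * y) = psi x * psi y by apply: subvs_inj; rewrite /= !psiE.
pose phi (x : subvs_of K) : subvs_of M := vsproj M (vsproj L (vsval x)).
have phiE (x : subvs_of K) : vsval (vsval (phi x)) = vsval x.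
  by rewrite vsprojK ?KM ?subvsP // vsprojK // KL // subvsP.
have psiK (x : subvs_of M) : phi (psi x) = x by do 2 apply: subvs_inj; rewrite phiE psiE.
have phiK (x : subvs_of K) : psi (phi x) = x by apply: subvs_inj; rewrite psiE phiE.
have psi_lin : linear psi by move=> a x y; rewrite /psi !linearP.
pose psiL : {linear subvs_of M -> subvs_of K} :=
  HB.pack psi (GRing.isLinear.Build _ _ _ _ psi psi_lin).
have psi_bij : bijective (linfun psiL).
  by exists phi => x; rewrite lfunE /= ?psiK ?phiK.
split.
  have -> : \dim {:subvs_of M} = \dim {:subvs_of K}.
    have /bij_inj/lker0P/eqP ker0 := psi_bij.
    rewrite -(limg_dim_eq (f := linfun psiL) (U := fullv)) ?ker0 ?capv0 //; congr (\dim _).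
    apply/vspaceP=> x; rewrite memvf; apply/memv_imgP; exists (phi x); rewrite ?memvf //.
    by rewrite lfunE /= phiK.
  rewrite dimvf -[LHS]/(\dim K) eK; apply/eqP.
  have := pair_free bp; rewrite -[[:: 1; u; _; _]]/([:: 1; u] ++ _).
  by move/catl_free; rewrite /free.
have psiLE (x : subvs_of M) : linfun psiL x = psi x by rewrite lfunE.
have hA i : ahom_in {:subvs_of M} (f i \o linfun psiL)%VF.
  apply/ahomP_tmp; split; first by rewrite comp_lfunE psiLE psi1 rmorph1.
  by move=> x y; rewrite !comp_lfunE !psiLE psiM rmorphM.
exists r, E, (fun i => AHom (hA i)); split=> // y.
have [x [fx x_uniq]] := f_bij y; exists (phi x); split=> [i|z fz].
  by rewrite /= comp_lfunE psiLE phiK fx.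
rewrite -(psiK z); congr phi; apply: x_uniq => i.
by rewrite -fz /= comp_lfunE psiLE.
Qed.

End Pair.
End Automorphisms.

(** * Automorphisms of order two *)

Section Classification.

Variables (F : fieldType) (A : falgType F) (L : {aspace A}).
Hypothesis (L1 : 1 \in L).
Implicit Types (u k : A) (c a b : F).

Lemma Wspace_pair (sigma : 'End(A)) (g : 'AEnd(subvs_of L)) u u' c c' :
  biquadratic_pair L u u' c c' -> conjugates u u' g -> Wspace sigma g = Wvs sigma u u'.
Proof.
move=> bp cg; apply/vspaceP=> x; apply/idP/idP.
  case/WspaceP=> xS xg; apply/WvsP; split=> //.
    have := xg (vsproj L u); rewrite -/(act g u) cg.1 vsprojK //; exact: pair_mem1 bp.
  have := xg (vsproj L u'); rewrite -/(act g u') cg.2 vsprojK ?(pair_mem2 bp) //.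
  by rewrite /flips mulrBr mulr1 => ->; rewrite opprB addrC subrK.
case/WvsP=> xS ux fx; apply/WspaceP; split=> // y.
have [k [k' [qk qk' ey]]] := pair_in_quad bp (subvsP y).
rewrite -(vsvalK y) -/(act g (vsval y)) vsvalK ey (conjugatesE L1 bp cg) //.
rewrite mulrDl mulrDr (in_quad_comm qk ux) mulrA -(in_quad_comm qk' ux).
by congr (_ + _); rewrite -!mulrA mulrBr mulr1 (fx : x * u' = _) opprB addrC subrK.
Qed.

(** An involution [g] of [L] moves [u] to a root of the same polynomial:
    [(g u - u) ^ 2] is, up to a scalar, the idempotent of the part of [L] where
    [g] flips [u]. A nontrivial such idempotent [eta] would generate the fixed
    subalgebra, so that [u] would be scalar on the other part; then [u - rho] and
    its conjugate would generate two orthogonal ideals of dimension 2 in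
    [eta L], which is too much. *)
Lemma involution_root (g : 'AEnd(subvs_of L)) u u' c c' :
    biquadratic_pair L u u' c c' -> (forall x : subvs_of L, g (g x) = x) ->
    \dim (fixedSpace g) = 2%N ->
  act g u = u \/ act g u = 1 - u.
Proof.
move=> bp gg dfix; have ru := pair_root bp; have [u2 d0] := ru.
have Lu := pair_mem1 bp; have Lu' := pair_mem2 bp.
have com x y := pair_commutative bp (x := x) (y := y).
have algL : algid L = 1 by apply/eqP; rewrite algid_eq1.
have aa x : x \in L -> act g (act g x) = x by move=> xL; rewrite /act vsvalK gg vsprojK.
set gu := act g u; have guL : gu \in L by apply: act_mem.
have ggu : act g gu = u by apply: aa.
have gu2 : gu * gu = gu + c%:A by rewrite /gu -actM // u2 actD actZ act1.
have ugu : gu * u = u * gu by apply: com.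
have ugu0 : (gu - u) * (gu + u - 1) = 0.
  by nc_expand; rewrite gu2 u2 ugu; nc.
pose eta := (1 + 4 * c)^-1 *: ((gu - u) * (gu - u)).
have etaL : eta \in L by rewrite memvZ ?memvM ?memvB.
have ww : (gu - u) * (gu - u) = - (2 *: u - 1) * (gu - u).
  apply/eqP; rewrite -subr_eq0; apply/eqP; rewrite -[RHS]ugu0.
  by nc_expand; rewrite gu2 u2 ugu; nc.
have etaw : eta * (gu - u) = gu - u.
  rewrite /eta -scalerAl ww -mulrA ww mulrA mulrNN (etale_root_discr ru).
  by rewrite -scalerAl mul1r scalerA mulVf // scale1r.
have eta2 : eta * eta = eta by rewrite {2}/eta -scalerAr mulrA etaw.
have geta : act g eta = eta.
  by rewrite /eta actZ actM ?memvB // actB ggu -/gu; congr (_ *: _); nc.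
have etau : eta * (gu + u - 1) = 0 by rewrite /eta -scalerAl -mulrA ugu0 mulr0 scaler0.
clearbody eta; have [eta0|eta0] := eqVneq eta 0.
  by left; apply/eqP; rewrite -subr_eq0 -etaw eta0 mul0r.
have [eta1|eta1] := eqVneq eta 1.
  right; apply/eqP; rewrite -subr_eq0 opprB addrA; apply/eqP.
  by rewrite -[LHS]mul1r -{1}eta1.
exfalso.
have e1L : 1 - eta \in L by rewrite memvB.
have e1uL : (1 - eta) * u \in L by rewrite memvM.
have free_fix : basis_of (fixedSpace g) [:: 1; vsproj L eta].
  have fr2 : free [:: vsproj L eta; 1].
    rewrite free_cons span_seq1 seq1_free oner_neq0 andbT.
    apply/vlineP=> -[a ea].
    have ea' : eta = a%:A by rewrite -(vsprojK etaL) ea linearZ /= algL.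
    move: eta2; rewrite ea' -scalerAl mul1r scalerA => /eqP.
    rewrite -subr_eq0 -scalerBl scaler_eq0 oner_eq0 orbF -{3}[a]mulr1 -mulrBr mulf_eq0 subr_eq0.
    case/orP=> /eqP a_; [case/eqP: eta0 | case/eqP: eta1];
      by rewrite ea' a_ ?scale0r ?scale1r.
  rewrite (perm_basis (Y := [:: vsproj L eta; 1])); last by rewrite (perm_catC [:: _] [:: _]).
  rewrite basisEfree fr2 dfix /= andbT; apply/span_subvP=> x.
  rewrite !inE => /orP[] /eqP ->; apply/fixedSpaceP; last by rewrite rmorph1.
  by apply: subvs_inj; rewrite -/(act g eta) geta vsprojK.
have [rho erho] : exists rho, (1 - eta) * u = rho *: (1 - eta).
  have : vsproj L ((1 - eta) * u) \in fixedSpace g.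
    apply/fixedSpaceP/subvs_inj; rewrite -/(act g _) vsprojK //.
    rewrite actM // actB act1 // geta -/gu; apply/eqP.
    by rewrite -subr_eq0 -mulrBr mulrBl mul1r etaw subrr.
  rewrite -(span_basis free_fix) span_cons span_seq1.
  case/memv_addP=> _ /vlineP[a ->] [_ /vlineP[b ->]] /(congr1 vsval).
  rewrite vsprojK // linearD !linearZ /= algL vsprojK // => e.
  exists a; transitivity ((1 - eta) * ((1 - eta) * u)).
    by nc_expand; rewrite eta2; nc.
  by rewrite e; nc_expand; rewrite eta2; nc.
have eta1' : 1 - eta != 0 by rewrite subr_eq0 eq_sym.
have rho2 : rho * rho = rho + c.
  apply/eqP; rewrite -subr_eq0; move: eta1'; apply: contraNT => r0.
  rewrite -(inj_eq (scalerI r0)) scaler0; apply/eqP.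
  transitivity (rho *: ((1 - eta) * u) - (1 - eta) * (u + c%:A)).
    by rewrite mulrDr -scalerAr mulr1 erho; nc.
  by rewrite scalerAl -erho -u2 mulrA subrr.
pose r := 1 - 2 * rho; have r0 : r != 0.
  apply: contraNneq d0 => e; have -> : 1 + 4 * c = r * r; last by rewrite e mul0r.
  transitivity (1 - 4 * rho + 4 * (rho * rho)); first by rewrite rho2; ring.
  by rewrite /r; ring.
pose P := u - rho%:A; pose Q := gu - rho%:A.
have PL : P \in L by rewrite memvB ?memvZ.
have QL : Q \in L by rewrite memvB ?memvZ.
have gP : act g P = Q by rewrite /P actB actZ act1.
have gQ : act g Q = P by rewrite -gP aa.
have PP : P * P = r *: P.
  have -> : P * P = u * u - (2 * rho) *: u + (rho * rho)%:A by rewrite /P; nc.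
  have -> : r *: P = u - (2 * rho) *: u - rho%:A + (2 * (rho * rho))%:A.
    by rewrite /P /r; nc.
  by rewrite u2 rho2; nc.
have etaP : eta * P = P.
  by apply/eqP; rewrite -subr_eq0 -opprB -{1}[P]mul1r -mulrBl mulrBr erho -scalerAr mulr1 subrr oppr0.
have etaQ : eta * Q = Q by rewrite -gP -{1}geta -actM // etaP.
have PQ : P * Q = 0.
  have e1 : eta * gu = eta * (1 - u).
    by apply/eqP; rewrite -subr_eq0 -mulrBr opprB addrA etau.
  have eQ : eta * Q = eta - eta * u - rho *: eta.
    by rewrite /Q mulrBr e1 mulrBr mulr1 -scalerAr mulr1.
  rewrite -etaQ eQ.
  have -> : P * (eta - eta * u - rho *: eta) = P * eta * (1 - u - rho%:A) by nc.
  rewrite (com P) // -mulrA.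
  have -> : P * (1 - u - rho%:A) = 0; last by rewrite mulr0.
  transitivity (u - u * u + (rho * rho)%:A - rho%:A); first by rewrite /P; nc.
  by rewrite u2 rho2; nc.
have P_free a b : a *: P + b *: (P * u') = 0 -> a = 0 /\ b = 0.
  move=> e; have : ((- (a * rho))%:A + a *: u) + ((- (b * rho))%:A + b *: u) * u' = 0.
    by rewrite -[RHS]e /P; nc.
  by case/(pair_indep bp).
set gu' := act g u'; have gu'L : gu' \in L by apply: act_mem.
have free4 : free [:: P; P * u'; Q; Q * gu'].
  apply/(@freeP _ _ _ [tuple P; P * u'; Q; Q * gu']) => k.
  rewrite !big_ord_recl big_ord0 /= addr0 => e.
  have [k0 k1] : k ord0 = 0 /\ k (lift ord0 ord0) = 0.
    apply: P_free; apply/eqP; rewrite -(inj_eq (scalerI r0)) scaler0 -[X in _ == X](mulr0 P) -{}e.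
    rewrite !mulrDr -!scalerAr !mulrA PP PQ !mul0r !scaler0 !addr0 scalerDr -scalerAl.
    by rewrite !scalerA ![r * _]mulrC.
  have [k2 k3] : k (lift ord0 (lift ord0 ord0)) = 0 /\
      k (lift ord0 (lift ord0 (lift ord0 ord0))) = 0.
    apply: P_free; rewrite -gQ -(aa u') // -/gu' -actM // -!actZ -actD.
    by move: e; rewrite k0 k1 !scale0r !add0r => ->; rewrite /act !linear0.
  case=> [[|[|[|[|m]]]] lt_m] //.
  - by rewrite -k0; congr k; apply: val_inj.
  - by rewrite -k1; congr k; apply: val_inj.
  - by rewrite -k2; congr k; apply: val_inj.
  by rewrite -k3; congr k; apply: val_inj.
have sub4 : (span [:: P; P * u'; Q; Q * gu']%R <= amull eta @: L)%VS.
  apply/span_subvP=> x; rewrite !inE => /or4P[] /eqP ->; apply/memv_imgP.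
  - by exists P; rewrite ?lfunE //= etaP.
  - by exists (P * u'); rewrite ?memvM ?lfunE //= mulrA etaP.
  - by exists Q; rewrite ?lfunE //= etaQ.
  by exists (Q * gu'); rewrite ?memvM ?lfunE //= mulrA etaQ.
have eqL : (amull eta @: L == L)%VS.
  rewrite eqEdim; apply/andP; split.
    by apply/subvP=> _ /memv_imgP[x xL ->]; rewrite lfunE /= memvM.
  apply: leq_trans (dimvS sub4); rewrite (eqP free4).
  by rewrite (pair_span bp) (eqP (pair_free bp)).
case/eqP: eta1; have : 1 \in (amull eta @: L)%VS by rewrite (eqP eqL).
by case/memv_imgP=> x _; rewrite lfunE /= => e; rewrite -[eta]mulr1 e mulrA eta2.
Qed.

End Classification.

(** * Changing the pair of generators *)

Section PairChange.

Variables (F : fieldType) (A : falgType F) (L : {aspace A}).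
Implicit Types (u k x v : A) (c a b : F).

(** The new root [u + u' - 2 u u'] generates the third quadratic subalgebra of
    [F[u, u']]: it is fixed by the automorphism flipping both [u] and [u']. *)
Lemma product_pair u u' c c' : biquadratic_pair L u u' c c' ->
  biquadratic_pair L (u + u' - 2 *: (u * u')) u (c + c' + 4 * c * c') c.
Proof.
move=> bp; have [[u2 d0] [u'2 d0'] uu' _ spL] := bp.
have u2A x := etale_rootA x (conj u2 d0); have u'2A x := etale_rootA x (conj u'2 d0').
set u3 := u + u' - 2 *: (u * u').
have u3u : u3 * u = c%:A + u - 2 *: (c *: u') - u * u'.
  by rewrite /u3; nc_expand; rewrite ?(esym uu', commA _ uu', u2); nc_expand; rewrite ?u2; nc.
have fr : free [:: 1; u3; u; u3 * u].
  apply/(@freeP _ _ _ [tuple 1; u3; u; u3 * u]) => k.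
  rewrite !big_ord_recl big_ord0 /= addr0 u3u.
  move: (erefl (k ord0)) (erefl (k (lift ord0 ord0))).
  move: {1 3}(k ord0) {1 3}(k (lift ord0 ord0)) => k0 k1 e0 e1.
  move: (erefl (k (lift ord0 (lift ord0 ord0))))
    (erefl (k (lift ord0 (lift ord0 (lift ord0 ord0))))).
  move: {1 3}(k (lift ord0 (lift ord0 ord0)))
    {1 3}(k (lift ord0 (lift ord0 (lift ord0 ord0)))) => k2 k3 e2 e3 e.
  have : ((k0 + k3 * c)%:A + (k1 + k2 + k3) *: u) +
      ((k1 - 2 * c * k3)%:A + (- 2 * k1 - k3) *: u) * u' = 0.
    by rewrite -[RHS]e /u3; nc.
  case/(pair_indep bp) => h0 h1 h2 h3.
  have k10 : k1 = 0.
    have : (1 + 4 * c) * k1 = 0.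
      transitivity ((k1 - 2 * c * k3) - 2 * c * (- 2 * k1 - k3)); first by ring.
      by rewrite h2 h3 mulr0 subr0.
    by move/eqP; rewrite mulf_eq0 (negPf d0) => /eqP.
  have k30 : k3 = 0 by apply/eqP; rewrite -oppr_eq0; move/eqP: h3; rewrite k10 mulr0 add0r.
  have k20 : k2 = 0 by move: h1; rewrite k10 k30 add0r addr0.
  have k00 : k0 = 0 by move: h0; rewrite k30 mul0r addr0.
  case=> [[|[|[|[|m]]]] lt_m] //.
  - by rewrite -k00 e0; congr k; apply: val_inj.
  - by rewrite -k10 e1; congr k; apply: val_inj.
  - by rewrite -k20 e2; congr k; apply: val_inj.
  by rewrite -k30 e3; congr k; apply: val_inj.
split=> //.
- split; last first.
    have -> : 1 + 4 * (c + c' + 4 * c * c') = (1 + 4 * c) * (1 + 4 * c') by ring.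
    by rewrite mulf_neq0.
  rewrite /u3; do 2 (nc_expand; rewrite ?(esym uu', commA _ uu', u2, u2A, u'2, u'2A)).
  by nc.
- by rewrite u3u /u3; nc_expand; rewrite u2; nc.
apply/eqP; rewrite eq_sym eqEdim; apply/andP; split; last first.
  by rewrite (eqP fr) spL (eqP (pair_free bp)).
have m1 : 1 \in L by rewrite spL memv_span ?inE ?eqxx.
have mu := pair_mem1 bp; have mu' := pair_mem2 bp.
have m3 : u3 \in L by rewrite memvB ?memvD ?memvZ ?memvM.
by apply/span_subvP=> x; rewrite !inE => /or4P[] /eqP -> //; rewrite memvM.
Qed.

(** If [x] and [v] decompose along [u] and [u'], the product [x v] flips both
    [u] and [u'], hence commutes with the third root. That it is a symmetrized
    element uses that [x] is one by an element commuting with [v]. *)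
Lemma decomposing_product (sigma : 'End(A)) u u' c c' :
    symmetric_frame sigma L -> biquadratic_pair L u u' c c' ->
  decomposing_pair sigma u u' -> decomposing_pair sigma (u + u' - 2 *: (u * u')) u.
Proof.
move=> fr bp [x [v [a [b [xW vW xv [xx a0] [vv b0]]]]]].
have ru := pair_root bp; have uu' := pair_comm bp.
have sM := frame_anti fr; have su := frame_fix fr (pair_mem1 bp).
have [xS ux fx] := WvsP _ _ _ _ xW; have [vS u'v fv] := WvsP _ _ _ _ vW.
have sx := Symd_fix fr xS; have sv := Symd_fix fr vS.
have xvS : x * v \in Symd sigma.
  have [w [uw _ ex]] := W_symmetrized fr bp xW.
  pose z := u * w + b^-1 *: ((1 - u) * (v * w * v)).
  have vz : v * z = z * v.
    have vvA y : y * v * v = b *: y by rewrite -mulrA vv -scalerAr mulr1.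
    have e1 : b^-1 *: (b *: (w * v)) = w * v by rewrite scalerA mulVf // scale1r.
    have e2 : b^-1 *: (b *: (v * w)) = v * w by rewrite scalerA mulVf // scale1r.
    have h1 : v * (b^-1 *: ((1 - u) * (v * w * v))) = u * (w * v).
      have vnu : v * (1 - u) = u * v.
        by rewrite mulrBr mulr1 (fv : v * u = _) opprB addrC subrK.
      have vvwv : v * (v * w * v) = b *: (w * v) by rewrite !mulrA vv -!scalerAl mul1r.
      by rewrite -scalerAr (mulrA v) vnu -mulrA vvwv scalerAr e1.
    have h2 : b^-1 *: ((1 - u) * (v * w * v)) * v = (1 - u) * (v * w).
      by rewrite -scalerAl -(mulrA (1 - u)) vvA scalerAr e2.
    by rewrite /z mulrDr h1 (mulrDl (u * w)) h2 (mulrA v u) (fv : v * u = _); nc.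
  have ez : x = z + sigma z.
    have vxv : b^-1 *: (v * x * v) = x by rewrite -xv -mulrA vv -scalerAr mulr1 scalerA mulVf ?scale1r.
    have usw := sigma_comm fr su uw.
    have uY : u * (v * sigma w * v) = v * sigma w * v * u.
      exact: (flips_flips (flips_comm fv usw) fv).
    have e3 : sigma z = u * sigma w + b^-1 *: ((1 - u) * (v * sigma w * v)).
      have s1 : sigma 1 = 1 := frame_fix fr (frame_one fr).
      rewrite /z linearD linearZ /= !sM linearB /= su sv s1 usw (mulrBl (_ * _)) uY.
      by rewrite mul1r mulrBr mulr1 !mulrA.
    rewrite e3 /z.
    have -> : u * w + b^-1 *: ((1 - u) * (v * w * v)) +
        (u * sigma w + b^-1 *: ((1 - u) * (v * sigma w * v))) =
      u * (w + sigma w) + b^-1 *: ((1 - u) * (v * (w + sigma w) * v)) by nc.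
    by rewrite -ex scalerAr vxv; nc.
  apply/SymdP; exists (z * v); have sz := sigma_comm fr sv vz.
  by rewrite sM sv sz -mulrDl -ez.
exists (x * v), x, (a * b), a; split=> //.
- apply/WvsP; split=> //; last exact: comm_flips.
  have e1 : u * (x * v) = x * v - x * v * u.
    by rewrite -[x * v * u]mulrA (fv : v * u = _) mulrBr !mulrA ux opprB addrC subrK.
  have e2 : (x * v) * u' = x * v - u' * (x * v).
    by rewrite -mulrA -u'v mulrA (fx : x * u' = _) mulrBl !mulrA.
  have e2' : u' * (x * v) = x * v - x * v * u' by rewrite e2 opprB addrC subrK.
  rewrite mulrBl mulrBr mulrDl mulrDr -scalerAl -scalerAr.
  have -> : u * u' * (x * v) = x * v - x * v * u - (x * v * u' - x * v * u * u').
    by rewrite -mulrA e2' mulrBr !mulrA -(mulrA u) e1; nc.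
  by rewrite e1 e2' !mulrA; nc.
- apply/WvsP; split=> //.
  have e1 : x * (u * u') = u * x - u * u' * x.
    by rewrite mulrA -ux -mulrA (fx : x * u' = _) mulrBr mulrA.
  rewrite /flips mulrBr mulrDr mulrBl mulrDl -scalerAl -scalerAr e1 -ux (fx : x * u' = _).
  by nc.
- by rewrite -mulrA -xv.
- split; last by rewrite mulf_neq0.
  by rewrite -mulrA (mulrA v) -xv -mulrA vv -!scalerAr mulr1 xx scalerA mulrC.
Qed.

(** By [involution_root], [g] fixes or flips each of [u] and [u']; if it flips
    both, it fixes the third quadratic subalgebra. *)
Lemma galois_pair (g : 'AEnd(subvs_of L)) u u' c c' :
    1 \in L -> biquadratic_pair L u u' c c' -> galois_involution g ->
  exists v v' d d', [/\ biquadratic_pair L v v' d d', conjugates v v' g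
    & forall sigma, symmetric_frame sigma L ->
        decomposing_pair sigma u u' -> decomposing_pair sigma v v'].
Proof.
move=> L1 bp [[x gx] gg [dM _]].
have dfix : \dim (fixedSpace g) = 2%N by move: dM; rewrite dimvf.
have Lu := pair_mem1 bp; have Lu' := pair_mem2 bp.
have [gu|gu] := involution_root L1 bp gg dfix; last first.
  have [gu'|gu'] := involution_root L1 (pairC bp) gg dfix.
    by exists u', u, c', c; split=> // [|sigma _]; [apply: pairC | apply: decomposing_pairC].
  exists (u + u' - 2 *: (u * u')), u, (c + c' + 4 * c * c'), c; split.
  - exact: product_pair.
  - split=> //; rewrite actB actD actZ actM // gu gu'; nc.
  by move=> sigma fr; apply: decomposing_product fr bp.
have [gu'|gu'] := involution_root L1 (pairC bp) gg dfix; last by exists u, u', c, c'.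
case/eqP: gx; apply: subvs_inj; rewrite -{1}(vsvalK x) -/(act g (vsval x)).
have [a [b [a' [b' ->]]]] := pair_coord bp (subvsP x).
rewrite actD actM ?memvD ?memvZ // !actD !actZ act1 // gu gu'.
by [].
Qed.

End PairChange.

(** * Neat quadratic subalgebras belong to a pair *)

Section NeatSubalgebras.

Variables (F : fieldType) (A : falgType F).
Implicit Types (L K B : {aspace A}) (u w e f x : A) (c a b : F).

Lemma scalar_idempotent a : a%:A * a%:A = a%:A :> A -> a%:A = 0 :> A \/ a%:A = 1 :> A.
Proof.
rewrite -scalerAl mul1r scalerA => /eqP; rewrite -subr_eq0 -scalerBl scaler_eq0.
rewrite oner_eq0 orbF -{3}(mulr1 a) -mulrBr mulf_eq0 subr_eq0.
by case/orP=> /eqP ->; rewrite ?scale0r ?scale1r; [left | right].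
Qed.

Lemma biquadratic_generators L : 1 \in L -> etale (subvs_of L) -> biquadratic L ->
  exists u u' c c', biquadratic_pair L u u' c c'.
Proof.
move=> L1 etL [dL [M [M' [/andP[M1 M'1] dM dM' cM eL]]]].
have ML : (M <= L)%VS by rewrite -eL; apply/subvP=> x xM; rewrite -(mulr1 x) memv_mul.
have M'L : (M' <= L)%VS by rewrite -eL; apply/subvP=> x xM; rewrite -(mul1r x) memv_mul.
have [u [c [ru uM eM]]] := etale_generator L1 etL ML M1 dM.
have [u' [c' [ru' u'M eM']]] := etale_generator L1 etL M'L M'1 dM'.
have sp : (L <= span [:: 1; u; u'; u * u']%R)%VS.
  rewrite -eL eM eM'; apply/prodvP=> x y.
  rewrite !span_cons !span_nil !addv0 => /memv_addP[_ /vlineP[a ->] [_ /vlineP[b ->] ->]].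
  case/memv_addP=> _ /vlineP[a' ->] [_ /vlineP[b' ->] ->].
  have -> : (a%:A + b *: u) * (a'%:A + b' *: u') =
    (a * a') *: 1 + ((b * a') *: u + ((a * b') *: u' + (b * b') *: (u * u'))) by nc.
  by rewrite !memv_add // memvZ // memv_line.
have fr : free [:: 1; u; u'; u * u'].
  rewrite /free eqn_leq dim_span /=; apply: leq_trans (dimvS sp).
  by rewrite -[4%N]/(4 : nat) dL.
exists u, u', c, c'; split=> //.
  have /centvsP cMM' := cM; exact: cMM'.
by apply/eqP; rewrite eqEdim sp (eqP fr) dL.
Qed.

(** The components [f b_i] of a basis [b_i] of [A] over [B] are independent over
    [F], and span [f A] when [f B] is [F f]. *)
Lemma free_module_bounds B f : free_left_module B -> f \in B -> f != 0 ->
  exists m, [/\ \dim {:A} = (m * \dim B)%N, (m <= \dim (amull f @: {:A}))%N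
    & (forall l, l \in B -> f * l \in <[f]>%VS) -> (\dim (amull f @: {:A}) <= m)%N].
Proof.
move=> [m [b bB]] fB f0; exists m.
pose h (l : {ffun 'I_m -> subvs_of B}) : A := \sum_i vsval (l i) * b i.
have h_lin : linear h.
  move=> a l l'; rewrite /h scaler_sumr -big_split; apply: eq_bigr => i _.
  by rewrite !ffunE linearP mulrDl scalerAl.
pose hL : {linear {ffun 'I_m -> subvs_of B} -> A} :=
  HB.pack h (GRing.isLinear.Build _ _ _ _ h h_lin).
have h_inj l l' : h l = h l' -> l = l'.
  by move=> e; have [l0 [_ lu]] := bB (h l); rewrite -(lu _ erefl) -(lu l').
split.
- have inj : injective (linfun hL) by move=> l l'; rewrite !lfunE; apply: h_inj.
  move/lker0P/eqP in inj.
  have -> : {:A}%VS = limg (linfun hL).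
    apply/eqP; rewrite eqEsubv subvf andbT; apply/subvP=> x _.
    have [l [el _]] := bB x; apply/memv_imgP; exists l; rewrite ?memvf //.
    by rewrite lfunE.
  rewrite limg_dim_eq ?inj ?capv0 // dimvf.
  by rewrite -[LHS]/(#|'I_m| * \dim B)%N card_ord.
- have fr : free [tuple f * b i | i < m].
    apply/freeP=> k e i; apply/eqP; apply: contraNT f0 => ki.
    have e0 : h [ffun i => k i *: vsproj B f] = h 0.
      rewrite /h; under eq_bigr do rewrite ffunE linearZ /= vsprojK // -scalerAl.
      under [RHS]eq_bigr do rewrite ffunE linear0 mul0r.
      rewrite [RHS]big1 // -[RHS]e; apply: eq_bigr => j _.
      by rewrite -tnth_nth tnth_mktuple.
    have /ffunP/(_ i) := h_inj _ _ e0; rewrite !ffunE => /(congr1 vsval).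
    rewrite linearZ linear0 /= vsprojK // => /eqP.
    by rewrite scaler_eq0 (negPf ki).
  have := eqP fr; rewrite size_tuple => <-; apply: dimvS.
  apply/span_subvP=> _ /mapP[i _ ->]; apply/memv_imgP.
  by exists (b i); rewrite ?memvf ?lfunE.
move=> fl; have <- : size [seq f * b i | i : 'I_m] = m by rewrite size_map size_enum_ord.
apply: leq_trans (dim_span _); apply: dimvS; apply/subvP=> _ /memv_imgP[x _ ->].
have [l [-> _]] := bB x; rewrite lfunE /= mulr_sumr memv_suml // => i _.
have /vlineP[a ea] := fl _ (subvsP (l i)).
by rewrite mulrA ea -scalerAl memvZ // memv_span //; apply/imageP; exists i.
Qed.

(** With generators [u1], [u2] of [L] and [u3] of its third quadratic
    subalgebra: a [w] among them that is not independent of [u] over [F] (as in [cand])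
    either generates [K], and then [K] is already one of the factors, or is
    a scalar on the part of [L] given by a nontrivial idempotent [f] of [K].  As
    [K] has at most two such idempotents, the latter for all three [w] would
    make two of them scalar on the same part, so that [f L = F f]; but freeness
    over [L] and [K] makes the dimension of [f A] both at most a quarter and at
    least a half of that of [A] ([not_bad]). *)
Lemma neat_pair L K : 1 \in L -> etale (subvs_of L) -> biquadratic L ->
    free_left_module L -> (K <= L)%VS -> 1 \in K -> \dim K = 2%N ->
    free_left_module K ->
  exists u u' c c', biquadratic_pair L u u' c c' /\ K = span [:: 1; u] :> {vspace A}.
Proof.
move=> L1 etL bL frL KL K1 K2 frK.
have [u [c [ru uK eK]]] := etale_generator L1 etL KL K1 K2.
have [u1 [u2 [c1 [c2 bp12]]]] := biquadratic_generators L1 etL bL.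
have bp31 := product_pair bp12; have bp32 := product_pair (pairC bp12).
have com x y := pair_commutative bp12 (x := x) (y := y).
have inK x : x \in K <-> in_quad u x by rewrite eK; apply: span_quadP.
have uF : u \notin 1%VS by rewrite -dim_span_quad -eK K2.
have uL : u \in L by apply: (subvP KL).
pose bad f w := f * w \in <[f]>%VS.
have not_bad f w w' d d' : biquadratic_pair L w w' d d' -> f \in K -> f * f = f -> f != 0 ->
    bad f w -> bad f w' -> False.
  move=> bp fK ff f0 /vlineP[a ea] /vlineP[a' ea'].
  have fl l : l \in L -> f * l \in <[f]>%VS.
    case/(pair_coord bp)=> [p [q [p' [q' ->]]]]; apply/vlineP.
    exists (p + q * a + (p' + q' * a) * a').
    have -> : f * ((p%:A + q *: w) + (p'%:A + q' *: w) * w') =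
       p *: f + q *: (f * w) + p' *: (f * w') + q' *: (f * w * w') by nc.
    by rewrite ea ea' -scalerAl ea'; nc.
  have [m [dK mK _]] := free_module_bounds frK fK f0.
  have [m' [dL' _ /(_ fl) mL]] := free_module_bounds frL (subvP KL _ fK) f0.
  have dL : \dim L = 4 by rewrite (pair_span bp); exact: (eqP (pair_free bp)).
  have A0 : (0 < \dim {:A})%N by rewrite dimvf FalgType_proper.
  rewrite K2 in dK; rewrite dL in dL'; move: dK dL' mK mL A0.
  by move: (\dim _) (\dim {:A}) => d1 d2; lia.
have cand w w' d d' : biquadratic_pair L w w' d d' ->
    (exists u u' c c', biquadratic_pair L u u' c c' /\ K = span [:: 1; u] :> {vspace A}) \/
    exists f, [/\ f \in K, f * f = f, f != 0, f != 1 & bad f w].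
  move=> bp; have wL := pair_mem1 bp; have rw := pair_root bp.
  have [fr|nfr] := boolP (free [:: 1; u; w; u * w]).
    left; exists u, w, c, d; split; last first.
      by rewrite -[RHS]eK.
    split=> //; first exact: com.
    have sub : (span [:: 1; u; w; u * w]%R <= L)%VS.
      by apply/span_subvP=> x; rewrite !inE => /or4P[] /eqP -> //; rewrite memvM.
    apply/esym/eqP; rewrite eqEdim sub (eqP fr) (pair_span bp).
    by rewrite (eqP (pair_free bp)).
  have [q [q' [qq qq' e0 q'0]]] : exists q q', [/\ in_quad u q, in_quad u q',
      q + q' * w = 0 & q' != 0].
    have uE (a : F) : u - a%:A != 0.
      by rewrite subr_eq0; apply: contraNneq uF => ->; rewrite memvZ ?memv_line.
    have pe : perm_eq [:: 1; u; w; u * w] [:: u * w; w; u; 1].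
      by rewrite -perm_rev /rev /= perm_refl.
    move: nfr; rewrite (perm_free pe) !free_cons !negb_and !negbK span_seq1 (negPf (uF : u \notin <[1]>%VS)) /=.
    rewrite nil_free span_nil memv0 oner_eq0 /= orbF; case/orP.
      rewrite !span_cons span_nil addv0 => /memv_addP[_ /vlineP[a ->] [x]].
      case/memv_addP=> _ /vlineP[b ->] [_ /vlineP[d0 ->] ->] e.
      exists (- d0%:A - b *: u), (u - a%:A); split; rewrite ?uE //.
      - by exists (- d0), (- b); rewrite !scaleNr.
      - by exists (- a), 1; rewrite scale1r scaleNr addrC.
      by rewrite mulrBl e -scalerAl mul1r; nc.
    rewrite span_cons span_seq1 => /memv_addP[_ /vlineP[b ->] [_ /vlineP[d0 ->] e]].
    exists (- d0%:A - b *: u), 1; split; rewrite ?oner_neq0 //.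
    - by exists (- d0), (- b); rewrite !scaleNr.
    - exact: in_quad1.
    by rewrite mul1r e; nc.
  have [f [k' [[s [t ef]] qk' ff fk fl]]] := quad_idempotent ru qq' q'0.
  have f0 : f != 0.
    apply: contraNneq uF => f0; have [|a] := fl u.
      by exists 0, 1; rewrite scale0r add0r scale1r.
    by rewrite f0 subr0 mulr1 => ->; rewrite memvZ ?memv_line.
  have fw : f * w = - (k' * q).
    have -> : k' * q = k' * (q + q' * w) - k' * q' * w by nc.
    rewrite e0 mulr0 sub0r opprK; congr (_ * _); rewrite -fk.
    exact: in_quad_commC qq' qk'.
  have k'q : in_quad u (k' * q) by exact: in_quadM ru qk' qq.
  have [f1|f1] := eqVneq f 1.
    left; have wK : w \in K.
      by apply/inK; rewrite -(mul1r w) -f1 fw; apply: in_quadN.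
    exists w, w', d, d'; split=> //; apply/esym/eqP; rewrite eqEdim K2.
    have := catl_free (pair_free bp : free ([:: 1; w] ++ [:: w'; w * w'])).
    move=> /eqP /= -> /=; rewrite andbT; apply/span_subvP=> x.
    by rewrite !inE => /orP[] /eqP ->.
  right; exists f; split=> //; first by apply/inK; exists s, t.
  have t0 : t != 0.
    apply/eqP=> t0; rewrite t0 scale0r addr0 in ef; move: ff f0 f1; rewrite ef.
    by case/scalar_idempotent=> ->; rewrite eqxx.
  have uf : u * f = (t^-1 * (1 - s)) *: f.
    have e1 : t *: (u * f) = (1 - s) *: f.
      rewrite scalerAl -[t *: u](addKr (s%:A)) -ef mulrDl ff mulNr -scalerAl mul1r.
      by rewrite addrC scalerBl scale1r.
    by rewrite -scalerA -e1 scalerA mulVf ?scale1r.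
  rewrite /bad; have -> : f * w = f * (f * w) by rewrite mulrA ff.
  rewrite fw; case: k'q => [p [p' ->]]; apply/vlineP.
  exists (- (p + p' * (t^-1 * (1 - s)))); rewrite mulrN mulrDr -!scalerAr mulr1.
  have -> : f * u = u * f by rewrite ef; nc.
  by rewrite uf scalerA scaleNr scalerDl.
have [//|[f1 [f1K ff1 f10 f11 b1]]] := cand _ _ _ _ bp12.
have [//|[f2 [f2K ff2 f20 f21 b2]]] := cand _ _ _ _ (pairC bp12).
have [//|[f3 [f3K ff3 f30 f31 b3]]] := cand _ _ _ _ bp31.
have dich f f' : f \in K -> f * f = f -> f != 0 -> f != 1 ->
    f' \in K -> f' * f' = f' -> f' != 0 -> f' != 1 -> f' = f \/ f' = 1 - f.
  move=> fK ff f0 fn1 f'K f'f' f'0 f'n1.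
  have fF : f \notin 1%VS.
    apply/vlineP=> -[s ef]; move: ff f0 fn1; rewrite ef.
    by case/scalar_idempotent=> ->; rewrite eqxx.
  have ind (a b : F) := @quad_indep _ _ f a b fF.
  have spf : K = span [:: 1; f] :> {vspace A}.
    apply/esym/eqP; rewrite eqEdim K2.
    have /eqP -> : \dim (span [:: 1; f]%R) == 2%N by rewrite dim_span_quad.
    by rewrite andbT; apply/span_subvP=> x; rewrite !inE => /orP[] /eqP ->.
  move: f'K f'f' f'0 f'n1; rewrite spf span_cons span_seq1.
  case/memv_addP=> _ /vlineP[a ->] [_ /vlineP[b ->] ->] e0 f'0 f'n1.
  have [] := ind (a * a - a) (a * b + a * b + b * b - b).
    rewrite -[RHS](subrr (a%:A + b *: f)) -{1}e0.
    have -> : (a%:A + b *: f) * (a%:A + b *: f) =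
       (a * a)%:A + (a * b + a * b) *: f + (b * b) *: (f * f) by nc.
    by rewrite ff; nc.
  move=> /eqP; rewrite -{3}(mulr1 a) -mulrBr mulf_eq0 subr_eq0 => /orP[] /eqP ea.
    rewrite ea !mul0r !add0r => /eqP; rewrite -{3}(mulr1 b) -mulrBr mulf_eq0 subr_eq0.
    case/orP=> /eqP eb; first by move: f'0; rewrite ea eb !scale0r addr0 eqxx.
    by left; rewrite eb scale0r add0r scale1r.
  rewrite ea !mul1r (_ : b + b + b * b - b = b * (b + 1)); last by ring.
  move=> /eqP; rewrite mulf_eq0 addr_eq0; case/orP=> /eqP eb.
    by move: f'n1; rewrite ea eb scale0r addr0 scale1r eqxx.
  by right; rewrite eb scale1r scaleN1r.
exfalso; have n12 := not_bad f1 _ _ _ _ bp12; have n31 := not_bad f1 _ _ _ _ bp31.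
have [e2|e2] := dich f1 f2 f1K ff1 f10 f11 f2K ff2 f20 f21.
  by apply: n12 => //; rewrite -e2.
have [e3|e3] := dich f1 f3 f1K ff1 f10 f11 f3K ff3 f30 f31.
  by apply: n31 => //; rewrite -e3.
rewrite -e3 in e2; apply: (not_bad f3 _ _ _ _ bp32) => //.
  by rewrite (addrC u2) -(pair_comm bp12).
by move: b2; rewrite /bad e2.
Qed.

End NeatSubalgebras.

(** * Explicit quaternion algebras *)

Section Quaternions.

Variables (F : fieldType) (A : falgType F) (u v : A) (c b : F).
Hypotheses (ru : etale_root u c) (fv : flips u v) (vv : v * v = b%:A) (b0 : b != 0).

Lemma flips_comm0 y : flips u y -> u * y = y * u -> y = 0.
Proof.
rewrite /flips => fy cy; apply: (etale_root_cancel ru).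
have {}fy : u * y = y - u * y by rewrite {1}cy.
have -> : (2 *: u - 1) * y = u * y - (y - u * y) by nc.
by rewrite -fy subrr.
Qed.

(** The part [q v] of [p + q v] flips [u]; if it also commutes with [u] it
    vanishes. *)
Lemma quaternion_comm p q : u * p = p * u -> u * q = q * u ->
  u * (p + q * v) = (p + q * v) * u -> q = 0.
Proof.
move=> up uq; rewrite mulrDr mulrDl up => /addrI cqv.
have qv0 := flips_comm0 (comm_flips uq fv) cqv.
apply: (scalerI b0); rewrite scaler0.
by rewrite -[q]mulr1 scalerAr -vv mulrA qv0 mul0r.
Qed.

Lemma quaternion_indep p q : u * p = p * u -> u * q = q * u ->
  p + q * v = 0 -> p = 0 /\ q = 0.
Proof.
move=> up uq e; have q0 : q = 0.
  by apply: (quaternion_comm up uq); rewrite e mulr0 mul0r.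
by move: e; rewrite q0 mul0r addr0.
Qed.

Lemma flips_quad k : in_quad u k -> exists2 k', in_quad u k' & v * k = k' * v.
Proof.
move=> [x [y ->]]; exists ((x + y)%:A - y *: u); first by exists (x + y), (- y); nc.
by nc_expand; rewrite fv; nc.
Qed.

Lemma in_quadV1 x y : x%:A + y *: u = 0 -> x = 0 /\ y = 0.
Proof.
move=> e; have [_ d0] := ru; have y0 : y = 0.
  have : v * (x%:A + y *: u) - (x%:A + y *: u) * v = 0 by rewrite e mulr0 mul0r subrr.
  have -> : v * (x%:A + y *: u) - (x%:A + y *: u) * v = - ((2 *: u - 1) * (y *: v)).
    by nc_expand; rewrite fv; nc.
  move=> /eqP; rewrite oppr_eq0 => /eqP/(etale_root_cancel ru)/eqP.
  rewrite scaler_eq0 => /orP[/eqP //|/eqP v0].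
  by move: vv b0; rewrite v0 mul0r => /esym/eqP; rewrite scaler_eq0 oner_eq0 orbF => ->.
by move: e; rewrite y0 scale0r addr0 => /eqP; rewrite scaler_eq0 oner_eq0 orbF => /eqP.
Qed.

Let X := [:: 1; u; v; u * v].

Lemma quaternionP x :
  x \in <<X>>%VS <-> exists p q, [/\ in_quad u p, in_quad u q & x = p + q * v].
Proof.
rewrite !span_cons span_nil addv0; split.
  case/memv_addP=> _ /vlineP[x0 ->] [_ /memv_addP[_ /vlineP[x1 ->]] [y + ->] ->].
  case/memv_addP=> _ /vlineP[x2 ->] [_ /vlineP[x3 ->] ->].
  exists (x0%:A + x1 *: u), (x2%:A + x3 *: u); split; [by exists x0, x1|by exists x2, x3|].
  by nc.
move=> [_ [_ [[x0 [x1 ->]] [x2 [x3 ->]] ->]]].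
have -> : x0%:A + x1 *: u + (x2%:A + x3 *: u) * v =
  x0%:A + (x1 *: u + (x2 *: v + x3 *: (u * v))) by nc.
by rewrite !memv_add // memvZ // memv_line.
Qed.

Lemma quaternion_free : free X.
Proof.
apply/freeP=> k; rewrite !big_ord_recl big_ord0 addr0 /= => e.
have [] := @quaternion_indep ((k ord0)%:A + k (lift ord0 ord0) *: u)
    ((k (lift ord0 (lift ord0 ord0)))%:A + k (lift ord0 (lift ord0 (lift ord0 ord0))) *: u).
- by nc.
- by nc.
- by rewrite -[RHS]e; nc.
move=> /in_quadV1[k0 k1] /in_quadV1[k2 k3] i.
have := ltn_ord i; case: i => [[|[|[|[|i]]]] lti] // _.
- by rewrite -[RHS]k0; congr k; apply: val_inj.
- by rewrite -[RHS]k1; congr k; apply: val_inj.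
- by rewrite -[RHS]k2; congr k; apply: val_inj.
by rewrite -[RHS]k3; congr k; apply: val_inj.
Qed.

Lemma quaternion_is_aspace : is_aspace <<X>>.
Proof.
apply/andP; split.
  apply/has_algidP; exists 1; split; rewrite ?oner_neq0 ?memv_span ?inE ?eqxx //.
  by move=> x _; rewrite mul1r mulr1.
apply/prodvP=> _ _ /quaternionP[p [q [qp qq ->]]] /quaternionP[p' [q' [qp' qq' ->]]].
have [k ik vk] := flips_quad qp'; have [k' ik' vk'] := flips_quad qq'.
have inM := in_quadM ru; apply/quaternionP.
exists (p * p' + b *: (q * k')), (p * q' + q * k); split.
- by apply: in_quadD; [apply: inM | apply: in_quadZ; apply: inM].
- by apply: in_quadD; apply: inM.
rewrite !mulrDl !mulrDr -!mulrA [v * p']vk [v * (q' * v)]mulrA vk' -(mulrA k') vv; nc.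
Qed.

Definition quaternion : {aspace A} := ASpace quaternion_is_aspace.

Lemma dim_quaternion : \dim quaternion = 4%N.
Proof. exact: (eqP quaternion_free). Qed.

(** A nonzero ideal contains the two parts [p] and [q v] of each of its elements,
    hence a nonzero element [k] of [F[u]], hence its conjugate, norm and trace;
    and the norm and the trace of [k] vanish together only if [k = 0], since
    [2 u - 1] has a nonzero scalar square. *)
Lemma quaternion_central_simple : {:A}%VS = <<X>>%VS -> central_simple A.
Proof.
move=> eA; have allQ x : exists p q, [/\ in_quad u p, in_quad u q & x = p + q * v].
  by apply/quaternionP; rewrite -eA memvf.
have cu k : in_quad u k -> u * k = k * u.
  by move=> qk; apply/esym/(in_quad_comm qk).
split.
  apply/eqP; rewrite eqEsubv; apply/andP; split; last first.
    apply/subvP=> _ /mem1vP[a ->]; apply/centerP=> y; nc.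
  apply/subvP=> z /centerP cz; have [p [q [qp qq ez]]] := allQ z.
  have q0 := quaternion_comm (cu _ qp) (cu _ qq).
  rewrite -ez cz in q0; have {q0}q0 := q0 erefl.
  rewrite q0 mul0r addr0 in ez; case: qp => [x [y ep]]; rewrite ez ep.
  have : (2 *: u - 1) * (y *: v) = 0.
    have := cz v; rewrite ez ep => /eqP; rewrite -subr_eq0 => /eqP <-.
    by nc_expand; rewrite fv; nc.
  move=> /(etale_root_cancel ru)/eqP; rewrite scaler_eq0 => /orP[/eqP ->|/eqP v0].
    by rewrite scale0r addr0; apply/mem1vP; exists x.
  by move: vv b0; rewrite v0 mul0r => /esym/eqP; rewrite scaler_eq0 oner_eq0 orbF => ->.
move=> I /two_sided_idealP iI; have [->|I0] := eqVneq I 0%VS; [by left | right].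
have unitI a : a%:A \in I -> a != 0 -> I = fullv.
  move=> aI a0; apply/eqP; rewrite eqEsubv subvf; apply/subvP=> x _.
  have [h _] := iI _ (a^-1 *: x) aI; move: h.
  by rewrite -scalerAl -scalerAr mulr1 scalerA mulVf // scale1r.
have quadI k : in_quad u k -> k \in I -> k != 0 -> I = fullv.
  move=> [x [y ek]] kI k0.
  have kbI : (x + y)%:A - y *: u \in I.
    have [h1 _] := iI _ v kI; have [_ h2] := iI _ (b^-1 *: v) h1.
    suff <- : v * k * (b^-1 *: v) = (x + y)%:A - y *: u by [].
    have -> : v * k = ((x + y)%:A - y *: u) * v by rewrite ek; nc_expand; rewrite fv; nc.
    by rewrite -scalerAr -mulrA vv -scalerAr scalerA mulVf // scale1r mulr1.
  have [n0|n0] := eqVneq (x * x + x * y - c * (y * y)) 0; last first.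
    apply: unitI n0; have [_ h] := iI _ ((x + y)%:A - y *: u) kI.
    suff <- : k * ((x + y)%:A - y *: u) = (x * x + x * y - c * (y * y))%:A by [].
    by have [u2 _] := ru; rewrite ek; nc_expand; rewrite u2; nc.
  have [t0|t0] := eqVneq (2 * x + y) 0; last first.
    apply: (unitI _ _ t0).
    suff <- : k + ((x + y)%:A - y *: u) = (2 * x + y)%:A by apply: memvD.
    by rewrite ek; nc.
  have ey : y = - (2 * x) by apply/eqP; rewrite -addr_eq0 addrC t0.
  exfalso; have [_ d0] := ru.
  have x0 : x = 0.
    have /eqP : (1 + 4 * c) * (x * x) = 0.
      by rewrite -[RHS]oppr0 -[in RHS]n0 ey; ring.
    by rewrite mulf_eq0 (negPf d0) mulf_eq0 orbb => /eqP.
  by move: k0; rewrite ek ey x0 mulr0 oppr0 !scale0r addr0 eqxx.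
have := memv_pick I; move: I0; rewrite -vpick0.
move: (vpick I) => w w0 wI; have [p [q [qp qq ew]]] := allQ w.
have uw : u * w \in I by case: (iI w u wI).
have wu : w * u \in I by case: (iI w u wI).
have pI : p \in I.
  have qv0 : comm_part u c (q * v) = 0.
    have := comm_flip_part ru (q * v).
    rewrite (flip_part_id ru (comm_flips (cu _ qq) fv)) => e.
    by apply: (addIr (q * v)); rewrite add0r.
  have -> : p = comm_part u c w.
    by rewrite ew comm_partD qv0 addr0 (comm_part_id ru) ?cu.
  have uwu : u * w * u \in I by case: (iI _ u uw).
  by rewrite /comm_part ?memvZ ?memvD ?memvN ?memvB ?memvZ ?memvD ?memvN.
have [p0|p0] := eqVneq p 0; last exact: quadI qp pI p0.
apply: (quadI q) => //.
  have [_ h] := iI _ (b^-1 *: v) wI; move: h.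
  by rewrite ew p0 add0r -scalerAr -mulrA vv -scalerAr scalerA mulVf // scale1r mulr1.
by apply: contraNneq w0 => q0; rewrite ew p0 q0 mul0r addr0.
Qed.

End Quaternions.

(** * Decomposability from a decomposing pair *)

Section QuaternionSubalgebra.

Variables (F : fieldType) (A : falgType F) (u v : A) (c b : F).
Hypotheses (ru : etale_root u c) (fv : flips u v) (vv : v * v = b%:A) (b0 : b != 0).
Local Notation Q := (quaternion ru fv vv).
Local Notation quatP := (quaternionP u v).

Lemma quaternion_mem1 : 1 \in Q.
Proof.
by apply/quatP; exists 1, 0; split; rewrite ?mul0r ?addr0 //; [exact: in_quad1 | exists 0, 0; nc].
Qed.

Lemma quaternion_mem_root : u \in Q.
Proof.
apply/quatP; exists u, 0; split; rewrite ?mul0r ?addr0 //; [exists 0, 1 | exists 0, 0]; nc.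
Qed.

Lemma quaternion_mem_flip : v \in Q.
Proof.
apply/quatP; exists 0, 1; split; rewrite ?mul1r ?add0r //; [exists 0, 0; nc | exact: in_quad1].
Qed.

Lemma quaternion_subalgebraP : quaternion_subalgebra Q.
Proof.
have Q1 := quaternion_mem1; have Qu := quaternion_mem_root; have Qv := quaternion_mem_flip.
split=> //; last exact: dim_quaternion.
have v1 := vsval_one Q1; have a1 : algid Q = 1 by apply/eqP; rewrite algid_eq1.
have ru' : etale_root (vsproj Q u) c.
  have [u2 d0] := ru; split=> //; apply: subvs_inj.
  by rewrite /= !vsprojK // u2 ?v1 ?a1.
have fv' : flips (vsproj Q u) (vsproj Q v).
  by apply: subvs_inj; rewrite /= !vsprojK // fv.
have vv' : vsproj Q v * vsproj Q v = b%:A.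
  by apply: subvs_inj; rewrite /= !vsprojK // vv ?v1 ?a1.
apply: (quaternion_central_simple ru' fv' vv' b0); apply/eqP.
rewrite eqEsubv subvf andbT; apply/subvP=> x _; apply/quaternionP.
have /quatP[_ [_ [[x0 [x1 ->]] [x2 [x3 ->]] ex]]] := subvsP x.
exists (x0%:A + x1 *: vsproj Q u), (x2%:A + x3 *: vsproj Q u); split.
- by exists x0, x1.
- by exists x2, x3.
by apply: subvs_inj; rewrite /= !vsprojK // ?v1 ?a1.
Qed.

Lemma quaternion_commute y : u * y = y * u -> v * y = y * v ->
  forall x, x \in Q -> x * y = y * x.
Proof.
move=> uy vy x /quatP[p [q [qp qq ->]]].
rewrite mulrDl mulrDr (in_quad_comm qp uy); congr (_ + _).
by rewrite -mulrA vy mulrA (in_quad_comm qq uy) mulrA.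
Qed.

Lemma quaternion_cap (M : {vspace A}) : 1 \in M -> u \in M ->
  (forall x, x \in M -> u * x = x * u) -> (Q :&: M)%VS = span [:: 1; u].
Proof.
move=> M1 Mu cM; apply/eqP; rewrite eqEsubv; apply/andP; split; last first.
  apply/span_subvP=> x; rewrite memv_cap !inE => /orP[] /eqP ->.
    by rewrite quaternion_mem1.
  by rewrite quaternion_mem_root.
apply/subvP=> x /memv_capP[/quatP[p [q [qp qq ex]]] xM].
have cu k : in_quad u k -> u * k = k * u by move=> qk; apply/esym/(in_quad_comm qk).
have q0 : q = 0.
  apply: (quaternion_comm ru fv vv b0 (cu _ qp) (cu _ qq)).
  by rewrite -ex cM.
move: ex; rewrite q0 mul0r addr0 => ->; case: qp => [x0 [x1 ->]].
by rewrite span_cons span_seq1 memv_add // memvZ // memv_line.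
Qed.

Lemma dim_quaternion_quad : \dim (span [:: 1; u]%R) = 2%N.
Proof.
have := catl_free (quaternion_free ru fv vv b0 : free ([:: 1; u] ++ [:: v; u * v])).
by move/eqP.
Qed.

Lemma quaternion_stable (sigma : 'End(A)) :
    (forall x y, sigma (x * y) = sigma y * sigma x) -> (forall x, sigma (sigma x) = x) ->
    sigma 1 = 1 -> sigma u = u -> sigma v = v -> (sigma @: Q)%VS = Q.
Proof.
move=> sM sK s1 su sv; have sub : (sigma @: Q <= Q)%VS.
  apply/subvP=> _ /memv_imgP[x + ->] => /quatP[_ [_ [[x0 [x1 ->]] [x2 [x3 ->]] ->]]].
  rewrite linearD /= sM sv !linearD /= !linearZ /= s1 su.
  have Q1 := quaternion_mem1; have Qu := quaternion_mem_root; have Qv := quaternion_mem_flip.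
  have inQ y z : y *: 1 + z *: u \in Q by apply: memvD; apply: memvZ.
  by apply: memvD (inQ _ _) _; exact: (@memvM _ _ Q _ _ Qv (inQ _ _)).
apply/eqP; rewrite eqEsubv sub; apply/subvP=> x xQ; rewrite -(sK x); apply: memv_img.
by apply: (subvP sub); apply: memv_img.
Qed.

End QuaternionSubalgebra.

Section Decompositions.

Variables (F : fieldType) (A : falgType F) (sigma : 'End(A)) (L : {aspace A}).
Hypothesis fr : symmetric_frame sigma L.
Variables (u u' : A) (c c' : F).
Hypotheses (L1 : 1 \in L) (bp : biquadratic_pair L u u' c c').
Hypothesis dec : decomposing_pair sigma u u'.

Lemma decomposing_decomposable_quad (K : {aspace A}) : K = span [:: 1; u] :> {vspace A} ->
  decomposable_along sigma K.
Proof.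
have [x [v [a [b [xW vW xv [xx a0] [vv b0]]]]]] := dec.
have [vS u'v fv] := WvsP _ _ _ _ vW; have ru := pair_root bp.
have sM := frame_anti fr; have sK := frame_invol fr.
have sL y : y \in L -> sigma y = y by apply: frame_fix.
move=> eK; exists 1%N, (fun=> quaternion ru fv vv); split=> //.
- by rewrite eK (dim_quaternion_quad ru fv vv b0).
- by move=> i; apply: quaternion_subalgebraP.
- move=> i; apply: (quaternion_stable _ _ _ sM sK (sL _ L1) (sL _ (pair_mem1 bp))).
  exact: (Symd_fix fr vS).
- by move=> i j; rewrite !ord1 eqxx.
move=> i; rewrite /quadratic (quaternion_cap ru fv vv b0).
- exact: (dim_quaternion_quad ru fv vv b0).
- by rewrite eK memv_span ?inE ?eqxx.
- by rewrite eK memv_span ?inE ?eqxx ?orbT.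
move=> y; rewrite eK span_cons span_seq1 => /memv_addP[_ /vlineP[p ->] [_ /vlineP[q ->] ->]].
nc.
Qed.

Lemma decomposing_decomposable : decomposable_along sigma L.
Proof.
have [x [v [a [b [xW vW xv [xx a0] [vv b0]]]]]] := dec.
have [vS u'v fv] := WvsP _ _ _ _ vW; have [xS ux fx] := WvsP _ _ _ _ xW.
have ru := pair_root bp; have ru' := pair_root' bp; have uu' := pair_comm bp.
have uL := pair_mem1 bp; have u'L := pair_mem2 bp.
have sM := frame_anti fr; have sK := frame_invol fr.
have sL y : y \in L -> sigma y = y by apply: frame_fix.
pose Q := quaternion ru fv vv; pose Q' := quaternion ru' fx xx.
have QQ' : (Q <= 'C(Q'))%VS.
  apply/centvsP=> y z yQ zQ'; apply: (quaternion_commute _ _ yQ).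
    by apply/esym; apply: (quaternion_commute _ _ zQ').
  by apply/esym; apply: (quaternion_commute _ _ zQ').
have cL y z : y \in L -> z \in L -> y * z = z * y by apply: (pair_commutative bp).
exists 2, (fun i : 'I_2 => if i == ord0 then Q else Q'); split.
- by rewrite (pair_span bp) (eqP (pair_free bp)).
- by move=> i; case: ifP => _; apply: quaternion_subalgebraP.
- have [s1 su su'] := And3 (sL _ L1) (sL _ uL) (sL _ u'L).
  have [sx sv] := conj (Symd_fix fr xS) (Symd_fix fr vS).
  by move=> i; case: ifP => _; apply: quaternion_stable.
- have Q'Q : (Q' <= 'C(Q))%VS.
    by apply/centvsP=> y z yQ zQ'; apply/esym; have /centvsP := QQ'; apply.
  by case=> [[|[|i]] lti] [[|[|j]] ltj].
move=> i; case: ifP => _; rewrite /quadratic.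
  rewrite (quaternion_cap ru fv vv b0) ?(dim_quaternion_quad ru fv vv b0) //.
  by move=> y; apply: cL.
rewrite (quaternion_cap ru' fx xx a0) ?(dim_quaternion_quad ru' fx xx a0) //.
by move=> y; apply: cL.
Qed.

End Decompositions.

(** * Bases over skew fields *)

Section FieldBasis.

Variables (F : fieldType) (A : falgType F) (D V : {vspace A}) (e : A).
Hypotheses (eD : e \in D) (e0 : e != 0).
Hypothesis DM : forall d d', d \in D -> d' \in D -> d * d' \in D.
Hypothesis DV : forall d, d \in D -> d != 0 -> exists2 d', d' \in D & d * d' = e.
Hypothesis VD : forall v d, v \in V -> d \in D -> v * d \in V.
Hypothesis Ve : forall v, v \in V -> v * e = v.

Definition right_independent k (x : 'I_k -> A) : Prop :=
  forall d : 'I_k -> A, (forall i, d i \in D) -> \sum_i x i * d i = 0 -> forall i, d i = 0.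

Definition right_comb k (x : 'I_k -> A) (d : {ffun 'I_k -> subvs_of D}) : A :=
  \sum_i x i * vsval (d i).

Lemma right_comb_linear k (x : 'I_k -> A) : linear (right_comb x).
Proof.
move=> a l l'; rewrite /right_comb scaler_sumr -big_split; apply: eq_bigr => i _.
by rewrite !ffunE linearP mulrDr scalerAr.
Qed.

HB.instance Definition _ k (x : 'I_k -> A) :=
  GRing.isLinear.Build _ _ _ _ (right_comb x) (right_comb_linear x).

Lemma right_independent_dim k (x : 'I_k -> A) : right_independent x ->
  \dim (limg (linfun (right_comb x))) = (k * \dim D)%N.
Proof.
move=> xi; rewrite limg_dim_eq.
  by rewrite dimvf -[LHS]/(#|'I_k| * \dim D)%N card_ord.
apply/eqP; rewrite -subv0; apply/subvP=> d; rewrite memv_cap memvf memv_ker lfunE /=.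
move=> /eqP/(xi (fun i => vsval (d i)) (fun i => subvsP _)) di.
by rewrite memv0; apply/eqP/ffunP=> i; apply: subvs_inj; rewrite di ffunE linear0.
Qed.

(** An independent family in [V] that does not span [V] can be extended, and its
    length is bounded by the dimension over the base field. *)
Lemma right_field_basis : exists k (x : 'I_k -> A),
  [/\ forall i, x i \in V, right_independent x,
      forall y, y \in V -> exists2 d : 'I_k -> A, forall i, d i \in D & y = \sum_i x i * d i
    & \dim V = (k * \dim D)%N].
Proof.
have D0 : (0 < \dim D)%N.
  by rewrite lt0n dimv_eq0; apply: contraNneq e0 => D0; rewrite -memv0 -D0.
suff main m : forall k (x : 'I_k -> A), (\dim V < k * \dim D + m)%N ->
    (forall i, x i \in V) -> right_independent x -> exists k (x : 'I_k -> A),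
      [/\ forall i, x i \in V, right_independent x,
      forall y, y \in V -> exists2 d : 'I_k -> A, forall i, d i \in D & y = \sum_i x i * d i
    & \dim V = (k * \dim D)%N].
  by apply: (main (\dim V).+1 0%N (fun=> 0)) => // [|d _ _] [].
have sub k (x : 'I_k -> A) : (forall i, x i \in V) ->
    (limg (linfun (right_comb x)) <= V)%VS.
  move=> xV; apply/subvP=> _ /memv_imgP[d _ ->]; rewrite lfunE memv_suml // => i _.
  by apply: VD (subvsP _).
elim: m => [|m IHm] k x lt_m xV xi; have dx := right_independent_dim xi;
    have {}sub := sub k x xV.
  by move: (dimvS sub); rewrite dx leqNgt -(addn0 (k * _)%N) lt_m.
have [le|nle] := boolP (V <= limg (linfun (right_comb x)))%VS.
  exists k, x; split=> //; last by rewrite -dx; apply/eqP; rewrite eqn_leq !dimvS.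
  move=> y /(subvP le)/memv_imgP[d _ ->]; exists (fun i => vsval (d i)).
    by move=> i; apply: subvsP.
  by rewrite lfunE.
have [y yV ny] := subvPn nle.
pose x' (i : 'I_k.+1) := oapp x y (unlift ord0 i).
apply: (IHm k.+1 x').
- by move: lt_m D0; rewrite mulSn; lia.
- by move=> i; rewrite /x'; case: unliftP => [j _|_] /=; rewrite ?xV ?yV.
move=> d dD; rewrite big_ord_recl {1}/x' unlift_none /=.
under eq_bigr do rewrite /x' liftK /=.
move=> e1; have d0 : d ord0 = 0.
  apply/eqP; apply: contraNT ny => /(DV (dD _))[d' d'D dd'].
  apply/memv_imgP; exists [ffun i => vsproj D (- (d (lift ord0 i) * d'))]; first exact: memvf.
  rewrite lfunE /= /right_comb -(Ve yV) -dd' mulrA.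
  move/eqP: e1; rewrite addr_eq0 => /eqP ->; rewrite mulNr mulr_suml -sumrN.
  apply: eq_bigr => i _; rewrite ffunE vsprojK ?memvN ?DM ?dD //.
  by rewrite mulrN mulrA.
move=> i; case: (unliftP ord0 i) => [j ->|-> //].
apply: (xi (fun j => d (lift ord0 j))) => //.
by rewrite -[RHS]e1 d0 mulr0 add0r.
Qed.

End FieldBasis.

(** * Self-centralizing subalgebras *)

Section SelfCentralizing.

Variables (F : fieldType) (A : falgType F) (n : nat) (M : {vspace A}).
Local Notation Z := 'Z({:A})%AS.
Hypothesis genA : central_idempotents_generate A.
Hypothesis Zunit : forall z, z \in Z -> z != 0 -> z \is a GRing.unit.
Hypothesis dimA : \dim {:A} = (n ^ 2 * \dim Z)%N.
Hypothesis MM : forall x y, x \in M -> y \in M -> x * y \in M.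
Hypothesis Mcomm : forall x y, x \in M -> y \in M -> x * y = y * x.
Hypothesis Mred : forall x, x \in M -> x * x = 0 -> x = 0.
Hypothesis ZM : (Z <= M)%VS.

Local Notation ideal f := (amull f @: M)%VS.
Local Notation left_ideal f := (amulr f @: {:A})%VS.

Lemma idealP f x : f \in M -> f * f = f -> x \in ideal f <-> x \in M /\ f * x = x.
Proof.
move=> fM ff; split=> [/memv_imgP[y yM ->]|[xM fx]]; rewrite ?lfunE /=.
  by rewrite MM // mulrA ff.
by apply/memv_imgP; exists x; rewrite ?lfunE.
Qed.

Lemma left_idealP f x : f * f = f -> x \in left_ideal f <-> x * f = x.
Proof.
move=> ff; split=> [/memv_imgP[y _ ->]|fx]; rewrite ?lfunE /=.
  by rewrite -mulrA ff.
by apply/memv_imgP; exists x; rewrite ?lfunE ?memvf.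
Qed.

Lemma ideal_decomp f g : f \in M -> g \in M -> f * f = f -> g * g = g -> f * g = g ->
  \dim (ideal f) = (\dim (ideal g) + \dim (ideal (f - g)))%N /\
  \dim (left_ideal f) = (\dim (left_ideal g) + \dim (left_ideal (f - g)))%N.
Proof.
move=> fM gM ff gg fg; have gf : g * f = g by rewrite Mcomm.
have hh : (f - g) * (f - g) = f - g by rewrite mulrBl !mulrBr ff gg fg gf subrr subr0.
have hM : f - g \in M by rewrite memvB.
have gh : g * (f - g) = 0 by rewrite mulrBr gf gg subrr.
have hg : (f - g) * g = 0 by rewrite mulrBl fg gg subrr.
split; rewrite -dimv_disjoint_sum.
- congr (\dim _); apply/vspaceP=> x; apply/idP/idP.
    move=> /(idealP _ fM ff)[xM fx]; have -> : x = g * x + (f - g) * x by rewrite -mulrDl addrC subrK fx.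
    by apply: memv_add; apply/idealP=> //; rewrite MM // mulrA ?gg ?hh.
  case/memv_addP=> y /(idealP _ gM gg)[yM gy] [y' /(idealP _ hM hh)[y'M hy'] ->].
  apply/idealP=> //; split; first exact: memvD.
  rewrite mulrDr -{1}gy -{1}hy' !mulrA fg gy.
  by rewrite (_ : f * (f - g) = f - g) ?hy' // mulrBr ff fg.
- apply/eqP; rewrite -subv0; apply/subvP=> x; rewrite memv_cap memv0.
  move=> /andP[/(idealP _ gM gg)[_ gx] /(idealP _ hM hh)[_ hx]].
  by rewrite -gx -hx mulrA gh mul0r.
- congr (\dim _); apply/vspaceP=> x; apply/idP/idP.
    move=> /(left_idealP _ ff) fx; have -> : x = x * g + x * (f - g) by rewrite -mulrDr addrC subrK fx.
    by apply: memv_add; apply/left_idealP=> //; rewrite -mulrA ?gg ?hh.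
  case/memv_addP=> y /(left_idealP _ gg) gy [y' /(left_idealP _ hh) hy' ->].
  apply/left_idealP=> //.
  rewrite mulrDl -{1}gy -{1}hy' -!mulrA gf gy.
  by rewrite (_ : (f - g) * f = f - g) ?hy' // mulrBl ff gf.
apply/eqP; rewrite -subv0; apply/subvP=> x; rewrite memv_cap memv0.
move=> /andP[/(left_idealP _ gg) gx /(left_idealP _ hh) hx].
by rewrite -gx -hx -mulrA hg mulr0.
Qed.

Variable c : A.
Hypothesis cM : forall m, m \in M -> c * m = m * c.

(** Boolean, so that fields may be told from other ideals by contradiction. *)
Definition big_ideal f : bool :=
  (n * \dim (ideal f) <= \dim (left_ideal f))%N &&
  ((n * \dim (ideal f) == \dim (left_ideal f))%N ==> (f * c \in M)).

(** When [f M] is a field, [A f] has a basis [x] over it, and [f M] a basis [b]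
    over the centre. The maps [x |-> sum_t a_t x b_t] of [A f] are right
    [f M]-linear, and different [a] give different maps; hence the
    dimension inequality. In case of equality all [f M]-linear maps have this form,
    in particular a projection onto [f M] does; but these maps commute with the
    right multiplication by [c], so that the projection sends [f c] to itself. *)
Lemma field_big_ideal f : f \in M -> f * f = f -> f != 0 ->
  (forall m, m \in ideal f -> m != 0 -> f \in (amull m @: ideal f)%VS) -> big_ideal f.
Proof.
move=> fM ff f0 finv.
have fD : f \in ideal f by apply/idealP.
have DP x : x \in ideal f <-> x \in M /\ f * x = x by apply: idealP.
have VP x : x \in left_ideal f <-> x * f = x by apply: left_idealP.
have DM d d' : d \in ideal f -> d' \in ideal f -> d * d' \in ideal f.
  by move=> /DP[dM fd] /DP[d'M _]; apply/DP; rewrite MM // mulrA fd.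
have Df d : d \in ideal f -> d * f = d by move=> /DP[dM fd]; rewrite Mcomm.
have [|||k [x [xV xi xg dV]]] := @right_field_basis _ _ (ideal f) (left_ideal f) f fD f0 DM.
- by move=> d dD /(finv _ dD)/memv_imgP[d' d'D fd']; exists d' => //; rewrite [RHS]fd' lfunE.
- by move=> v d /VP vf dD; apply/VP; rewrite -mulrA Df.
- by move=> v /VP.
have Z1 : 1 \in Z by apply/centerP=> y; rewrite mul1r mulr1.
have ZMul z z' : z \in Z -> z' \in Z -> z * z' \in Z.
  by move=> /centerP cz /centerP cz'; apply/centerP=> y; rewrite -mulrA cz' mulrA cz mulrA.
have [|||p [b [bD bi _ dD]]] := @right_field_basis _ _ Z (ideal f) 1 Z1 (oner_neq0 _) ZMul.
- move=> z zZ /(Zunit zZ) zu; exists z^-1; rewrite ?divrr //; apply/centerP=> y.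
  by apply/esym/commrV/esym; have /centerP := zZ; apply.
- move=> d z /DP[dM fd] zZ; apply/DP; rewrite MM ?mulrA ?fd //; exact: (subvP ZM).
- by move=> d _; rewrite mulr1.
have tens (a : 'I_p -> A) : (forall y, \sum_t a t * y * b t = 0) -> forall t, a t = 0.
  apply: (center_free_tensor genA) => z zZ e; apply: bi => //.
  by rewrite -[RHS]e; apply: eq_bigr => i _; have /centerP -> := zZ i.
have bM t : b t \in M by have /DP[] := bD t.
have abV y (a : 'I_p -> A) : \sum_t a t * y * b t \in left_ideal f.
  by rewrite memv_suml // => t _; apply/VP; rewrite -mulrA Df.
pose Phi (a : {ffun 'I_p -> A}) : {ffun 'I_k -> subvs_of (left_ideal f)} :=
  [ffun i => vsproj (left_ideal f) (\sum_t a t * x i * b t)].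
have Phi_lin : linear Phi.
  move=> l a a'; apply/ffunP=> i; rewrite !ffunE -linearP; congr (vsproj _ _).
  rewrite scaler_sumr -big_split; apply: eq_bigr => t _.
  by rewrite !ffunE !mulrDl !scalerAl.
pose PhiL : {linear _ -> _} := HB.pack Phi (GRing.isLinear.Build _ _ _ _ Phi Phi_lin).
have comb (a : 'I_p -> A) (d : 'I_k -> A) : (forall i, d i \in ideal f) ->
    \sum_t a t * (\sum_i x i * d i) * b t = \sum_i (\sum_t a t * x i * b t) * d i.
  move=> dD'; under [RHS]eq_bigr do rewrite mulr_suml.
  rewrite exchange_big /=; apply: eq_bigr => t _.
  rewrite mulr_sumr mulr_suml; apply: eq_bigr => i _.
  have /DP[dM _] := dD' i; by rewrite mulrA -!mulrA (Mcomm dM).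
have Phi_inj : injective (linfun PhiL).
  apply: raddf_inj => a a0; have {}a0 : Phi a = 0 by rewrite -[LHS](lfunE PhiL a).
  apply/ffunP=> t; rewrite ffunE; apply: tens => y {t}.
  have [|d dD' ey] := xg (y * f); first by apply/VP; rewrite -mulrA ff.
  transitivity (\sum_t a t * (y * f) * b t).
    by apply: eq_bigr => t _; have /DP[_ fb] := bD t; rewrite -{1}fb !mulrA.
  rewrite ey comb // big1 // => i _.
  have /ffunP/(_ i)/(congr1 vsval) := a0; rewrite !ffunE vsprojK // => ->.
  by rewrite linear0 mul0r.
have dim_dom : dim {ffun 'I_p -> A} = (p * \dim {:A})%N.
  by rewrite dimvf -[LHS]/(#|'I_p| * _)%N card_ord.
have dim_cod : dim {ffun 'I_k -> subvs_of (left_ideal f)} = (k * \dim (left_ideal f))%N.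
  by rewrite -[LHS]/(#|'I_k| * _)%N card_ord.
have /lker0P/eqP ker0 := Phi_inj.
have le_dim : (p * \dim {:A} <= k * \dim (left_ideal f))%N.
  rewrite -dim_dom -dim_cod -!dimvf -(limg_dim_eq (f := linfun PhiL)); first exact: dimvS (subvf _).
  by rewrite ker0 capv0.
have Z0 : (0 < \dim Z)%N.
  by rewrite lt0n dimv_eq0; apply: contraNneq (oner_neq0 A) => z0; rewrite -memv0 -z0.
have p0 : (0 < p)%N.
  rewrite lt0n; apply: contraNneq f0 => p0; rewrite -memv0.
  by move/eqP: dD; rewrite p0 mul0n dimv_eq0 => /eqP <-.
have nk : (n <= k)%N.
  rewrite dV dD dimA in le_dim.
  have pz : (0 < p * \dim Z)%N by rewrite muln_gt0 p0.
  rewrite -leq_sqr -(leq_pmul2r pz); move: le_dim.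
  by move: (\dim Z) => z; rewrite -!mulnn; nia.
rewrite /big_ideal dV leq_mul2r nk orbT /=; apply/implyP.
rewrite eqn_pmul2r ?dD ?muln_gt0 ?p0 // => /eqP enk.
have surj y : exists a, Phi a = y.
  have /lfun_bijective := Phi_inj; rewrite dim_dom dim_cod dV dD dimA enk => /(_ _)[|g _ gK].
    by move: (\dim Z) => z; rewrite -mulnn; nia.
  by exists (g y); rewrite -[RHS]gK lfunE.
have [l lD ef] := xg f (proj2 (VP f) ff).
have [j lj0] : exists j, l j != 0.
  apply/existsP; apply: contraR f0 => /existsPn l0; rewrite ef big1 // => i _.
  by have := l0 i; rewrite negbK => /eqP ->; rewrite mulr0.
have /memv_imgP[l' l'D] := finv _ (lD j) lj0; rewrite lfunE /= => ll'.
have l'V : l' \in left_ideal f by apply/VP; apply: Df.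
have [a /ffunP aE] := surj [ffun i => if i == j then vsproj _ l' else 0].
pose pr y := \sum_t a t * y * b t.
have prx i : pr (x i) = if i == j then l' else 0.
  have /(congr1 vsval) := aE i; rewrite !ffunE vsprojK // /pr => ->.
  by case: eqP => _; rewrite ?vsprojK ?linear0.
have prE d : (forall i, d i \in ideal f) -> pr (\sum_i x i * d i) = l' * d j.
  move=> dD'; rewrite /pr comb // (bigD1 j) //= -/(pr _) prx eqxx big1 ?addr0 //.
  by move=> i ij; rewrite -/(pr _) prx (negPf ij) mul0r.
have prf : pr f = f.
  rewrite {1}ef prE // [RHS]ll'; apply: Mcomm.
    by have /DP[] := l'D.
  by have /DP[] := lD j.
have [|d dD' efc] := xg (f * c); first by apply/VP; rewrite -mulrA cM // mulrA ff.
have : pr (f * c) \in ideal f by rewrite efc prE // DM.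
rewrite (_ : pr (f * c) = f * c); first by case/DP.
rewrite -[in RHS]prf /pr mulr_suml; apply: eq_bigr => t _.
by rewrite -!mulrA cM.
Qed.

(** As [M] is reduced, [f M] is the direct sum of the kernel and of the image of
    the multiplication by [m]; [g] is the component of [f] in the image. *)
Lemma split_idempotent f m : f \in M -> f * f = f -> m \in ideal f -> m != 0 ->
    f \notin (amull m @: ideal f)%VS ->
  exists g, [/\ g \in M, g * g = g, f * g = g, g != 0 & f - g != 0].
Proof.
move=> fM ff mI m0 nf; have fI : f \in ideal f by apply/idealP.
have IP x : x \in ideal f <-> x \in M /\ f * x = x by apply: idealP.
have /IP[mM fm] := mI; have := limg_ker_dim (amull m) (ideal f).
set N := (_ :&: _)%VS; set I := (_ @: _)%VS => dNI.
have NI : (N :&: I)%VS = 0%VS.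
  apply/eqP; rewrite -subv0; apply/subvP=> x; rewrite !memv_cap memv_ker memv0 lfunE /=.
  case/andP=> /andP[/IP[xM _] /eqP mx] /memv_imgP[y /IP[yM _]]; rewrite lfunE /= => ex.
  by apply/eqP/Mred => //; rewrite {1}ex -mulrA (Mcomm yM xM) mulrA mx mul0r.
have : f \in (N + I)%VS.
  suff -> : (N + I = ideal f)%VS by [].
  apply/eqP; rewrite eqEdim dimv_disjoint_sum // dNI leqnn andbT subv_add capvSl /=.
  apply/subvP=> _ /memv_imgP[y /IP[yM fy] ->]; rewrite lfunE; apply/IP.
  by rewrite MM // mulrA fm.
case/memv_addP=> h; rewrite memv_cap memv_ker lfunE /= => /andP[/IP[hM fh] /eqP mh].
case=> _ /memv_imgP[y /IP[yM fy] ->]; rewrite lfunE /= => ef.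
pose g := m * y; have gM : g \in M by apply: MM.
have gh : g * h = 0 by rewrite /g (Mcomm mM yM) -mulrA mh mulr0.
have fg : f * g = g by rewrite mulrA fm.
have eh : f - g = h by rewrite ef addrK.
exists g; split=> //.
- by rewrite -{2}(subKr f g) mulrBr eh gh subr0 Mcomm.
- apply: contraNneq m0 => g0; rewrite -[m]fm Mcomm // ef mulrDr mh -/g g0 mulr0.
  by rewrite addr0.
apply: contraNneq nf => /eqP; rewrite subr_eq0 => /eqP efg.
by rewrite [X in X \in _]efg; apply/memv_imgP; exists y; rewrite ?lfunE //; apply/IP.
Qed.

(** Both sides of the inequality are additive along a decomposition of [f], so
    that an equality for [f] is one for each part. *)
Lemma idempotent_big_ideal f : f \in M -> f * f = f -> big_ideal f.
Proof.
have [d] := ubnP (\dim (ideal f)); elim: d f => // d IHd f lt_d fM ff.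
have [->|f0] := eqVneq f 0.
  rewrite /big_ideal mul0r mem0v implybT andbT.
  suff -> : (amull 0 @: M)%VS = 0%VS :> {vspace A} by rewrite dimv0 muln0.
  apply/eqP; rewrite -subv0; apply/subvP=> _ /memv_imgP[x _ ->].
  by rewrite lfunE /= mul0r mem0v.
apply: contraT => nb; suff: big_ideal f by rewrite (negPf nb).
apply: field_big_ideal => // m mI m0; apply: contraR nb => /split_idempotent[] // g.
case=> gM gg fg g0 h0; have [dI dL] := ideal_decomp fM gM ff gg fg.
have gf : g * f = g by rewrite Mcomm.
have hh : (f - g) * (f - g) = f - g by rewrite mulrBl !mulrBr ff gg fg gf subrr subr0.
have hM : f - g \in M by rewrite memvB.
have pos x : x \in M -> x * x = x -> x != 0 -> (0 < \dim (ideal x))%N.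
  move=> xM xx; apply: contraR; rewrite -leqNgt leqn0 dimv_eq0 => /eqP x0.
  by rewrite -memv0 -x0; apply/idealP.
have pg := pos _ gM gg g0; have ph := pos _ hM hh h0.
rewrite dI in lt_d; rewrite /big_ideal dI dL.
have /andP[le2 /implyP eq2] : big_ideal (f - g) by apply: IHd => //; move: lt_d pg; lia.
have /andP[le1 /implyP eq1] : big_ideal g by apply: IHd => //; move: lt_d ph; lia.
rewrite mulnDr leq_add //; apply/implyP=> /eqP e.
have -> : f * c = g * c + (f - g) * c by rewrite -mulrDl addrC subrK.

by apply: memvD; [apply: eq1 | apply: eq2]; apply/eqP; lia.
Qed.

(** The inequality [n dim (f M) <= dim (A f)] holds for all idempotents [f] of
    [M] and is an equality for [f = 1]. *)
Lemma self_centralizing : \dim M = (n * \dim Z)%N -> c \in M.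
Proof.
move=> dM; have M1 : 1 \in M by apply: (subvP ZM); apply/centerP=> y; rewrite mul1r mulr1.
have /andP[_ /implyP] := idempotent_big_ideal M1 (mulr1 1).
have -> : ideal 1 = M by rewrite (_ : amull 1 = \1%VF) ?lim1g //; apply/lfunP=> x; rewrite !lfunE /= mul1r.
have -> : left_ideal 1 = {:A}%VS.
  by rewrite (_ : amulr 1 = \1%VF) ?lim1g //; apply/lfunP=> x; rewrite !lfunE /= mulr1.
rewrite mul1r dM dimA => -> //; by rewrite -mulnn mulnA.
Qed.

End SelfCentralizing.

(** * Stable quaternion subalgebras *)

Section QuaternionGenerators.

Variables (F : fieldType) (B : falgType F).
Hypotheses (csB : central_simple B) (dB : \dim {:B} = 4%N).
Variables (u : B) (c : F).
Hypotheses (ru : etale_root u c) (uF : u \notin 1%VS).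

(** The quadratic subalgebra generated by [u] has the maximal dimension [2]. *)
Lemma comm_root_quad y : u * y = y * u -> in_quad u y.
Proof.
move=> uy; have [u2 d0] := ru; have [eZ _] := csB.
have inM x : x \in span [:: 1; u] <-> in_quad u x by apply: span_quadP.
apply/inM; have /(_ 2%N) := self_centralizing (central_simple_idempotents csB).
rewrite dB (_ : 'Z({:B})%AS = 1%VS :> {vspace B}) ?dimv1 //; apply=> //.
- exact: scalar_unit.
- by move=> x x' /inM qx /inM qx'; apply/inM; apply: in_quadM ru _ _.
- by move=> x x' /inM qx /inM qx'; apply: in_quad_commC qx qx'.
- move=> x /inM[a [b ->]].
  have -> : (a%:A + b *: u) * (a%:A + b *: u) =
      (a * a + b * b * c)%:A + (2 * a * b + b * b) *: u.
    by nc_expand; rewrite u2; nc.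
  case/(quad_indep uF)=> e1 /eqP.
  rewrite -mulrDl mulf_eq0 orbC => /orP[] /eqP b0.
    by move: e1; rewrite b0 !mul0r addr0 => /eqP; rewrite mulf_eq0 orbb => /eqP ->; nc.
  have a0 : a = 0.
    have /eqP : (1 + 4 * c) * (a * a) = 0.
      have eb : b = - (2 * a) by apply/eqP; rewrite -addr_eq0 addrC b0.
      by rewrite -[RHS]e1 eb; ring.
    by rewrite mulf_eq0 (negPf d0) mulf_eq0 orbb => /eqP.
  by move: b0; rewrite a0 mulr0 add0r => ->; nc.
- by rewrite ?eZ; apply/subvP=> _ /vlineP[a ->]; apply/inM; exists a, 0; nc.
- by move=> m /inM qm; apply/esym; apply: in_quad_comm qm uy.
by apply/eqP; rewrite ?eZ ?dimv1 muln1 dim_span_quad.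
Qed.

(** The square of [y] commutes with [y] as well as with [u]. *)
Lemma flips_square y : flips u y -> exists b, y * y = b%:A.
Proof.
move=> fy; have [a [b yy]] := comm_root_quad (flips_flips fy fy).
exists a; have : (2 *: u - 1) * (b *: y) = 0.
  have : y * (y * y) - (y * y) * y = 0 by rewrite mulrA subrr.
  by move=> /(congr1 -%R); rewrite oppr0 => <-; rewrite yy; nc_expand; rewrite fy; nc.
move=> /(etale_root_cancel ru)/eqP; rewrite scaler_eq0 => /orP[/eqP b0|/eqP y0].
  by rewrite yy b0 scale0r addr0.
have [|a0 _] := @quad_indep _ _ u a b uF; first by rewrite -yy y0 mul0r.
by rewrite a0 y0 mul0r scale0r.
Qed.

(** If all elements exchanging [u] and [1 - u] had square zero, they would
    anticommute with each other and any nonzero one would generate a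
    nilpotent ideal. *)
Lemma quaternion_generator : exists v b, [/\ flips u v, v * v = b%:A & b != 0].
Proof.
have good y : flips u y -> y * y != 0 -> exists v b, [/\ flips u v, v * v = b%:A & b != 0].
  move=> fy yy0; have [b yy] := flips_square fy; exists y, b; split=> //.
  by apply: contraNneq yy0 => b0; rewrite yy b0 scale0r.
have [x nx] : exists x, x \notin span [:: 1; u].
  suff /subvPn[x _ nx] : ~~ ({:B} <= span [:: 1; u]%R)%VS by exists x.
  apply/negP=> /dimvS; rewrite dB => le4.
  by have := leq_trans le4 (dim_span _).
pose v0 := flip_part u c x; have f0 : flips u v0 by apply: flip_partP ru _.
have v00 : v0 != 0.
  apply: contraNneq nx => e0; have := comm_flip_part ru x; rewrite -/v0 e0 addr0 => <-.
  by apply/span_quadP/comm_root_quad/(comm_partP ru).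
clearbody v0.
have [v2|] := eqVneq (v0 * v0) 0; last exact: good.
have [w /eqP vwv] : exists w, v0 * w * v0 != 0.
  suff /subvPn[w _ nw] : ~~ ({:B} <= lker (amulr v0 \o amull v0))%VS.
    by exists w; move: nw; rewrite memv_ker comp_lfunE !lfunE.
  apply: contraNN v00 => /subvP sub; apply/eqP.
  apply: (semiprime_fullv (central_simple_idempotents csB)) (memvf _) _ => w _.
  by have := sub w (memvf _); rewrite memv_ker comp_lfunE !lfunE => /eqP.
have := comm_flip_part ru w; set k := comm_part u c w; set y := flip_part u c w => ew.
have fy : flips u y by apply: flip_partP ru _.
have [a [b ek]] := comm_root_quad (comm_partP ru w).
have vkv : v0 * k * v0 = 0.
  rewrite /k ek (_ : v0 * _ = ((a + b)%:A - b *: u) * v0) -?mulrA ?v2 ?mulr0 //.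
  by nc_expand; rewrite f0; nc.
have vyv : v0 * y * v0 <> 0.
  by move=> e; apply: vwv; rewrite -ew mulrDr mulrDl vkv e addr0.
have [yy|] := eqVneq (y * y) 0; last exact: good fy.
apply: (good (v0 + y)); first exact: flipsD.
apply/eqP=> e; apply: vyv; have : v0 * y + y * v0 = 0.
  by rewrite -[RHS]e mulrDl !mulrDr v2 yy addr0 add0r.
by move/eqP; rewrite addr_eq0 => /eqP ->; rewrite mulNr -mulrA v2 mulr0 oppr0.
Qed.

End QuaternionGenerators.

Section StableQuaternions.

Variables (F : fieldType) (A : falgType F) (sigma : 'End(A)).
Hypothesis sM : forall x y, sigma (x * y) = sigma y * sigma x.
Variables (Q : {aspace A}) (u : A) (c : F).
Hypotheses (qQ : quaternion_subalgebra Q) (sQ : (sigma @: Q)%VS = Q).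
Hypotheses (uQ : u \in Q) (ru : etale_root u c) (uF : u \notin 1%VS) (su : sigma u = u).

(** Both [v] and [sigma v] exchange [u] and [1 - u], hence differ by an element
    of [F[u]]. *)
Lemma stable_quaternion : exists v b, [/\ v \in Q, flips u v, v * v = b%:A, b != 0
  & forall y, u * y = y * u -> v * y = y * v -> sigma v * y = y * sigma v].
Proof.
have [Q1 csQ dQ] := qQ; have v1 := vsval_one Q1.
have a1 : algid Q = 1 by apply/eqP; rewrite algid_eq1.
have dB : \dim {:subvs_of Q} = 4%N by rewrite dimvf -[LHS]/(\dim Q).
have rB : etale_root (vsproj Q u) c.
  by have [u2 d0] := ru; split=> //; apply: subvs_inj; rewrite /= !vsprojK // u2 ?a1 ?v1.
have uB : vsproj Q u \notin 1%VS.
  apply: contra uF => /vlineP[a /(congr1 vsval)]; rewrite /= vsprojK // => ->.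
  by apply/vlineP; exists a; rewrite ?a1 ?v1.
have [v [b [fv vv b0]]] := quaternion_generator csQ dB rB uB.
have {}vv : vsval v * vsval v = b%:A by rewrite -[LHS]/(vsval (v * v)) vv /= ?a1 ?v1.
have {}fv : flips u (vsval v).
  by move/(congr1 vsval): fv; rewrite /flips /= !vsprojK.
exists (vsval v), b; split=> // [|y uy vy]; first exact: subvsP.
have svQ : sigma (vsval v) \in Q by move: (memv_img sigma (subvsP v)); rewrite sQ.
have fsv : flips u (sigma (vsval v)).
  have := congr1 sigma fv; rewrite linearB /= !sM su /flips => ->.
  by rewrite opprB addrC subrK.
pose k := b^-1 *: (sigma (vsval v) * vsval v).
have esv : sigma (vsval v) = k * vsval v.
  by rewrite /k -scalerAl -mulrA vv -scalerAr mulr1 scalerA mulVf ?scale1r.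
have kQ : k \in Q by rewrite memvZ ?memvM ?subvsP.
have uk : u * k = k * u by rewrite -scalerAr -scalerAl (flips_flips fsv fv).
have [|k0 [k1 ek]] := @comm_root_quad _ _ csQ dB _ _ rB uB (vsproj Q k).
  by apply: subvs_inj; rewrite /= !vsprojK.
have {}ek : in_quad u k.
  exists k0, k1; move/(congr1 vsval): ek; rewrite /= !vsprojK // => ->.
  by rewrite ?a1 ?v1.
by rewrite esv -mulrA vy mulrA (in_quad_comm ek uy) mulrA.
Qed.

Lemma stable_quaternion_decomposing (L : {aspace A}) (u' : A) (c' : F) :
    symmetric_frame sigma L -> biquadratic_pair L u u' c c' ->
  decomposing_pair sigma u u'.
Proof.
move=> fr bp; have [v [b [_ fv vv b0 sv]]] := stable_quaternion.
have [x [a [xW a0 xx]]] := quaternion_W_square fr bp fv vv b0 sv.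
exact (W_decomposing fr bp xW a0 xx).
Qed.

End StableQuaternions.

(** * The centre, and centralizers in degree four *)

Section Centre.

Variables (F : fieldType) (A : falgType F) (sigma : 'End(A)).
Hypothesis hA : algebra_with_involution sigma.
Local Notation Z := 'Z({:A})%AS.

Let sM x y : sigma (x * y) = sigma y * sigma x. Proof. by have [h _ _ _] := hA; apply: h. Qed.
Let sK x : sigma (sigma x) = x. Proof. by have [_ h _ _] := hA; apply: h. Qed.

Lemma central_sym z : z \in Z -> sigma z = z -> exists a, z = a%:A.
Proof.
move=> zZ sz; have [_ _ eF _] := hA; apply/mem1vP; rewrite -eF memv_cap zZ /=.
exact/fixedSpaceP.
Qed.

Lemma central_invol z : z \in Z -> sigma z \in Z.
Proof.
by move=> /centerP cz; apply/centerP=> y; rewrite -[y]sK -!sM cz.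
Qed.

(** The difference [w = t - sigma t] is skew and central, so its square is in
    [F]; it is not zero because [A] is semiprime. For [z] central,
    [w (z - sigma z)] is in [F] as well, which expresses [z] by [t]. *)
Lemma centre_cases : Z = 1%VS :> {vspace A} \/
  exists t d, [/\ t \in Z, (t - sigma t) * (t - sigma t) = d%:A, d != 0
    & forall z, z \in Z -> exists a b, z = a%:A + b *: t].
Proof.
have sp := semiprime_fullv (involution_idempotents hA).
have [ZS|/subvPn[t tZ nt]] := boolP (Z <= Sym sigma)%VS.
  by left; have [_ _ <- _] := hA; apply/eqP; rewrite eqEsubv capvSl subv_cap subvv ZS.
right; pose w := t - sigma t.
have w0 : w != 0 by rewrite subr_eq0 eq_sym; apply: contra nt => /eqP/fixedSpaceP.
have wZ : w \in Z by rewrite memvB ?central_invol.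
have sw : sigma w = - w by rewrite linearB /= sK opprB.
have ZM z z' : z \in Z -> z' \in Z -> z * z' \in Z.
  by move=> /centerP cz /centerP cz'; apply/centerP=> y; rewrite -mulrA cz' mulrA cz mulrA.
have [||d ww] := @central_sym (w * w); [exact: ZM | by rewrite sM sw mulrNN |].
have d0 : d != 0.
  apply: contraNneq w0 => d0; apply/eqP/sp; rewrite ?memvf // => y _.
  by rewrite (centerP _ wZ) -mulrA ww d0 scale0r mulr0.
exists t, d; split=> // z zZ.
have wz : z - sigma z \in Z by rewrite memvB ?central_invol.
have [||a ea] := @central_sym (w * (z - sigma z)).
- exact: ZM.
- by rewrite sM sw linearB /= sK mulrN -mulNr opprB (centerP _ wz).
have e1 : z - sigma z = (d^-1 * a) *: w.
  apply: (scalerI d0); rewrite scalerA mulrA divff // mul1r.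
  by rewrite -[LHS]mul1r -scalerAr scalerAl -ww -mulrA ea -scalerAr mulr1.
have [||b eb] := @central_sym (z - (d^-1 * a) *: t).
- by rewrite memvB ?memvZ.
- rewrite linearB linearZ /=; apply/eqP; rewrite -subr_eq0.
  have -> : sigma z = z - (d^-1 * a) *: w by rewrite -e1 subKr.
  by rewrite /w; apply/eqP; nc.
by exists b, (d^-1 * a); rewrite -eb subrK.
Qed.

Section Twisted.
Variables (t : A) (d : F).
Hypotheses (tZ : t \in Z) (td : (t - sigma t) * (t - sigma t) = d%:A) (d0 : d != 0).

(** Subtracting the image by [sigma] leaves [y' (t - sigma t) = 0], and
    [t - sigma t] is invertible. *)
Lemma sym_twist_free y y' : sigma y = y -> sigma y' = y' -> y + y' * t = 0 ->
  y = 0 /\ y' = 0.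
Proof.
move=> sy sy' e; have e' : y + y' * sigma t = 0.
  have stZ := central_invol tZ; rewrite -(centerP _ stZ) -[RHS](linear0 sigma) -e.
  by rewrite linearD /= sM sy sy'.
have y'0 : y' = 0.
  apply: (scalerI d0); rewrite scaler0 -[y']mulr1 scalerAr -td mulrA.
  suff -> : y' * (t - sigma t) = 0 by rewrite mul0r.
  by rewrite mulrBr -[_ * t](addKr y) e -[_ * sigma t](addKr y) e' subrr.
by move: e; rewrite y'0 mul0r addr0.
Qed.

End Twisted.

Lemma sym_center_free n (X : n.-tuple A) (z : 'I_n -> A) : free X ->
  (forall i : 'I_n, X`_i \in Sym sigma) -> (forall i, z i \in Z) ->
  \sum_i z i * X`_i = 0 -> forall i, z i = 0.
Proof.
move=> /freeP fX XS zZ; have [eZ|[t [d [tZ td d0 gZ]]]] := centre_cases.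
  have /fin_all_exists[a ea] : forall i, exists a, z i = a%:A.
    by move=> i; apply/mem1vP; rewrite -eZ.
  move=> e i; rewrite ea (fX a) ?scale0r // -[RHS]e.
  by apply: eq_bigr => j _; rewrite ea -scalerAl mul1r.
have /fin_all_exists[a /fin_all_exists[b ez]] : forall i, exists a b, z i = a%:A + b *: t.
  by move=> i; apply: gZ.
have sS (k : 'I_n -> F) : sigma (\sum_i k i *: X`_i) = \sum_i k i *: X`_i.
  by rewrite linear_sum; apply: eq_bigr => i _; rewrite linearZ /= (fixedSpaceP (XS i)).
move=> e; have [|e1 e2] := sym_twist_free tZ td d0 (sS a) (sS b).
  rewrite -[RHS]e mulr_suml -big_split; apply: eq_bigr => i _.
  by rewrite ez mulrDl -!scalerAl mul1r (centerP _ tZ).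
by move=> i; rewrite ez (fX a) // (fX b) // !scale0r addr0.
Qed.

Lemma switch_dim (A0 : falgType F) (f : 'AHom(A, A0)) :
  bijective (fun x => (f x, f (sigma x))) -> \dim {:A} = (2 * \dim {:A0})%N.
Proof.
move=> [g fgK gfK]; pose h x : (A0 * A0)%type := (f x, f (sigma x)).
have h_lin : linear h by move=> a x y; rewrite /h !linearP.
pose hL : {linear A -> (A0 * A0)%type} := HB.pack h (GRing.isLinear.Build _ _ _ _ h h_lin).
have h_inj : injective (linfun hL).
  by move=> x y; rewrite !lfunE => e; rewrite -[x]fgK -[y]fgK; congr (g _).
have h_surj : limg (linfun hL) = fullv.
  apply/eqP; rewrite eqEsubv subvf; apply/subvP=> y _; apply/memv_imgP.
  by exists (g y); rewrite ?memvf // lfunE; apply/esym/gfK.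
have := limg_dim_eq (f := linfun hL) (U := fullv); move/lker0P/eqP: h_inj => ->.
rewrite capv0 h_surj => /(_ erefl) <-.
by rewrite !dimvf mul2n -addnn.
Qed.

Section Centralizer.

Variable L : {aspace A}.
Hypotheses (L1 : 1 \in L) (LS : (L <= Sym sigma)%VS) (dL : \dim L = 4%N).
Hypothesis Lcomm : forall x y, x \in L -> y \in L -> x * y = y * x.
Hypothesis Lred : forall x, x \in L -> x * x = 0 -> x = 0.

Let sL x : x \in L -> sigma x = x. Proof. by move/(subvP LS)/fixedSpaceP. Qed.

(** Through the first projection of [A0 x A0^op], symmetric elements of [A]
    become arbitrary elements of [A0], where [L] has the maximal
    dimension [4]. *)
Lemma switch_centralizer (A0 : falgType F) (f : 'AHom(A, A0)) x :
    central_simple A0 -> bijective (fun x => (f x, f (sigma x))) ->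
    \dim {:A0} = (4 ^ 2)%N -> sigma x = x ->
  (forall y, y \in L -> x * y = y * x) -> x \in L.
Proof.
move=> csA0 [g fgK _] dA0 sx xL; have [eZ0 _] := csA0.
have f_inj y : sigma y = y -> f y = 0 -> y = 0.
  move=> sy fy; rewrite -[y]fgK -[RHS]fgK; congr (g _).
  by rewrite sy fy !linear0.
have fM y z : f (y * z) = f y * f z by apply: rmorphM.
suff /memv_imgP[l lL ef] : f x \in (f @: L)%VS.
  suff -> : x = l by [].
  apply/eqP; rewrite -subr_eq0; apply/eqP; apply: f_inj; rewrite linearB /= ?sx ?sL //.
  by rewrite ef subrr.
have := @self_centralizing _ _ 4 (f @: L)%VS (central_simple_idempotents csA0).
rewrite dA0 (_ : 'Z({:A0})%AS = 1%VS :> {vspace A0}) ?dimv1 //; apply=> //.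
- exact: scalar_unit.
- by move=> _ _ /memv_imgP[y yL ->] /memv_imgP[z zL ->]; rewrite -fM memv_img ?memvM.
- by move=> _ _ /memv_imgP[y yL ->] /memv_imgP[z zL ->]; rewrite -!fM Lcomm.
- move=> _ /memv_imgP[y yL ->]; rewrite -fM => e.
  by rewrite (Lred yL) ?linear0 //; apply: f_inj e; rewrite sL ?memvM.
- apply/subvP=> _ /vlineP[a ->]; apply/memv_imgP; exists a%:A; first by rewrite memvZ.
  by rewrite linearZ /= rmorph1.
- by move=> _ /memv_imgP[y yL ->]; rewrite -!fM xL.
rewrite ?eZ0 ?dimv1 muln1 limg_dim_eq ?dL //; apply/eqP; rewrite -subv0.
apply/subvP=> y; rewrite memv_cap memv_ker memv0 => /andP[yL /eqP fy].
by rewrite (f_inj _ (sL yL) fy).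
Qed.

(** With the centre [Z = F + F t], the maximal commutative subalgebra is
    [M = L + L t], of which [L] is the symmetric part. It is reduced: for
    [y] in [M] with [y ^ 2 = 0], the norm [y sigma y], the trace [y + sigma y]
    and then [(t - sigma t) y] are in [L] and nilpotent. *)
Lemma degree_centralizer x : has_degree sigma 4 -> sigma x = x ->
  (forall y, y \in L -> x * y = y * x) -> x \in L.
Proof.
case=> [[A0 [f [cs fb dA0]]]|[Zu dA]] sx xL; first exact: switch_centralizer cs fb dA0 sx xL.
have genA := involution_idempotents hA.
have [eZ|[t [d [tZ td d0 gZ]]]] := centre_cases.
  apply: (self_centralizing genA Zu dA) => //; first exact: memvM.
  - by apply/subvP=> z; rewrite eZ => /vlineP[a ->]; rewrite memvZ.
  by rewrite eZ dimv1 dL.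
have ct y : t * y = y * t by apply: (centerP _ tZ).
have dis := sym_twist_free tZ td d0.
pose M := (L + amulr t @: L)%VS.
have MP y : y \in M <-> exists l l', [/\ l \in L, l' \in L & y = l + l' * t].
  split=> [/memv_addP[l lL [_ /memv_imgP[l' l'L ->] ->]]|[l [l' [lL l'L ->]]]].
    by exists l, l'; rewrite lfunE.
  by apply: memv_add => //; apply/memv_imgP; exists l'; rewrite ?lfunE.
have scal a : a%:A \in L by rewrite memvZ.
have stZ := central_invol tZ.
have [||e ste] := @central_sym (t + sigma t); [exact: memvD | by rewrite linearD /= sK addrC |].
have [||n tst] := @central_sym (t * sigma t).
- by apply/centerP=> y; rewrite -mulrA (centerP _ stZ) mulrA ct mulrA.
- by rewrite sM sK.
have st : sigma t = e%:A - t by rewrite -ste addrC addKr.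
have tt : t * t = e *: t - n%:A.
  by rewrite -tst st; nc.
have symM y : y \in M -> sigma y = y -> y \in L.
  case/MP=> l [l' [lL l'L ->]]; rewrite linearD /= sM (sL lL) (sL l'L) => /addrI e1.
  have -> : l' = 0; last by rewrite mul0r addr0.
  apply: (scalerI d0); rewrite scaler0 -[l']mulr1 scalerAr -td mulrA.
  suff -> : l' * (t - sigma t) = 0 by rewrite mul0r.
  by rewrite mulrBr -e1 (centerP _ stZ) subrr.
have prod l l' m m' : (l + l' * t) * (m + m' * t) =
    l * m + (l * m' + l' * m) * t + l' * m' * (t * t).
  rewrite mulrDl !mulrDr -!mulrA (mulrA t m') (ct m) (ct m') !mulrA; nc.
have MM y y' : y \in M -> y' \in M -> y * y' \in M.
  case/MP=> l [l' [lL l'L ->]] /MP[m [m' [mL m'L ->]]]; apply/MP.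
  exists (l * m - n *: (l' * m')), (l * m' + l' * m + e *: (l' * m')).
  split; rewrite ?memvD ?memvN ?memvZ ?memvM //.
  by rewrite prod tt; nc.
have Mcomm y y' : y \in M -> y' \in M -> y * y' = y' * y.
  case/MP=> l [l' [lL l'L ->]] /MP[m [m' [mL m'L ->]]]; rewrite !prod.
  by rewrite (Lcomm mL lL) (Lcomm m'L l'L) (Lcomm mL l'L) (Lcomm m'L lL) (addrC (l' * m)).
have sMem y : y \in M -> sigma y \in M.
  case/MP=> l [l' [lL l'L ->]]; rewrite linearD /= sM (sL lL) (sL l'L) st; apply/MP.
  by exists (l + e *: l'), (- l'); split; rewrite ?memvD ?memvN ?memvZ // mulrBl ct; nc.
have tM : t \in M by apply/MP; exists 0, 1; rewrite mem0v L1 mul1r add0r.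
have Mred y : y \in M -> y * y = 0 -> y = 0.
  move=> yM yy; have syM := sMem y yM; have cy := Mcomm y _ yM syM.
  have sysy : sigma y * sigma y = 0 by rewrite -sM yy linear0.
  have ysy0 : y * sigma y = 0.
    apply: Lred; first by apply: symM; rewrite ?MM // sM sK.
    by rewrite {2}cy mulrA -(mulrA y) sysy mulr0 mul0r.
  have y_sy : y + sigma y = 0.
    apply: Lred; first by apply: symM; rewrite ?memvD // linearD /= sK addrC.
    by rewrite mulrDl !mulrDr -cy yy ysy0 sysy !addr0.
  have sy : sigma y = - y by apply/eqP; rewrite -addr_eq0 addrC y_sy.
  pose w := t - sigma t; have wM : w \in M by rewrite memvB ?sMem.
  have wy0 : w * y = 0.
    apply: Lred; last by rewrite (Mcomm w y) // mulrA -(mulrA y) (Mcomm w y) // !mulrA yy !mul0r.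
    apply: symM; first exact: MM.
    by rewrite sM sy linearB /= sK mulNr -mulrN opprB Mcomm.
  by apply: (scalerI d0); rewrite scaler0 -[y]mul1r scalerAl -td -mulrA wy0 mulr0.
have tF : t \notin 1%VS.
  apply/vlineP=> -[a ta]; have /eqP := td; rewrite ta sL ?scal // subrr mul0r eq_sym.
  by rewrite scaler_eq0 oner_eq0 orbF (negPf d0).
have dZ : \dim Z = 2%N.
  have -> : Z = span [:: 1; t] :> {vspace A}.
    apply/vspaceP=> z; apply/idP/idP => [/gZ[a [b ->]]|/span_quadP[a [b ->]]].
      by apply/span_quadP; exists a, b.
    by apply/centerP=> y; rewrite mulrDl mulrDr -!scalerAl -!scalerAr ct mul1r mulr1.
  by apply/eqP; rewrite dim_span_quad.
apply: (symM _ _ sx); apply: (self_centralizing genA Zu dA MM Mcomm Mred).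
- by apply/subvP=> z /gZ[a [b ->]]; apply/MP; exists a%:A, b%:A; rewrite !scal -scalerAl mul1r.
- by move=> _ /MP[l [l' [lL l'L ->]]]; rewrite mulrDr mulrDl xL // -mulrA ct mulrA xL // mulrA.
rewrite dZ dimv_disjoint_sum ?limg_dim_eq ?dL //.
  apply/eqP; rewrite -subv0; apply/subvP=> y; rewrite memv_cap memv_ker lfunE memv0 /=.
  case/andP=> yL /eqP e1; have [|_ ->//] := dis 0 y (linear0 _) (sL yL).
  by rewrite add0r.
apply/eqP; rewrite -subv0; apply/subvP=> y /memv_capP[yL /memv_imgP[l' l'L]].
rewrite lfunE /= => e1; rewrite memv0.
have sl' : sigma (- l') = - l' by rewrite linearN /= (sL l'L).
by have [|->] := dis y (- l') (sL yL) sl'; first by rewrite e1 mulNr subrr.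
Qed.

End Centralizer.

End Centre.

(** * Alternating matrices *)

Section AlternatingMatrices.

Variables (E : fieldType) (N : nat) (G : 'M[E]_N).

Definition alternating_mx k (S : 'M[E]_k) : Prop :=
  forall v : 'cV_k, v^T *m S *m v = 0.

Lemma alternating_mxE k (S : 'M[E]_k) : alternating_mx S ->
  (forall i, S i i = 0) /\ forall i j, S i j = - S j i.
Proof.
move=> aS; have dE i j : ((delta_mx i 0 : 'cV_k)^T *m S *m (delta_mx j 0 : 'cV_k)) = (S i j)%:M.
  apply/matrixP=> p q; rewrite trmx_delta -rowE -colE !mxE !ord1 eqxx mulr1n //.
have Sii i : S i i = 0.
  by have := aS (delta_mx i 0); rewrite dE => /matrixP/(_ 0 0); rewrite !mxE eqxx mulr1n.
split=> // i j; apply/eqP; rewrite -addr_eq0.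
have := aS (delta_mx i 0 + delta_mx j 0).
rewrite [(_ + _)^T]linearD /= !mulmxDl !mulmxDr !dE !Sii => /matrixP/(_ 0 0).
by rewrite !mxE eqxx !mulr1n ?addr0 ?add0r => ->.
Qed.

Lemma alternating_congr k (S : 'M[E]_N) (C : 'M[E]_(N, k)) :
  alternating_mx S -> alternating_mx (C^T *m S *m C).
Proof. by move=> aS v; have := aS (C *m v); rewrite trmx_mul !mulmxA. Qed.

Lemma idempotent_factor (P : 'M[E]_N) k : P *m P = P -> \rank P = k ->
  exists (C : 'M_(N, k)) (R : 'M_(k, N)), C *m R = P /\ R *m C = 1%:M.
Proof.
move=> PP <-; exists (col_base P), (row_base P); rewrite mulmx_base; split=> //.
have /row_freeP[D RD] := row_base_free P; have /row_fullP[D' CD'] := col_base_full P.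
move: (col_base P) (row_base P) (mulmx_base P) D RD D' CD'.
move: (\rank P) => m C R CR D RD D' CD'.
have e : D' *m (C *m R *m (C *m R)) *m D = D' *m (C *m R) *m D by rewrite CR PP.
move: e; rewrite !mulmxA CD' !mul1mx RD -!mulmxA RD mulmx1 => <- //.
Qed.

Hypotheses (Galt : alternating_mx G) (Gunit : G \in unitmx).

Section Idempotent.

Variable P : 'M[E]_N.
Hypotheses (PP : P *m P = P) (PG : P^T *m G = G *m P).

Lemma corner_gram_rank k (C : 'M_(N, k)) (R : 'M_(k, N)) : C *m R = P ->
  (\rank P <= \rank (C^T *m G *m C)%R)%N.
Proof.
move=> CR; have <- : \rank (R^T *m (C^T *m G *m C) *m R) = \rank P.
  have -> : R^T *m (C^T *m G *m C) *m R = G *m P.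
    by rewrite !mulmxA -trmx_mul CR -mulmxA CR PG -mulmxA PP.
  by rewrite -mxrank_tr trmx_mul mxrankMfree ?mxrank_tr // row_free_unit unitmx_tr.
by rewrite (leq_trans (mxrankM_maxl _ _)) // mxrankM_maxr.
Qed.

(** On the image of [P] the form is alternating and nondegenerate. *)
Lemma alternating_rank : P != 0 -> (2 <= \rank P)%N.
Proof.
rewrite -mxrank_eq0; case e: (\rank P) => [|[|k]] // _.
have [C [R [CR RC]]] := idempotent_factor PP e.
have := corner_gram_rank CR; rewrite e; have [S0 _] := alternating_mxE (alternating_congr C Galt).
have -> : C^T *m G *m C = 0 by apply/matrixP=> i j; rewrite !ord1 S0 mxE.
by rewrite mxrank0.
Qed.

(** Alternating forms on a plane are proportional. *)
Lemma alternating_scalar X : \rank P = 2%N -> X *m P = P *m X ->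
  alternating_mx (G *m X) -> exists l, X *m P = l *: P.
Proof.
move=> rP XP aX; have [C [R [CR RC]]] := idempotent_factor PP rP.
have := corner_gram_rank CR; rewrite rP.
have [S0 Sn] := alternating_mxE (alternating_congr C Galt).
have [T0 Tn] := alternating_mxE (alternating_congr C aX).
set S := C^T *m G *m C in S0 Sn *; set T := C^T *m (G *m X) *m C in T0 Tn => rS.
have Su : S \in unitmx by rewrite -row_free_unit /row_free eqn_leq rank_leq_row.
pose Y := R *m X *m C.
have XC : X *m C = C *m Y.
  have PC : P *m C = C by rewrite -CR -mulmxA RC mulmx1.
  by rewrite -{1}PC mulmxA XP -CR /Y !mulmxA.
have TY : T = S *m Y by rewrite /T /S -!mulmxA XC.
have i01 (Q : 'M[E]_2) : (forall i, Q i i = 0) -> (forall i j, Q i j = - Q j i) ->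
    Q = Q 0 1 *: \matrix_(i, j) ((i < j)%:R - (j < i)%:R).
  move=> Q0 Qn; apply/matrixP=> i j; rewrite !mxE.
  case: i j => [[|[|i]] lti] [[|[|j]] ltj] //=; rewrite ?subr0 ?sub0r ?subrr ?mulr0 ?mulr1 ?mulrN1.
  - by rewrite -[RHS](Q0 0); congr (Q _ _); apply: val_inj.
  - by congr (Q _ _); apply: val_inj.
  - by rewrite -Qn; congr (Q _ _); apply: val_inj.
  by rewrite -[RHS](Q0 1); congr (Q _ _); apply: val_inj.
have g0 : S 0 1 != 0.
  apply: contraL Su => /eqP g0; rewrite (i01 S S0 Sn) g0 scale0r unitmxE det0 unitr0 //.
have TS : T = (T 0 1 / S 0 1) *: S.
  have {1}-> := i01 T T0 Tn; have {2}-> := i01 S S0 Sn.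
  by rewrite scalerA divfK.
exists (T 0 1 / S 0 1).
have -> : X *m P = C *m Y *m R by rewrite -XC -mulmxA CR.
have -> : Y = (T 0 1 / S 0 1)%:M.
  by apply: (can_inj (mulKmx Su)); rewrite -TY {1}TS mul_mx_scalar.
by rewrite mul_mx_scalar -scalemxAl CR.
Qed.

End Idempotent.

Lemma orthogonal_idempotent_rank (P Q M : 'M[E]_N) : P *m P = P -> Q *m Q = Q ->
  P *m Q = 0 -> Q *m P = 0 -> P + Q = M -> (\rank P + \rank Q <= \rank M)%N.
Proof.
move=> PP QQ PQ QP <-; rewrite -(mxrank_disjoint_sum (A := P) (B := Q)).
  apply: mxrankS; rewrite addsmx_sub; apply/andP; split; apply/submxP.
    by exists P; rewrite mulmxDr PP PQ addr0.
  by exists Q; rewrite mulmxDr QQ QP add0r.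
apply/eqP; rewrite -submx0; apply/rV_subP=> v; rewrite sub_capmx submx0.
by case/andP=> /submxP[x ex] /submxP[y ey]; rewrite ex -PP mulmxA -ex ey -mulmxA QP mulmx0.
Qed.

End AlternatingMatrices.

(** * Symplectic case: split subalgebras *)

Section SplitRoots.

Variables (F : fieldType) (B : falgType F).

(** The idempotent is the Lagrange interpolation [(u - (1 - r)) / (2 r - 1)]. *)
Lemma root_idempotent (u : B) c r : etale_root u c -> r * r = r + c ->
  exists k a, [/\ k != 0, (k *: u + a%:A) * (k *: u + a%:A) = k *: u + a%:A
    & exists m, u = m *: (k *: u + a%:A) + (1 - r)%:A].
Proof.
move=> [u2 d0] rr; have m0 : 2 * r - 1 != 0.
  have mm : (2 * r - 1) * (2 * r - 1) = 1 + 4 * c.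
    have -> : c = r * r - r by rewrite rr; ring.
    ring.
  by apply: contraNneq d0 => m0; rewrite -mm m0 mul0r.
have kk : (2 * r - 1)^-1 * (2 * r - 1) = 1 by rewrite mulVf.
have cE : c = r * r - r by rewrite rr; ring.
set k := (2 * r - 1)^-1 in kk; exists k, (- (k * (1 - r))); split.
- by rewrite invr_eq0.
- have -> : (k *: u + (- (k * (1 - r)))%:A) * (k *: u + (- (k * (1 - r)))%:A) =
      (k * k * (2 * r - 1)) *: u + (k * k * (c + (1 - r) * (1 - r)))%:A.
    by nc_expand; rewrite u2; nc.
  have -> : k * k * (c + (1 - r) * (1 - r)) = k * (k * (2 * r - 1)) * (r - 1).
    by rewrite cE; ring.
  by rewrite -(mulrA k k (2 * r - 1)) kk !mulr1; congr (_ + _ *: _); ring.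
exists (2 * r - 1); rewrite scalerDr !scalerA (mulrC _ k) kk scale1r mulrN mulrA (mulrC _ k) kk.
by nc.
Qed.

End SplitRoots.

Section SplitAlternating.

Variables (E : fieldType) (G : 'M[E]_8).
Hypotheses (Galt : alternating_mx G) (Gunit : G \in unitmx).
Variables (u u' x : 'M[E]_8) (c c' r s : E).
Hypotheses (ru : etale_root u c) (ru' : etale_root u' c') (uu' : u * u' = u' * u).
Hypotheses (ruE : r * r = r + c) (suE : s * s = s + c').
Hypotheses (uG : u^T *m G = G *m u) (u'G : u'^T *m G = G *m u').
Hypotheses (xu : x * u = u * x) (xu' : x * u' = u' * x) (xG : alternating_mx (G *m x)).
Hypothesis indep : forall a b d, a%:A + b *: u + d *: u' + u * u' != 0.

Let adj (p : 'M[E]_8) := p^T *m G = G *m p.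

Let adj_lin k a (w : 'M[E]_8) : adj w -> adj (k *: w + a%:A).
Proof.
rewrite /adj => aw; rewrite linearD !linearZ /= mulmxDl mulmxDr -!scalemxAl -!scalemxAr aw.
by rewrite trmx1 mul1mx mulmx1.
Qed.

Lemma split_component k a k' b : k != 0 -> k' != 0 ->
    let e := k *: u + a%:A in let f := k' *: u' + b%:A in
    e * e = e -> f * f = f ->
  [/\ (e * f) * (e * f) = e * f, (2 <= \rank (e * f)%R)%N
    & \rank (e * f)%R = 2%N -> exists l, x * (e * f) = l *: (e * f)].
Proof.
move=> k0 k'0 e f ee ff; have ef : e * f = f * e by rewrite /e /f; nc_expand; rewrite uu'; nc.
have pp : (e * f) * (e * f) = e * f by rewrite mulrA -(mulrA e f) -ef mulrA ee -mulrA ff.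
have adjp : adj (e * f).
  have ae : adj e by apply: adj_lin.
  have af : adj f by apply: adj_lin.
  rewrite /adj -[e * f]/(e *m f) trmx_mul -mulmxA ae mulmxA af -mulmxA.
  by congr (_ *m _); exact: esym.
have xe : x * e = e * x by rewrite /e; nc_expand; rewrite xu; nc.
have xf : x * f = f * x by rewrite /f; nc_expand; rewrite xu'; nc.
split=> //.
  apply: (alternating_rank Galt Gunit pp adjp); apply: contra (indep ((k * k')^-1 * (a * b)) (k'^-1 * b) (k^-1 * a)).
  move=> /eqP e0; apply/eqP; apply: (scalerI (mulf_neq0 k0 k'0)); rewrite scaler0 -[RHS]e0 /e /f.
  rewrite !scalerDr !scalerA mulrA divff ?mulf_neq0 // mul1r.
  rewrite -(mulrA k) (mulrA k') divff // mul1r (mulrAC k) (mulrA k) divff // mul1r.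
  by nc.
move=> rk; apply: (alternating_scalar Galt Gunit pp adjp rk) => //.
by rewrite -[_ *m _]/(x * (e * f)) mulrA xe -mulrA xf mulrA.
Qed.

(** The four primitive idempotents of the split algebra [E[u, u']] have rank at
    least two by alternation, hence exactly two; on each of their images [x]
    is alternating for a form of rank two, i.e. a scalar. *)
Lemma split_alternating : exists a b a' b',
  x = (a%:A + b *: u) + (a'%:A + b' *: u) * u'.
Proof.
have [k [a [k0 ee [m eu]]]] := root_idempotent ru ruE.
have [k' [b [k'0 ff [m' fu]]]] := root_idempotent ru' suE.
have e'E : 1 - (k *: u + a%:A) = (- k) *: u + (1 - a)%:A by nc.
have f'E : 1 - (k' *: u' + b%:A) = (- k') *: u' + (1 - b)%:A by nc.
have Nk0 : - k != 0 by rewrite oppr_eq0.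
have Nk'0 : - k' != 0 by rewrite oppr_eq0.
have compl (w : 'M[E]_8) : w * w = w -> (1 - w) * (1 - w) = 1 - w by move=> ww; nc_expand; rewrite ww; nc.
have ee' := compl _ ee; have ff' := compl _ ff; rewrite e'E in ee'; rewrite f'E in ff'.
have [p11 r11 s11] := split_component k0 k'0 ee ff.
have [p10 r10 s10] := split_component k0 Nk'0 ee ff'.
have [p01 r01 s01] := split_component Nk0 k'0 ee' ff.
have [p00 r00 s00] := split_component Nk0 Nk'0 ee' ff'.
rewrite -e'E in p01 r01 s01 p00 r00 s00 ee'; rewrite -f'E in p10 r10 s10 p00 r00 s00 ff'.
have cef : (k *: u + a%:A) * (k' *: u' + b%:A) = (k' *: u' + b%:A) * (k *: u + a%:A).
  by nc_expand; rewrite uu'; nc.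
have lin_e : exists p q, k *: u + a%:A = p%:A + q *: u by exists a, k; rewrite addrC.
have lin_f : exists p q, k' *: u' + b%:A = p%:A + q *: u' by exists b, k'; rewrite addrC.
move: p11 r11 s11 p10 r10 s10 p01 r01 s01 p00 r00 s00 ee ff ee' ff' cef lin_e lin_f.
move: (k *: u + a%:A) (k' *: u' + b%:A) => e f.
move=> p11 r11 s11 p10 r10 s10 p01 r01 s01 p00 r00 s00 ee ff ee' ff' cef lin_e lin_f.
have ew (w : 'M[E]_8) : e * e * w = e * w by rewrite ee.
have z1 (w : 'M[E]_8) : w * w = w -> w * (1 - w) = 0 /\ (1 - w) * w = 0.
  by move=> ww; rewrite mulrBr mulrBl mulr1 mul1r ww subrr.
have [ze ze'] := z1 _ ee; have [zf zf'] := z1 _ ff.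
have cN (w y : 'M[E]_8) : w * y = y * w -> w * (1 - y) = (1 - y) * w.
  by move=> wy; rewrite mulrBr mulrBl mulr1 mul1r wy.
have cef' := cN _ _ cef; have ce'f := esym (cN _ _ (esym cef)); have ce'f' := cN _ _ ce'f.
have orth (w y y' : 'M[E]_8) : w * y = y * w -> y * y' = 0 -> w * y' = y' * w -> (w * y) * (w * y') = 0.
  by move=> wy yy wy'; rewrite -mulrA (mulrA y) -wy -mulrA yy !mulr0.
have R1 := orthogonal_idempotent_rank p11 p10 (orth _ _ _ cef zf cef') (orth _ _ _ cef' zf' cef)
  (etrans (esym (mulrDr e f (1 - f))) (congr1 (fun y => e * y) (subrKC f 1)) ).
have R0 := orthogonal_idempotent_rank p01 p00 (orth _ _ _ ce'f zf ce'f') (orth _ _ _ ce'f' zf' ce'f)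
  (etrans (esym (mulrDr (1 - e) f (1 - f))) (congr1 (fun y => (1 - e) * y) (subrKC f 1))).
have R := orthogonal_idempotent_rank ee ee' ze ze' (subrKC e 1).
rewrite !mulr1 in R1 R0; rewrite -[X in (_ <= \rank X)%N]/(1%:M : 'M[E]_8) mxrank1 in R.
have [l11 h11] : exists l, x * (e * f) = l *: (e * f) by apply: s11; lia.
have [l10 h10] : exists l, x * (e * (1 - f)) = l *: (e * (1 - f)) by apply: s10; lia.
have [l01 h01] : exists l, x * ((1 - e) * f) = l *: ((1 - e) * f) by apply: s01; lia.
have [l00 h00] : exists l, x * ((1 - e) * (1 - f)) = l *: ((1 - e) * (1 - f)) by apply: s00; lia.
have -> : x = x * (e * f) + x * (e * (1 - f)) + x * ((1 - e) * f) + x * ((1 - e) * (1 - f)).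
  by nc.
rewrite h11 h10 h01 h00; have [p [q ->]] := lin_e; have [p' [q' ->]] := lin_f.
exists (l11 * p * p' + l10 * p * (1 - p') + l01 * (1 - p) * p' + l00 * (1 - p) * (1 - p')),
  (l11 * q * p' + l10 * q * (1 - p') - l01 * q * p' - l00 * q * (1 - p')),
  (l11 * p * q' - l10 * p * q' + l01 * (1 - p) * q' - l00 * (1 - p) * q'),
  (l11 * q * q' - l10 * q * q' - l01 * q * q' + l00 * q * q').
nc.
Qed.

End SplitAlternating.

(** * Symplectic case: reduction to split subalgebras *)

Section MatrixForms.

Lemma row_free_ker (E : fieldType) m n (C : 'M[E]_(m, n)) :
  (forall v : 'rV_m, v *m C = 0 -> v = 0) -> row_free C.
Proof.
move=> C0; rewrite -kermx_eq0; apply/eqP/row_matrixP=> i; rewrite row0; apply: C0.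
by rewrite -row_mul mulmx_ker row0.
Qed.

Lemma sub_tr_alternating (E : fieldType) n (S : 'M[E]_n) : alternating_mx (S - S^T).
Proof.
move=> v; rewrite mulmxBr mulmxBl; apply/eqP; rewrite subr_eq0; apply/eqP.
have <- : (v^T *m S *m v)^T = v^T *m S^T *m v by rewrite !trmx_mul trmxK mulmxA.
by apply/matrixP=> i j; rewrite !ord1 [RHS]mxE.
Qed.

(** Being alternating concerns more vectors after an extension of scalars; it is
    transported as the property of being [T - T^T] for a triangular [T]. *)
Lemma map_alternating (E E' : fieldType) (j : {rmorphism E -> E'}) n (S : 'M[E]_n) :
  alternating_mx S -> alternating_mx (map_mx j S).
Proof.
move=> /alternating_mxE[S0 Sn].
pose T := \matrix_(i < n, l < n) (if (i < l)%N then S i l else 0).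
suff -> : map_mx j S = map_mx j T - (map_mx j T)^T by apply: sub_tr_alternating.
apply/matrixP=> i l; rewrite !mxE; case: ltngtP => [il|li|il].
- by rewrite rmorph0 subr0.
- by rewrite (Sn i l) rmorphN rmorph0 sub0r.
by rewrite (val_inj il) S0 !rmorph0 subr0.
Qed.

Variables (E : fieldType) (n : nat) (b : {biscalar 'cV[E]_n}).

Definition gram : 'M[E]_n := \matrix_(i, j) b (delta_mx i 0) (delta_mx j 0).

Lemma gramE u v : u^T *m gram *m v = (b u v)%:M.
Proof.
have cE (w : 'cV[E]_n) : w = \sum_i w i 0 *: delta_mx i 0.
  by rewrite {1}[w]matrix_sum_delta; apply: eq_bigr => i _; rewrite big_ord1.
rewrite {2}[u]cE {2}[v]cE linear_sumlz; apply/matrixP=> p q; rewrite !ord1 mxE [RHS]mxE eqxx mulr1n.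
under [RHS]eq_bigr do rewrite linear_sumr.
rewrite exchange_big /=; apply: eq_bigr => j _; rewrite mxE mulr_suml.
apply: eq_bigr => i _; rewrite !mxE linearZl_LR linearZr_LR /=; ring.
Qed.

Lemma form_mx_eq (S T : 'M[E]_n) :
  (forall u v : 'cV_n, u^T *m S *m v = u^T *m T *m v) -> S = T.
Proof.
move=> e; apply/matrixP=> i j; have := e (delta_mx i 0) (delta_mx j 0).
by rewrite trmx_delta -!rowE -!colE => /matrixP/(_ 0 0); rewrite !mxE.
Qed.

End MatrixForms.

Section AlternatingModels.

Variables (F : fieldType) (A : falgType F) (sigma : 'End(A)).

(** A splitting of degree [8] and a Gram matrix of the alternating form, for an
    involution on [A]. That [F]-free families stay free is all that is needed from
    the isomorphism with the matrix algebra, and is stable under extension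
    of [E]. *)
Record alternating_model (E : fieldType) (iota : {rmorphism F -> E})
    (phi : A -> 'M[E]_8) (G : 'M[E]_8) : Prop := AlternatingModel {
  model_add : {morph phi : x y / x + y};
  model_scale : forall a x, phi (a *: x) = iota a *: phi x;
  model_one : phi 1 = 1%:M;
  model_mul : forall x y, phi (x * y) = phi x *m phi y;
  model_adj : forall x, (phi x)^T *m G = G *m phi (sigma x);
  model_alternating : alternating_mx G;
  model_unit : G \in unitmx;
  model_row_free : forall n (X : n.-tuple A), free X ->
    row_free (\matrix_(i < n) mxvec (phi X`_i))
}.

Lemma model_map (E E' : fieldType) (iota : {rmorphism F -> E}) (j : {rmorphism E -> E'})
    phi G : alternating_model iota phi G ->
  alternating_model (j \o iota) (fun x => map_mx j (phi x)) (map_mx j G).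
Proof.
case=> mD mZ m1 mM mA mG mU mF; split.
- by move=> x y /=; rewrite mD map_mxD.
- by move=> a x /=; rewrite mZ map_mxZ.
- by rewrite /= m1 map_mx1.
- by move=> x y /=; rewrite mM map_mxM.
- by move=> x /=; rewrite map_trmx -!map_mxM mA.
- exact: map_alternating.
- by rewrite map_unitmx.
move=> n X /mF; rewrite -(row_free_map j); congr row_free.
by apply/row_matrixP=> i; rewrite -map_row !rowK map_mxvec.
Qed.

Section Model.

Variables (E : fieldType) (iota : {rmorphism F -> E}) (phi : A -> 'M[E]_8) (G : 'M[E]_8).
Hypothesis md : alternating_model iota phi G.

Lemma model_free n (X : n.-tuple A) (k : 'I_n -> E) : free X ->
  \sum_i k i *: phi X`_i = 0 -> forall i, k i = 0.
Proof.
move=> /(model_row_free md) rf e i; pose v := \row_i k i.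
suff /eqP/matrixP/(_ 0 i) : v == 0 by rewrite !mxE.
rewrite -(mulmx_free_eq0 _ rf) mulmx_sum_row; apply/eqP.
under eq_bigr do rewrite rowK mxE -linearZ /=.
by rewrite -linear_sum /= e linear0.
Qed.

(** For [x = a + sigma a], the matrix [G x] is [G a - (G a)^T]. *)
Lemma model_symd x : x \in Symd sigma -> alternating_mx (G *m phi x).
Proof.
case/SymdP=> a ->; rewrite (model_add md) mulmxDr -(model_adj md).
have [G0 Gn] := alternating_mxE (model_alternating md).
have -> : (phi a)^T *m G = - (G *m phi a)^T.
  rewrite trmx_mul -mulmxN; congr (_ *m _); apply/matrixP=> i j.
  by rewrite !mxE Gn.
exact: sub_tr_alternating.
Qed.

Lemma model_root u c : etale_root u c -> etale_root (phi u) (iota c).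
Proof.
case=> u2 d0; split; first by rewrite -[_ * _](model_mul md) u2 (model_add md) (model_scale md) (model_one md).
have -> : 1 + 4 * iota c = iota (1 + 4 * c) by rewrite rmorphD rmorphM rmorph1 rmorph_nat.
by rewrite fmorph_eq0.
Qed.

Lemma split_model_centralizer (L : {aspace A}) u u' c c' r s x :
    (L <= Sym sigma)%VS -> biquadratic_pair L u u' c c' ->
    r * r = r + iota c -> s * s = s + iota c' -> x \in Symd sigma ->
  (forall y, y \in L -> x * y = y * x) -> x \in L.
Proof.
move=> LS bp rr ss xS xL; have uL := pair_mem1 bp; have u'L := pair_mem2 bp.
have sL y : y \in L -> sigma y = y by move/(subvP LS)/fixedSpaceP.
have mM := model_mul md; have mD := model_add md.
have U1 := model_root (pair_root bp); have U2 := model_root (pair_root' bp).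
have uu' := pair_comm bp.
have [|||||||a [b [a' [b' ex]]]] := @split_alternating E G (model_alternating md)
   (model_unit md) (phi u) (phi u') (phi x) _ _ r s U1 U2 _ rr ss _ _ _ _ _.
- by rewrite -[LHS]mM -[RHS]mM uu'.
- by rewrite (model_adj md) sL.
- by rewrite (model_adj md) sL.
- by rewrite -[LHS]mM -[RHS]mM xL.
- by rewrite -[LHS]mM -[RHS]mM xL.
- exact: model_symd.
- move=> a b d; apply/eqP=> e.
  pose k (i : 'I_4) := nth 0 [:: a; b; d; 1] i.
  have h := @model_free 4 [tuple 1; u; u'; u * u'] k (pair_free bp).
  suff /h/(_ ord_max)/eqP : \sum_i k i *: phi [tuple 1; u; u'; u * u']`_i = 0.
    by rewrite /k /= oner_eq0.
  rewrite !big_ord_recl big_ord0 /k /= (model_one md) mM scale1r addr0 -[RHS]e.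
  by rewrite -[_ *m _]/(phi u * phi u') -[1%:M]/(1 : 'M[E]_8) !addrA.
apply: contraT => nx; have fr : free [:: x; 1; u; u'; u * u'].
  by rewrite free_cons (pair_free bp) andbT -(pair_span bp).
pose k (i : 'I_5) := nth 0 [:: -1; a; b; a'; b'] i.
have h := @model_free 5 [tuple x; 1; u; u'; u * u'] k fr.
suff /h/(_ ord0)/eqP : \sum_i k i *: phi [tuple x; 1; u; u'; u * u']`_i = 0.
  by rewrite /k /= oppr_eq0 oner_eq0.
rewrite !big_ord_recl big_ord0 /k /= (model_one md) mM ex addr0.
by rewrite -[phi u *m phi u']/(phi u * phi u') -[1%:M]/(1 : 'M[E]_8); nc.
Qed.

End Model.

(** The conclusion being boolean, one may assume that it fails; then the
    polynomial has no root in [E], hence is irreducible. *)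
Lemma with_root (E : fieldType) (c : E) (goal : bool) :
  (forall (E' : fieldType) (j : {rmorphism E -> E'}) r, r * r = r + j c -> goal) -> goal.
Proof.
move=> rg; apply: contraT => ng; pose p : {poly E} := 'X^2 - ('X + c%:P).
have sp : size p = 3.
  by rewrite size_polyDl ?size_polyXn // size_polyN (leq_ltn_trans (size_polyD _ _)) //
     size_polyX size_polyC gtn_max /=; case: eqP.
have [|K _ [z /rootP rz _]] := @irredp_FAdjoin E p.
  apply: cubic_irreducible => [|z]; first by rewrite sp.
  apply: contra ng => /rootP; rewrite !hornerE => /eqP; rewrite subr_eq0 => /eqP e.
  by apply: (rg E idfun z); rewrite -expr2 e.
apply: contraR ng => _; apply: (rg K (GRing.in_alg K) z); apply/eqP.
rewrite -subr_eq0 -rz /p rmorphB rmorphD /= map_polyXn map_polyX map_polyC !hornerE.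
by rewrite expr2.
Qed.

Lemma model_centralizer (E : fieldType) (iota : {rmorphism F -> E}) phi G
    (L : {aspace A}) u u' c c' x :
    alternating_model iota phi G ->
    (L <= Sym sigma)%VS -> biquadratic_pair L u u' c c' -> x \in Symd sigma ->
  (forall y, y \in L -> x * y = y * x) -> x \in L.
Proof.
move=> md LS bp xS xL; apply: (with_root (c := iota c)) => E1 j r rr.
apply: (with_root (c := j (iota c'))) => E2 j' s ss.
apply: (split_model_centralizer (model_map j' (model_map j md)) LS bp (r := j' r) (s := s)) => //=.
by rewrite -rmorphM rr rmorphD.
Qed.

End AlternatingModels.

(** * The frame of a neat subalgebra *)

Section Frames.

Variables (F : fieldType) (A : falgType F) (sigma : 'End(A)).
Hypothesis hA : algebra_with_involution sigma.
Local Notation Z := 'Z({:A})%AS.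

Lemma splitting_dim (E : fieldType) (iota : {rmorphism F -> E}) n (phi : A -> 'M[E]_n) :
  splitting iota phi -> \dim {:A} = (n * n)%N.
Proof.
case=> _ _ _ _ /andP[/eqP sp /eqP fr].
by rewrite -(size_tuple (vbasis {:A})) -(size_map phi) -fr sp dimvf.
Qed.

(** The rows are the products of the coordinates of the family, over [F], with an
    invertible matrix; and the rank is insensitive to field extensions. *)
Lemma splitting_row_free (E : fieldType) (iota : {rmorphism F -> E}) n (phi : A -> 'M[E]_n) :
    splitting iota phi -> forall m (X : m.-tuple A), free X ->
  row_free (\matrix_(i < m) mxvec (phi X`_i)).
Proof.
case=> mD mZ _ _ /andP[_ fr] m X fX; pose d := \dim {:A}.
pose B : 'M_(d, _) := \matrix_(i < d) mxvec (phi (vbasis {:A})`_i).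
pose C : 'M_(m, d) := \matrix_(i < m, j < d) vcoord j X`_i.
have phi0 : phi 0 = 0 by rewrite -(scale0r 0) mZ rmorph0 scale0r.
have -> : \matrix_(i < m) mxvec (phi X`_i) = map_mx iota C *m B.
  apply/row_matrixP=> i; rewrite rowK row_mul mulmx_sum_row.
  rewrite {1}(coord_vbasis (memvf X`_i)) (big_morph phi mD phi0) linear_sum.
  by apply: eq_bigr => j _; rewrite mZ linearZ !mxE rowK.
have rB : row_free B.
  apply: row_free_ker => v; rewrite mulmx_sum_row => e.
  have /freeP fr' : free (map_tuple phi (vbasis {:A})) by [].
  apply/rowP=> i; rewrite [RHS]mxE; apply: (fr' (fun i => v 0 i)).
  apply: (can_inj mxvecK); rewrite linear0 -[RHS]e linear_sum; apply: eq_bigr => j _.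
  by rewrite rowK linearZ /= (nth_map 0) // size_tuple.
rewrite /row_free mxrankMfree // mxrank_map; apply: row_free_ker => v vC.
apply/rowP=> i; rewrite [RHS]mxE; move/freeP: fX => fX; apply: (fX (fun i => v 0 i)).
apply: vcoord_inj => j; rewrite vcoord0 /vcoord linear_sum.
have /rowP/(_ j) := vC; rewrite !mxE => e; rewrite -[RHS]e; apply: eq_bigr => l _.
by rewrite linearZ /= mxE.
Qed.

Lemma degree_dim n : has_degree sigma n ->
  \dim {:A} = (2 * n ^ 2)%N \/ \dim {:A} = (n ^ 2 * \dim Z)%N.
Proof.
case=> [[A0 [f [_ /switch_dim dA dA0]]]|[_ dA]]; last by right.
by left; rewrite -dA0 -dA.
Qed.

Lemma square_degree n : (n * n = 2 * 8 ^ 2 \/ n * n = 8 ^ 2 * 1)%N -> n = 8%N.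
Proof.
move=> dn; have le12 : (n <= 12)%N.
  by rewrite leqNgt; apply/negP=> h; have := leq_mul h h; case: dn => ->.
by move: dn le12; do 13 (case: n => [|n]; first by case).
Qed.

(** A degree [8] of the second kind would give [n ^ 2 = 128]. *)
Lemma symplectic_model : symplectic_involution sigma -> has_degree sigma 8 ->
  \dim {:A} = 64%N /\ exists (E : fieldType) (iota : {rmorphism F -> E}) phi G,
    alternating_model sigma iota phi G.
Proof.
move=> [eZ [E [iota [n [phi [b [sp adj nd alt]]]]]]] /degree_dim.
have dZ : \dim Z = 1%N by rewrite (_ : Z = 1%VS :> {vspace A}) ?dimv1.
rewrite dZ (splitting_dim sp) => dn; have n8 := square_degree dn.
subst n; split=> //; exists E, iota, phi, (gram b).
have rf := splitting_row_free sp; have [mD mZ m1 mM _] := sp; split=> //.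
- move=> x; apply: form_mx_eq => u v.
  by rewrite mulmxA -trmx_mul gramE adj -gramE !mulmxA.
- by move=> v; rewrite gramE alt raddf0.
rewrite -row_free_unit; apply: row_free_ker => v vG; apply: (can_inj trmxK).
rewrite trmx0; apply: nd => w; have := gramE b v^T w.
rewrite trmxK vG mul0mx => /matrixP/(_ 0 0); rewrite !mxE eqxx mulr1n => <- //.
Qed.

Lemma centre_dim : \dim Z = 1%N \/ \dim Z = 2%N.
Proof.
case: (centre_cases hA) => [->|[t [d [_ _ _ gZ]]]]; first by left; rewrite dimv1.
have le2 : (\dim Z <= 2)%N.
  apply: leq_trans (dim_span [:: 1; t]); apply: dimvS; apply/subvP=> z /gZ[a [b ->]].
  by apply/span_quadP; exists a, b.
have : (0 < \dim Z)%N.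
  rewrite lt0n dimv_eq0; apply: contraNneq (oner_neq0 A) => z0; rewrite -memv0 -z0.
  by apply/centerP=> y; rewrite mul1r mulr1.
by move: le2; case: (\dim Z) => [|[|[|]]] // _ _; [left | right].
Qed.

Lemma capacity_dim : has_capacity sigma 4 -> exists j, \dim {:A} = (2 ^ (4 + j))%N.
Proof.
case=> [[_ /degree_dim[->|->]]|[sp hd]].
- by exists 1%N.
- by case: centre_dim => ->; [exists 0%N | exists 1%N].
by have [-> _] := symplectic_model sp hd; exists 2.
Qed.

Lemma neat_frame (L : {aspace A}) : 1 \in Symd sigma -> has_capacity sigma 4 ->
  neat sigma L -> biquadratic L -> symmetric_frame sigma L.
Proof.
move=> h1 hc [L1 etL LS _ _] bL.
have [u [u' [c [c' bp]]]] := biquadratic_generators L1 etL bL.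
have genA := involution_idempotents hA; have [sM sK _ _] := hA.
have Lred := etale_reduced etL; have dL : \dim L = 4%N by case: bL.
have Lcomm x y := pair_commutative bp (x := x) (y := y).
split=> //; first exact: semiprime_fullv.
- move=> x xS xL; case: hc => [[_ hd]|[sp hd]]; last first.
    have [_ [E [iota [phi [G md]]]]] := symplectic_model sp hd.
    exact: model_centralizer md LS bp xS xL.
  apply: (degree_centralizer hA L1 LS dL Lcomm Lred hd) => //.
  by have /SymdP[a ->] := xS; rewrite linearD /= sK addrC.
move=> n X a fX XL; apply: (center_free_tensor genA) => z zZ.
by apply: (sym_center_free hA fX) => // i; apply: (subvP LS).
Qed.

End Frames.

(** * The equivalences *)

Section PfisterForms.

Variables (F : fieldType) (A : falgType F) (sigma : 'End(A)) (L : {aspace A}).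
Hypotheses (fr : symmetric_frame sigma L) (L1 : 1 \in L).

Lemma pair_root_notin u u' c c' : biquadratic_pair L u u' c c' -> u \notin 1%VS.
Proof.
move=> bp; apply/vlineP=> -[a ea]; have [|_ /eqP + _ _] := @pair_indep _ _ _ _ _ _ _ bp (- a) 1 0 0.
  by rewrite ea; nc.
by rewrite oner_eq0.
Qed.

Section Galois.

Variables (u u' : A) (c c' : F) (g : 'AEnd(subvs_of L)).
Hypotheses (bp : biquadratic_pair L u u' c c') (cg : conjugates u u' g).
Local Notation fix_g := (fixedSpace_aspace g).
Local Notation pr x := (vsproj fix_g (vsproj L x)).

Lemma proj_fixed x : in_quad u x -> vsval (pr x) = vsproj L x.
Proof.
move=> qx; rewrite vsprojK //; apply/fixedSpaceP; apply: subvs_inj.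
rewrite -/(act g x) (conjugates_quad L1 cg qx) vsprojK //.
exact: in_quad_mem L1 (pair_mem1 bp) qx.
Qed.

Lemma proj_fixed1 : pr 1 = 1.
Proof.
apply: subvs_inj; rewrite (proj_fixed (in_quad1 u)) vsproj1 // vsval_one //.
by apply/fixedSpaceP; rewrite rmorph1.
Qed.

Lemma Wform_pair (s : 'Hom(subvs_of fix_g, F^o)) : lker s = 1%VS ->
  exists2 s0 : F, s0 != 0 & forall (x : subvs_of (Wspace sigma g)) a b,
    vsval x * vsval x = a%:A + b *: u -> Wform s x = s0 * b.
Proof.
move=> ks; have qu : in_quad u u by exists 0, 1; rewrite scale0r scale1r add0r.
have s1 : s (pr 1) = 0.
  by apply/eqP; rewrite -memv_ker ks proj_fixed1; apply: memv_line.
exists (s (pr u)).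
  apply: contra (pair_root_notin bp) => su0; have : pr u \in lker s by rewrite memv_ker; exact: su0.
  rewrite ks => /vlineP[a].
  move/(congr1 vsval); rewrite (proj_fixed qu) -proj_fixed1 linearZ /=.
  rewrite (proj_fixed (in_quad1 u)) => /(congr1 vsval); rewrite linearZ /= !vsprojK //.
    by move=> ->; apply/vlineP; exists a.
  exact: pair_mem1 bp.
move=> x a b e; rewrite /Wform expr2 e !linearD !linearZ /= s1 scaler0 add0r.
exact: mulrC.
Qed.

Lemma coefficient_form : exists s : 'Hom(subvs_of fix_g, F^o), lker s = 1%VS.
Proof.
have qu : in_quad u u by exists 0, 1; rewrite scale0r scale1r add0r.
have uL := pair_mem1 bp.
have fixE (y : subvs_of fix_g) : exists a b, y = a *: 1 + b *: pr u.
  have [||a [b e]] := @conjugates_fixed _ _ _ L1 _ _ _ _ bp g (vsval (vsval y)) cg; rewrite ?subvsP //.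
    by rewrite /act vsvalK (fixedSpaceP (subvsP y)).
  exists a, b; apply: subvs_inj; apply: subvs_inj; rewrite e -proj_fixed1 /=.
  by rewrite (proj_fixed (in_quad1 u)) (proj_fixed qu) !vsprojK.
have nu : pr u \notin 1%VS.
  apply: contra (pair_root_notin bp) => /vlineP[a].
  move/(congr1 vsval); rewrite (proj_fixed qu) -proj_fixed1 linearZ /=.
  rewrite (proj_fixed (in_quad1 u)) => /(congr1 vsval); rewrite linearZ /= !vsprojK // => ->.
  by apply/vlineP; exists a.
have frf : free [:: 1; pr u] by rewrite /free dim_span_quad.
have [f] := linear_of_free [:: 1; pr u] [:: (0 : F^o); 1].
move/(_ frf erefl) => /= [f1 fu]; exists (linfun f); apply/vspaceP=> y.
rewrite memv_ker lfunE /=; have [a [b ->]] := fixE y.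
rewrite linearD !linearZ /= fu f1 scaler0 add0r; apply/idP/idP.
  rewrite scaler_eq0 oner_eq0 orbF => /eqP ->; rewrite scale0r addr0.
  by apply/vlineP; exists a.
case/vlineP=> a' e; apply: contraR nu => b0.
have {}b0 : b != 0 by apply: contraNneq b0 => ->; rewrite scale0r.
apply/vlineP; exists (b^-1 * (a' - a)).
rewrite -scalerA scalerBl -e addrAC subrr add0r scalerA mulVf // scale1r //.
Qed.

End Galois.

(** By [galois_pair] the decomposition along the given pair induces one for each
    automorphism, so that all forms are hyperbolic of the same dimension. *)
Lemma decomposing_Pfister u u' c c' j : biquadratic_pair L u u' c c' ->
    decomposing_pair sigma u u' -> \dim {:A} = (2 ^ (4 + j))%N ->
  Pfister_form_hyperbolic sigma L.
Proof.
move=> bp dec dA; exists _, (@hyperbolic_form F (2 ^ j)); split; last first.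
  exists (2 ^ j)%N, \1%VF; split; last by move=> v; rewrite id_lfunE.
  by exists id => x; rewrite id_lfunE.
split; first by rewrite dA trunc_expnK //; apply: pfister_hyperbolic.
move=> g s gal ks; have [v [v' [d [d' [bp' cg decE]]]]] := galois_pair L1 bp gal.
have [s0 s00 sE] := Wform_pair bp' cg ks.
have [m [dm m0 [f [f_bij fE]]]] := decomposing_hyperbolic fr bp' (decE _ fr dec)
  (Wspace_pair L1 sigma bp' cg) s00 sE.
have em : m = (2 ^ j)%N by apply/eqP; rewrite -(eqn_pmul2l (isT : 0 < 16)%N) -dm dA expnD.
subst m; exists 1; first exact: oner_neq0.
by exists f; split=> // x; rewrite mul1r -fE.
Qed.

(** A hyperbolic form of positive dimension is isotropic, and an isotropic vector
    of [x |-> s (x ^ 2)] is an element of [Wvs u u'] with scalar square. *)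
Lemma Pfister_decomposing u u' c c' (K : {aspace A}) : biquadratic_pair L u u' c c' ->
    1 \in K -> etale (subvs_of K) -> K = span [:: 1; u] :> {vspace A} ->
  Pfister_form_hyperbolic sigma L -> decomposing_pair sigma u u'.
Proof.
move=> bp K1 etK eK [V [P [[_ simP] [m [h [h_bij hE]]]]]].
have [g [cg gg]] := pair_automorphism L1 bp.
have gal := conjugates_galois L1 bp cg gg K1 etK eK.
have [s ks] := coefficient_form bp cg.
have [s0 s00 sE] := Wform_pair bp cg ks.
have eW := Wspace_pair L1 sigma bp cg.
have [k k0 [f [f_bij fE]]] := simP g s gal ks.
have m0 : (0 < m)%N.
  rewrite lt0n; apply/eqP=> m0; subst m.
  have [y [yW _ y0]] := W_idempotent fr bp (in_quad1 u) (mulr1 1) (oner_neq0 _).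
  have yW' : y \in Wspace sigma g by rewrite eW.
  have : h (f (vsproj (Wspace sigma g) y)) = h (f 0).
    case: (h _) (h _) => p1 p2 [q1 q2]; congr (_, _); apply/rowP; by case.
  move/(bij_inj h_bij)/(bij_inj f_bij)/(congr1 vsval); rewrite vsprojK // linear0 => e.
  by move: y0; rewrite e mul0r eqxx.
case: m h h_bij hE m0 => // m h h_bij hE _.
have [h' hK h'K] := h_bij; have [f' fK f'K] := f_bij.
pose e := f' (h' (const_mx 1, 0)).
have he : h (f e) = (const_mx 1, 0) by rewrite /e f'K h'K.
have We : Wform s e = 0.
  have /eqP : k * Wform s e = 0.
    by rewrite -fE -hE he /=; apply: big1 => i _; rewrite [X in _ * X]mxE mulr0.
  by rewrite mulf_eq0 (negPf k0) => /eqP.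
have eW' : vsval e \in Wvs sigma u u' by rewrite -eW subvsP.
have e0 : vsval e != 0.
  apply/eqP=> e0; have : h (f e) = 0 by rewrite (_ : e = 0) ?linear0 //; apply: subvs_inj.
  rewrite he => /(congr1 (fun p : 'rV[F]_m.+1 * 'rV[F]_m.+1 => p.1 0 0)) /=; rewrite !mxE => /eqP.
  by rewrite oner_eq0.
have [a [b ee]] := W_square fr bp eW'.
have b0 : b = 0.
  have := sE e a b ee; rewrite We => /esym/eqP; rewrite mulf_eq0 (negPf s00) => /eqP //.
rewrite b0 scale0r addr0 in ee.
have [x [a' [xW a'0 xx]]] := W_invertible_square fr bp eW' e0 (ex_intro _ a ee).
exact (W_decomposing fr bp xW a'0 xx).
Qed.

End PfisterForms.

Section Converses.

Variables (F : fieldType) (A : falgType F) (sigma : 'End(A)) (L : {aspace A}).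
Hypotheses (fr : symmetric_frame sigma L) (L1 : 1 \in L).

Lemma decomposable_quad_decomposing (K : {aspace A}) u u' c c' :
    biquadratic_pair L u u' c c' -> K = span [:: 1; u] :> {vspace A} -> \dim K = 2%N ->
  decomposable_along sigma K -> decomposing_pair sigma u u'.
Proof.
move=> bp eK dK [r [Q [dr qQ sQ _ dQ]]].
case: r Q dr qQ sQ dQ => [|r] Q dr qQ sQ dQ; first by rewrite dK in dr.
have uK : u \in K by rewrite eK memv_span // !inE eqxx orbT.
have uQ : u \in Q ord0.
  suff : u \in (Q ord0 :&: K)%VS by rewrite memv_cap => /andP[].
  rewrite (_ : (Q ord0 :&: K)%VS = K) //; apply/eqP.
  by rewrite eqEdim capvSr dK (dQ ord0).
apply: (stable_quaternion_decomposing (frame_anti fr) (qQ ord0) (sQ ord0) uQ (pair_root bp) _ _ fr bp).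
  by rewrite -dim_span_quad -eK dK.
exact (frame_fix fr (pair_mem1 bp)).
Qed.

(** The generators of the intersections of [L] with the two quaternion algebras
    form a pair: an element [v] of the first algebra that flips [u] commutes
    with [u'], which makes [1], [u] independent over [F[u']]. *)
Lemma decomposable_decomposing (etL : etale (subvs_of L)) :
    (forall x y, x \in L -> y \in L -> x * y = y * x) -> \dim L = 4%N ->
    decomposable_along sigma L ->
  exists u u' c c', biquadratic_pair L u u' c c' /\ decomposing_pair sigma u u'.
Proof.
move=> Lcomm dL [r [Q [dr qQ sQ cQ dQ]]].
case: r Q dr qQ sQ cQ dQ => [|[|r]] Q dr qQ sQ cQ dQ; [by rewrite dL in dr | by rewrite dL in dr | ].
have gen i : exists u c, [/\ etale_root u c, u \in Q i, u \in L & u \notin 1%VS].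
  have [Q1 _ _] := qQ i.
  have asp : is_aspace (Q i :&: L)%VS.
    apply/andP; split; last first.
      by apply/prodvP=> x y; rewrite !memv_cap => /andP[xQ xL] /andP[yQ yL]; rewrite !memvM.
    apply/has_algidP; exists 1; split; rewrite ?oner_neq0 ?memv_cap ?Q1 //.
    by move=> x _; rewrite mul1r mulr1.
  have M1 : 1 \in ASpace asp by rewrite memv_cap Q1 L1.
  have [u [c [ru uM eM]]] := etale_generator L1 etL (M := ASpace asp) (capvSr _ _) M1 (dQ i).
  move: uM; rewrite memv_cap => /andP[uQ uL]; exists u, c; split=> //.
  by rewrite -dim_span_quad -eM; apply/eqP/dQ.
have [u [c [ru uQ uL uF]]] := gen ord0; have [u' [c' [ru' u'Q u'L u'F]]] := gen ord_max.
have su := frame_fix fr uL.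
have [v [b [vQ fv vv b0 _]]] := stable_quaternion (frame_anti fr) (qQ ord0) (sQ ord0) uQ ru uF su.
have vu' : v * u' = u' * v.
  by have /centvsP := cQ ord0 ord_max isT; apply.
have uu' := Lcomm _ _ uL u'L.
have fr4 : free [:: 1; u; u'; u * u'].
  apply/freeP=> k; rewrite !big_ord_recl big_ord0 addr0 /=.
  set k0 := k _; set k1 := k _; set k2 := k _; set k3 := k _ => e.
  have e1 : k1%:A + k3 *: u' = 0.
    apply: (etale_root_cancel ru); apply: (scalerI b0); rewrite scaler0.
    have : v * (k0 *: 1 + (k1 *: u + (k2 *: u' + k3 *: (u * u')))) * v
        - (k0 *: 1 + (k1 *: u + (k2 *: u' + k3 *: (u * u')))) * (v * v) = 0.
      by rewrite e mulr0 !mul0r subrr.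
    move/(congr1 -%R); rewrite oppr0 => <-; rewrite vv.
    have -> : v * (k0 *: 1 + (k1 *: u + (k2 *: u' + k3 *: (u * u')))) =
       (k0 *: 1 + (k1 *: (1 - u) + (k2 *: u' + k3 *: ((1 - u) * u')))) * v.
      by nc_expand; rewrite vu' (commA _ vu') fv; nc_expand; rewrite ?(commA _ vu') ?vu'; nc.
    by rewrite -mulrA vv; nc.
  have [k10 k30] := quad_indep u'F e1.
  have [|k00 k20] := @quad_indep _ _ u' k0 k2 u'F.
    by rewrite -[RHS]e k10 k30 !scale0r addr0 add0r.
  case=> [[|[|[|[|i]]]] lti] //.
  - by rewrite -[RHS]k00; congr k; apply: val_inj.
  - by rewrite -[RHS]k10; congr k; apply: val_inj.
  - by rewrite -[RHS]k20; congr k; apply: val_inj.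
  by rewrite -[RHS]k30; congr k; apply: val_inj.
have bp : biquadratic_pair L u u' c c'.
  split=> //; apply/esym/eqP; rewrite eqEdim dL (eqP fr4) andbT; apply/span_subvP=> x.
  by rewrite !inE => /or4P[] /eqP -> //; rewrite memvM.
exists u, u', c, c'; split=> //.
exact: (stable_quaternion_decomposing (frame_anti fr) (qQ ord0) (sQ ord0) uQ ru uF su fr bp).
Qed.

End Converses.

Theorem proposition7p6 (F : fieldType) (A : falgType F) (sigma : 'End(A))
    (hA : algebra_with_involution sigma)
    (h1 : 1 \in Symd sigma)
    (hcap : has_capacity sigma 4)
    (L : {aspace A}) (hL : neat sigma L) (hL4 : biquadratic L)
    (K : {aspace A}) (hK : neat sigma K) (hK2 : quadratic K)
    (hKL : (K <= L)%VS) :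
  (Pfister_form_hyperbolic sigma L <-> decomposable_along sigma L) /\
  (decomposable_along sigma L <-> decomposable_along sigma K).
Proof.
have [L1 etL _ frL _] := hL; have [K1 etK _ frK _] := hK.
have fr := neat_frame hA h1 hcap hL hL4.
have [j dA] := capacity_dim hA hcap.
have dL : \dim L = 4%N by case: hL4.
have [u [u' [c [c' [bp eK]]]]] := neat_pair L1 etL hL4 frL hKL K1 hK2 frK.
have Lcomm x y := pair_commutative bp (x := x) (y := y).
have i_dec := Pfister_decomposing fr L1 bp K1 etK eK.
have dec_ii := decomposing_decomposable fr L1 bp.
have dec_iii dec := decomposing_decomposable_quad fr L1 bp dec eK.
have iii_dec := decomposable_quad_decomposing fr bp eK hK2.
have ii_i : decomposable_along sigma L -> Pfister_form_hyperbolic sigma L.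
  case/(decomposable_decomposing fr L1 etL Lcomm dL) => [w [w' [d [d' [bp' dec]]]]].
  exact (decomposing_Pfister fr L1 bp' dec dA).
split; split; [by move/i_dec/dec_ii | exact: ii_i | by move/ii_i/i_dec/dec_iii | by move/iii_dec/dec_ii].
Qed.
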